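(* Let $\boldsymbol{k} \in \mathbb{Z}_+^m$ be a partition of $n$, and let $\mathbb{T}^m$ and $\mathrm{U}(\boldsymbol{k})$ be the corresponding subgroups of $\mathrm{U}(n)$. Let $a \in L^\infty(\mathbb{B}^n)^{\mathbb{T}^m}$ be given and consider the symbol $\widehat{a} \in L^\infty(\mathbb{B}^n)^{\mathrm{U}(\boldsymbol{k})}$ defined by \[ \widehat{a}(z) = \int_{\mathrm{U}(\boldsymbol{k})} a(A^{-1}z)\, d\mu(A), \qquad z\in\mathbb{B}^n, \] where $\mu$ is the Haar probability measure of $\mathrm{U}(\boldsymbol{k})$. Then, for every $\lambda > -1$ we have \[ \mathrm{tr}(T_a^{(\lambda)}|_{\mathcal{P}_{\boldsymbol{\kappa}}(\mathbb{C}^n)}) = \mathrm{tr}(T_{\widehat{a}}^{(\lambda)}|_{\mathcal{P}_{\boldsymbol{\kappa}}(\mathbb{C}^n)}) \] for every $\boldsymbol{\kappa} \in \mathbb{N}^m$. In particular, \[ \gamma_{\lambda,\widehat{a}}(\boldsymbol{\kappa}) = \frac{\mathrm{tr}(T_a^{(\lambda)}|_{\mathcal{P}_{\boldsymbol{\kappa}}(\mathbb{C}^n)})}{\dim \mathcal{P}_{\boldsymbol{\kappa}}(\mathbb{C}^n)} \] for every $\boldsymbol{\kappa} \in \mathbb{N}^m$.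
   Context: Here $\mathbb{N}=\{0,1,2,\dots\}$ and $\mathbb{Z}_+$ is the set of positive integers. $\mathbb{B}^n$ is the open unit ball of $\mathbb{C}^n$ with Lebesgue measure $v$. For $\lambda>-1$, $dv_\lambda(z) = c_\lambda (1-|z|^2)^\lambda dv(z)$ with $c_\lambda = \frac{\Gamma(n+\lambda+1)}{\pi^n\Gamma(\lambda+1)}$, and $\mathcal{A}^2_\lambda(\mathbb{B}^n)$ is the closed subspace of holomorphic functions in $L^2(\mathbb{B}^n,v_\lambda)$, with orthogonal projection $B_\lambda$. For $a\in L^\infty(\mathbb{B}^n)$ the Toeplitz operator is $T_a^{(\lambda)}(f)=B_\lambda(af)$ on $\mathcal{A}^2_\lambda(\mathbb{B}^n)$. For a subgroup $H\subset\mathrm{U}(n)$, $L^\infty(\mathbb{B}^n)^H$ is the space of $a\in L^\infty(\mathbb{B}^n)$ with $a\circ A=a$ for all $A\in H$. A partition of $n$ is $\boldsymbol{k}=(k_1,\dots,k_m)\in\mathbb{Z}_+^m$ with $k_1+\dots+k_m=n$. It gives $\mathbb{C}^n=\mathbb{C}^{k_1}\times\dots\times\mathbb{C}^{k_m}$, $z=(z_{(1)},\dots,z_{(m)})$ and, for multi-indices, $\alpha=(\alpha_{(1)},\dots,\alpha_{(m)})\in\mathbb{N}^n$ with $\alpha_{(j)}\in\mathbb{N}^{k_j}$. $\mathrm{U}(\boldsymbol{k})=\mathrm{U}(k_1)\times\dots\times\mathrm{U}(k_m)$ is embedded block diagonally in $\mathrm{U}(n)$ and $\mathbb{T}^m=\{(t_1I_{(1)},\dots,t_mI_{(m)})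 : t_j\in\mathbb{T}\}$ is its center, where $I_{(j)}$ is the identity on $\mathbb{C}^{k_j}$. For $\boldsymbol{\kappa}\in\mathbb{N}^m$, $\mathcal{P}_{\boldsymbol{\kappa}}(\mathbb{C}^n)$ is the linear span of the monomials $z^\alpha$ with $|\alpha_{(j)}|=\kappa_j$ for all $j$. $\mathcal{A}^2_\lambda(\mathbb{B}^n)$ is the Hilbert direct sum of the $\mathcal{P}_{\boldsymbol{\kappa}}(\mathbb{C}^n)$, $\boldsymbol{\kappa}\in\mathbb{N}^m$. Toeplitz operators with $\mathbb{T}^m$-invariant symbols preserve each $\mathcal{P}_{\boldsymbol{\kappa}}(\mathbb{C}^n)$, and for $b\in L^\infty(\mathbb{B}^n)^{\mathrm{U}(\boldsymbol{k})}$ the operator $T_b^{(\lambda)}$ acts on each $\mathcal{P}_{\boldsymbol{\kappa}}(\mathbb{C}^n)$ as a scalar; $\gamma_{\lambda,b}\in\ell^\infty(\mathbb{N}^m)$ denotes the sequence with $T_b^{(\lambda)}|_{\mathcal{P}_{\boldsymbol{\kappa}}(\mathbb{C}^n)}=\gamma_{\lambda,b}(\boldsymbol{\kappa})I_{\boldsymbol{\kappa}}$, $I_{\boldsymbol{\kappa}}$ being the identity of $\mathcal{P}_{\boldsymbol{\kappa}}(\mathbb{C}^n)$. *)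

(* Defs.v *)
From HB Require Import structures.
From mathcomp Require Import all_boot all_order all_algebra.
From mathcomp Require Import all_classical all_reals all_analysis.
From mathcomp Require Import complex.
Set Implicit Arguments.
Unset Strict Implicit.
Unset Printing Implicit Defensive.
Import Order.TTheory GRing.Theory Num.Theory numFieldNormedType.Exports.

Local Open Scope classical_set_scope.
Local Open Scope ring_scope.

(* [R[i]] with its usual topology, as a normed module over itself. *)
HB.instance Definition _ (R : rcfType) := NormedModule.copy R[i] R[i]^o.

(* MathComp-Analysis puts no sigma-algebra on [R[i]] or on matrices.  We give
   [R[i]] the one induced by [R * R] and matrices the product one; over [R[i]]
   these are the Borel sigma-algebras. *)

Definition complex_display : measure_display -> measure_display.
Proof. exact. Qed.

Section measurable_complex.
Context (R : realType).

Definition complex_measurable : set (set R[i]) :=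
  <<s preimage_set_system setT (fun z : R[i] => (complex.Re z, complex.Im z))
        measurable >>.

Let complex_set0 : complex_measurable set0.
Proof. exact: sigma_algebra0. Qed.

Let complex_setC A : complex_measurable A -> complex_measurable (~` A).
Proof. by move=> mA; rewrite -setTD; exact: sigma_algebraCD. Qed.

Let complex_bigcup (F : (set R[i])^nat) :
  (forall i, complex_measurable (F i)) -> complex_measurable (\bigcup_i F i).
Proof. exact: sigma_algebra_bigcup. Qed.

HB.instance Definition _ :=
  @isMeasurable.Build (complex_display default_measure_display) R[i]
    complex_measurable complex_set0 complex_setC complex_bigcup.

End measurable_complex.

Definition matrix_display : measure_display -> measure_display.
Proof. exact. Qed.

Section measurable_matrix.
Context {d : measure_display} {T : measurableType d} (p q : nat).

Definition matrix_measurable : set (set 'M[T]_(p, q)) :=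
  <<s \bigcup_(ij in [set: 'I_p * 'I_q])
        preimage_set_system setT (fun M : 'M[T]_(p, q) => M ij.1 ij.2)
          measurable >>.

Let matrix_set0 : matrix_measurable set0.
Proof. exact: sigma_algebra0. Qed.

Let matrix_setC A : matrix_measurable A -> matrix_measurable (~` A).
Proof. by move=> mA; rewrite -setTD; exact: sigma_algebraCD. Qed.

Let matrix_bigcup (F : (set 'M[T]_(p, q))^nat) :
  (forall i, matrix_measurable (F i)) -> matrix_measurable (\bigcup_i F i).
Proof. exact: sigma_algebra_bigcup. Qed.

HB.instance Definition _ := @isMeasurable.Build (matrix_display d)
  'M[T]_(p, q) matrix_measurable matrix_set0 matrix_setC matrix_bigcup.

End measurable_matrix.

Section lebesgue_Cn.
Context (R : realType).

Lemma measurable_complexP d (T : measurableType d) (f : T -> R[i]) :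
  measurable_fun setT (fun t => complex.Re (f t)) ->
  measurable_fun setT (fun t => complex.Im (f t)) -> measurable_fun setT f.
Proof.
move=> mRe mIm; apply: (measurability (rT:=R[i]) _ erefl) => _ [_ [A mA <-] <-].
by rewrite !setTI; have := measurable_fun_pair mRe mIm measurableT mA;
  rewrite setTI.
Qed.

Lemma measurable_matrixP d (T : measurableType d) d' (U : measurableType d')
    p q (f : T -> 'M[U]_(p, q)) :
  (forall i j, measurable_fun setT (fun t => f t i j)) ->
  measurable_fun setT f.
Proof.
move=> mf; apply: (measurability (rT:='M[U]_(p, q)) _ erefl) => _ [_ [ij _ [A mA <-]] <-].
by rewrite !setTI; have := mf ij.1 ij.2 measurableT A mA; rewrite setTI.
Qed.

Definition complex_cons n (p : 'cV[R[i]]_n * R * R) : 'cV[R[i]]_n.+1 :=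
  col_mx (Complex p.1.2 p.2)%:M p.1.1.

Lemma measurable_complex_cons n : measurable_fun setT (@complex_cons n).
Proof.
apply: measurable_matrixP => i j; rewrite (ord1 j) /complex_cons.
case: (@split_ordP 1 n i) => [i0 ->|i0 ->].
  rewrite (ord1 i0); apply: measurable_complexP.
    rewrite (_ : (fun _ => _) = snd \o fst).
      exact: measurableT_comp.
    by apply/funext => p; rewrite (@col_mxEu _ 1 n) mxE ?mulr1n.
  rewrite (_ : (fun _ => _) = snd) //.
  by apply/funext => p; rewrite (@col_mxEu _ 1 n) mxE ?mulr1n.
rewrite (_ : (fun _ => _) = (fun v : 'cV[R[i]]_n => v i0 0) \o (fst \o fst)).
  apply: measurableT_comp.
    move=> _ A mA; rewrite setTI; apply: sub_sigma_algebra.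
    by exists (i0, 0) => //; exists A => //; rewrite setTI.
  exact: measurableT_comp.
by apply/funext => p; rewrite (@col_mxEd _ 1 n).
Qed.

(* Lebesgue measure on [C^n = R^(2n)], as an iterated product measure. *)
Definition lebesgue_Cn_step n (mu : {measure set 'cV[R[i]]_n -> \bar R}) :
    {measure set 'cV[R[i]]_n.+1 -> \bar R} :=
  measure_function_pushforward__canonical__measure_function_Measure
    ((mu \x @lebesgue_measure R) \x @lebesgue_measure R)%E
    (@measurable_complex_cons n).

Fixpoint lebesgue_Cn n : {measure set 'cV[R[i]]_n -> \bar R} :=
  if n is n'.+1 then lebesgue_Cn_step (lebesgue_Cn n') else @dirac _ 'cV[R[i]]_0 0 R.

End lebesgue_Cn.

Section complex_integral.
Context d (T : measurableType d) (R : realType).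

Definition Cintegral (mu : {measure set T -> \bar R}) (D : set T)
    (f : T -> R[i]) : R[i] :=
  Complex (\int[mu]_(x in D) complex.Re (f x))
          (\int[mu]_(x in D) complex.Im (f x)).

End complex_integral.

Section linear_span_dimension_trace.
Context (K : fieldType) (V : lmodType K).

Definition lin_span (S : set V) : set V :=
  [set x | exists (N : nat) (c : 'I_N -> K) (s : 'I_N -> V),
     (forall i, S (s i)) /\ x = \sum_i c i *: s i].

Definition is_basis (W : set V) N (e : 'I_N -> V) :=
  (forall c : 'I_N -> K, \sum_i c i *: e i = 0 -> forall i, c i = 0) /\
  lin_span (range e) = W.

Definition fin_dim (W : set V) : nat :=
  xget 0%N [set N | exists e : 'I_N -> V, is_basis W e].

(* Trace of the restriction of [T] to a finite-dimensional subspace [W] that it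
   preserves: trace of the matrix of [T] in a basis of [W]. *)
Definition trace_on (W : set V) (T : V -> V) : K :=
  xget 0 [set t | exists (N : nat) (e : 'I_N -> V) (M : 'M[K]_N),
    [/\ is_basis W e, forall j, T (e j) = \sum_i M i j *: e i & t = \tr M]].

(* The scalar by which [T] acts on [W], when [T] acts on [W] as a scalar. *)
Definition scalar_on (W : set V) (T : V -> V) : K :=
  xget 0 [set c | forall x, W x -> T x = c *: x].

End linear_span_dimension_trace.

Local Notation normc := complex.ComplexField.Normc.normc.

Section unit_ball.
Context (R : realType) (n : nat).

Definition sqnorm (z : 'cV[R[i]]_n) : R := \sum_i normc (z i 0) ^+ 2.

Definition Bn : set 'cV[R[i]]_n := [set z | sqnorm z < 1].

Definition Linfty (a : 'cV[R[i]]_n -> R[i]) :=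
  measurable_fun Bn a /\
  exists M : R, {ae lebesgue_Cn R n, forall z, Bn z -> normc (a z) <= M}.

(* Symbols are functions on [C^n], of which only the almost everywhere class of
   the restriction to the ball matters. *)
Definition Linfty_invariant (H : set 'M[R[i]]_n) (a : 'cV[R[i]]_n -> R[i]) :=
  Linfty a /\
  forall A, H A ->
    {ae lebesgue_Cn R n, forall z, Bn z -> a (A *m z) = a z}.

End unit_ball.
Arguments Bn : clear implicits.

Section bergman.
Context (R : realType) (n : nat).

Definition Gamma (x : R) : R :=
  \int[@lebesgue_measure R]_(t in `]0, +oo[) (t `^ (x - 1) * expR (- t)).

Context (lambda : R).

(* Density of [v_lambda] with respect to the Lebesgue measure [v]. *)
Definition weight (z : 'cV[R[i]]_n) : R :=
  Gamma (n%:R + lambda + 1) / (pi ^+ n * Gamma (lambda + 1))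
  * (1 - sqnorm z) `^ lambda.

Definition L2 (f : 'cV[R[i]]_n -> R[i]) :=
  measurable_fun (Bn R n) f /\
  (\int[lebesgue_Cn R n]_(z in Bn R n) (normc (f z) ^+ 2 * weight z)%:E < +oo)%E.

Definition inner (f g : 'cV[R[i]]_n -> R[i]) : R[i] :=
  Cintegral (lebesgue_Cn R n) (Bn R n)
    (fun z => f z * conjc (g z) * real_complex R (weight z)).

(* A function on the ball is represented by its extension by zero, so that
   elements of the Bergman space are equal as soon as they agree on the ball. *)
Definition ball_restrict (f : 'cV[R[i]]_n -> R[i]) : 'cV[R[i]]_n -> R[i] :=
  patch (cst 0) (Bn R n) f.

(* [differentiable] is over the field [R[i]] here, i.e. [f] is holomorphic. *)
Definition bergman_space : set ('cV[R[i]]_n -> R[i]) :=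
  [set f | [/\ f = ball_restrict f,
               forall z, Bn R n z -> differentiable f z & L2 f]].

(* Orthogonal projection of [L2] onto the Bergman space. *)
Definition bergman_proj (f : 'cV[R[i]]_n -> R[i]) : 'cV[R[i]]_n -> R[i] :=
  xget (cst 0) [set g | bergman_space g /\
                  forall h, bergman_space h -> inner (f - g) h = 0].

Definition toeplitz (a f : 'cV[R[i]]_n -> R[i]) : 'cV[R[i]]_n -> R[i] :=
  bergman_proj (fun z => a z * f z).

End bergman.

(* [k : 'I_m -> nat] is a partition of [n := \sum_j k j].  The [i]-th coordinate
   of the [j]-th block has index [tagnat.Rank j i : 'I_n]. *)
Section partition.
Context (R : realType) (m : nat) (k : 'I_m -> nat).
Let n := (\sum_j k j)%N.

Definition Uk : set 'M[R[i]]_n :=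
  [set A | exists2 B : (forall j, 'M[R[i]]_(k j)),
     forall j, B j \is unitarymx & A = \mxdiag_(j < m) B j].

Definition Tm : set 'M[R[i]]_n :=
  [set A | exists2 t : 'I_m -> R[i],
     forall j, `|t j| = 1 & A = \mxdiag_(j < m) ((t j)%:M : 'M[R[i]]_(k j))].

Definition monomial (alpha : 'I_n -> nat) (z : 'cV[R[i]]_n) : R[i] :=
  \prod_i z i 0 ^+ alpha i.

Definition Pk (kappa : 'I_m -> nat) : set ('cV[R[i]]_n -> R[i]) :=
  lin_span [set ball_restrict (monomial alpha) | alpha in
    [set alpha : 'I_n -> nat |
      forall j, (\sum_(i < k j) alpha (tagnat.Rank j i))%N = kappa j]].

Definition gamma (lambda : R) (b : 'cV[R[i]]_n -> R[i])
    (kappa : 'I_m -> nat) : R[i] :=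
  scalar_on (Pk kappa) (toeplitz lambda b).

End partition.
Arguments Uk R {m} k.
Arguments Tm R {m} k.
Arguments Pk R {m} k kappa.
Arguments gamma {R m} k lambda b kappa.

Section haar.
Context (R : realType) (n : nat).

(* [mu], a measure on all matrices, is the Haar probability measure of the
   compact matrix group [G]. *)
Definition is_haar_probability (G : set 'M[R[i]]_n)
    (mu : probability 'M[R[i]]_n R) :=
  mu G = 1%E /\
  forall A, G A -> forall E : set 'M[R[i]]_n, measurable E ->
    mu [set B | E (A *m B)] = mu E.

Definition group_average (G : set 'M[R[i]]_n) (mu : probability 'M[R[i]]_n R)
    (a : 'cV[R[i]]_n -> R[i]) (z : 'cV[R[i]]_n) : R[i] :=
  Cintegral mu G (fun A => a (invmx A *m z)).

End haar.

(* Main.v *)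
Require Import Defs.
From HB Require Import structures.
From mathcomp Require Import all_boot all_order all_algebra.
From mathcomp Require Import all_classical all_reals all_analysis.
From mathcomp Require Import measurable_realfun complex ring lra zify.
Set Implicit Arguments.
Unset Strict Implicit.
Unset Printing Implicit Defensive.
Import Order.TTheory GRing.Theory Num.Theory numFieldNormedType.Exports.
Import complex.ComplexField.Normc.

Local Open Scope classical_set_scope.
Local Open Scope ring_scope.

Local Notation cRe := (@complex.Re _).
Local Notation cIm := (@complex.Im _).

(** The monomials are orthogonal in the Bergman space and, by the torus invariance of [a],
    [T_a] maps the degree [kappa] part into itself with matrix [<a e_p, e_q> / <e_q, e_q>].
    To identify [T_a e_p] one needs that the monomials are total: a bounded function orthogonal
    to them is orthogonal to every Bergman function [F].  For this, expand [F] into a Fourier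
    series along the rotations of each coordinate.  Goursat's theorem in logarithmic
    coordinates shows that the [q]-th coefficient is homogeneous of degree [q] in that
    coordinate, so that after all coordinates have been treated only monomials are left.

    The trace of [T_a] on the degree [kappa] part is then the integral of [a] against
    [K(z) = \sum_p |e_p(z)|^2 / <e_p, e_p>].  The group [U(k)] acts unitarily on this part,
    hence [K] is [U(k)]-invariant, and by Fubini averaging [a] over [U(k)] does not change
    the trace.

    If [a] is [U(k)]-invariant, the form [<a f, h>] is diagonal in the monomials (use diagonal
    unitaries) and invariant under the action of [U(k)], as is the form [<f, h>].  The
    ratio of their diagonals thus commutes with every matrix of the action.  An element of [U(k)]
    whose blocks have no zero entries gives a matrix of the action with a row without zeros, so
    the ratio is constant and [T_a] is a scalar, equal to the trace divided by the dimension. *)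

(** * Complex numbers and measurability *)

(** [bergman_proj] is an [xget], so computing [T_a f] means exhibiting a Bergman function, here a
    polynomial [g], and proving it unique; orthogonality has to hold against every Bergman function,
    which is where totality enters. As [a f - g] is bounded, [L1] control of Bergman functions
    suffices for the pairing, and the Fourier argument runs on the [L1] continuity of rotations.
    Holomorphic means differentiable over [R[i]] at each point, with nothing said on continuity of
    the derivative, hence Goursat's bisection. Lebesgue measure is an iterated product, so its
    unitary invariance is derived from translation invariance. For negative [lambda] the weight is
    unbounded near the sphere, and finiteness of the weighted measure is proved by integrating one
    real coordinate at a time. The symbol is bounded and invariant only almost everywhere: it is
    replaced by a bounded representative vanishing off the ball, and Tonelli together with the
    invariance of null sets shows that this changes the average on a null set only. *)

Section complex_arith.
Context {R : realType}.
Implicit Types x y z : R[i].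

Lemma cReD x y : cRe (x + y) = cRe x + cRe y. Proof. by case: x y => ? ? []. Qed.
Lemma cImD x y : cIm (x + y) = cIm x + cIm y. Proof. by case: x y => ? ? []. Qed.
Lemma cReN x : cRe (- x) = - cRe x. Proof. by case: x. Qed.
Lemma cImN x : cIm (- x) = - cIm x. Proof. by case: x. Qed.
Lemma cReB x y : cRe (x - y) = cRe x - cRe y. Proof. by rewrite cReD cReN. Qed.
Lemma cImB x y : cIm (x - y) = cIm x - cIm y. Proof. by rewrite cImD cImN. Qed.
Lemma cReM x y : cRe (x * y) = cRe x * cRe y - cIm x * cIm y.
Proof. by case: x y => ? ? []. Qed.
Lemma cImM x y : cIm (x * y) = cRe x * cIm y + cIm x * cRe y.
Proof. by case: x y => ? ? []. Qed.
Lemma cReJ x : cRe (conjc x) = cRe x. Proof. by case: x. Qed.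
Lemma cImJ x : cIm (conjc x) = - cIm x. Proof. by case: x. Qed.

Lemma complexP x y : cRe x = cRe y -> cIm x = cIm y -> x = y.
Proof. by case: x y => ? ? [? ?] /= -> ->. Qed.

Lemma sqr_normc x : normc x ^+ 2 = cRe x ^+ 2 + cIm x ^+ 2.
Proof. by case: x => a b /=; rewrite sqr_sqrtr ?addr_ge0 ?sqr_ge0. Qed.

Lemma normc_ge0 x : 0 <= normc x. Proof. by case: x => a b; exact: sqrtr_ge0. Qed.

Lemma normrE x : `|x| = (normc x)%:C%C. Proof. by case: x. Qed.

Lemma le_normcD x y : normc (x + y) <= normc x + normc y.
Proof. by have := ler_normD x y; rewrite !normrE -rmorphD lecR. Qed.

Lemma normcN x : normc (- x) = normc x.
Proof. by case: x => a b /=; rewrite !sqrrN. Qed.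

Lemma normcB x y : normc (x - y) = normc (y - x).
Proof. by rewrite -normcN opprB. Qed.

Lemma normcJ x : normc (conjc x) = normc x.
Proof. by case: x => a b /=; rewrite sqrrN. Qed.

Lemma normcX x n : normc (x ^+ n) = normc x ^+ n.
Proof.
elim: n => [|n IH]; first by rewrite !expr0 normc1.
by rewrite !exprS normcM IH.
Qed.

Lemma normc_real (r : R) : normc r%:C%C = `|r|.
Proof. by rewrite /= expr0n/= addr0 sqrtr_sqr. Qed.

Lemma le_cRe_normc x : `|cRe x| <= normc x.
Proof.
by rewrite -[leRHS]ger0_norm ?normc_ge0// -ler_sqr ?nnegrE// !real_normK ?num_real// sqr_normc lerDl sqr_ge0.
Qed.

Lemma le_cIm_normc x : `|cIm x| <= normc x.
Proof.
by rewrite -[leRHS]ger0_norm ?normc_ge0// -ler_sqr ?nnegrE// !real_normK ?num_real// sqr_normc lerDr sqr_ge0.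
Qed.

Lemma normc_le_ReIm x : normc x <= `|cRe x| + `|cIm x|.
Proof.
rewrite -ler_sqr ?nnegrE ?addr_ge0 ?normc_ge0// sqr_normc sqrrD !real_normK ?num_real//.
by rewrite -addrA [_ *+ 2 + _]addrC addrA lerDl mulrn_wge0// mulr_ge0.
Qed.

Lemma normc_eq0 x : (normc x == 0) = (x == 0).
Proof. by apply/eqP/eqP => [/eq0_normc//|->]; rewrite normc0. Qed.

Lemma normc_gt0 x : (0 < normc x) = (x != 0).
Proof. by rewrite lt_def normc_ge0 andbT normc_eq0. Qed.

Lemma mulcJ x : x * conjc x = (normc x ^+ 2)%:C%C.
Proof. by apply: complexP; rewrite ?cReM ?cImM ?cReJ ?cImJ/= -?[_ + _ ^+ 2]/(_) ?sqr_normc; case: x => a b /=; rewrite ?sqr_sqrtr ?addr_ge0 ?sqr_ge0//; ring. Qed.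

Lemma le_normc_sum I r (P : pred I) (F : I -> R[i]) :
  normc (\sum_(i <- r | P i) F i) <= \sum_(i <- r | P i) normc (F i).
Proof.
elim/big_rec2: _ => [|i a b _ h]; first by rewrite normc0.
by apply: (le_trans (le_normcD _ _)); rewrite lerD2l.
Qed.

Lemma normc_prod I r (P : pred I) (F : I -> R[i]) :
  normc (\prod_(i <- r | P i) F i) = \prod_(i <- r | P i) normc (F i).
Proof. by apply: (big_morph (@normc R)); [exact: normcM|exact: normc1]. Qed.

Lemma normc_eq1 x : `|x| = 1 <-> normc x = 1.
Proof. by rewrite normrE; split => [[]//|->]. Qed.

End complex_arith.

Section complex_measurability.
Context {R : realType} d (T : measurableType d).
Implicit Types f g : T -> R[i].

Lemma measurable_cRe : measurable_fun setT (fun z : R[i] => cRe z).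
Proof.
move=> _ A mA; rewrite setTI; apply: sub_sigma_algebra.
exists (A `*` setT); first exact: measurableX.
by rewrite setTI; apply/seteqP; split => z /=; [case|].
Qed.

Lemma measurable_cIm : measurable_fun setT (fun z : R[i] => cIm z).
Proof.
move=> _ A mA; rewrite setTI; apply: sub_sigma_algebra.
exists (setT `*` A); first exact: measurableX.
by rewrite setTI; apply/seteqP; split => z /=; [case|].
Qed.

Lemma measurable_Re f : measurable_fun setT f -> measurable_fun setT (cRe \o f).
Proof. by move=> mf; exact: measurableT_comp measurable_cRe mf. Qed.

Lemma measurable_Im f : measurable_fun setT f -> measurable_fun setT (cIm \o f).
Proof. by move=> mf; exact: measurableT_comp measurable_cIm mf. Qed.

Lemma measurable_cD f g : measurable_fun setT f -> measurable_fun setT g ->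
  measurable_fun setT (fun t => f t + g t).
Proof.
move=> mf mg; apply: measurable_complexP.
  under eq_fun do rewrite cReD.
  by apply: measurable_funD; exact: measurable_Re.
under eq_fun do rewrite cImD.
by apply: measurable_funD; exact: measurable_Im.
Qed.

Lemma measurable_cM f g : measurable_fun setT f -> measurable_fun setT g ->
  measurable_fun setT (fun t => f t * g t).
Proof.
move=> mf mg; apply: measurable_complexP.
  under eq_fun do rewrite cReM.
  by apply: measurable_funB; apply: measurable_funM;
    (exact: measurable_Re || exact: measurable_Im).
under eq_fun do rewrite cImM.
by apply: measurable_funD; apply: measurable_funM;
  (exact: measurable_Re || exact: measurable_Im).
Qed.

Lemma measurable_cN f : measurable_fun setT f -> measurable_fun setT (fun t => - f t).
Proof.
move=> mf; under eq_fun do rewrite -mulN1r.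
exact: measurable_cM.
Qed.

Lemma measurable_cJ f : measurable_fun setT f ->
  measurable_fun setT (fun t => conjc (f t)).
Proof.
move=> mf; apply: measurable_complexP.
  by under eq_fun do rewrite cReJ; exact: measurable_Re.
under eq_fun do rewrite cImJ.
by apply: measurable_funN; exact: measurable_Im.
Qed.

Lemma measurable_cX f n : measurable_fun setT f ->
  measurable_fun setT (fun t => f t ^+ n).
Proof.
move=> mf; elim: n => [|n IH]; first exact: measurable_cst.
by under eq_fun do rewrite exprS; exact: measurable_cM.
Qed.

Lemma measurable_cprod I (r : seq I) (P : pred I) (F : I -> T -> R[i]) :
  (forall i, measurable_fun setT (F i)) ->
  measurable_fun setT (fun t => \prod_(i <- r | P i) F i t).
Proof.
move=> mF; elim: r => [|i r IH]; first by (under eq_fun do rewrite big_nil); exact: measurable_cst.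
under eq_fun do rewrite big_cons.
by case: (P i) => //; exact: measurable_cM.
Qed.

Lemma measurable_csum I (r : seq I) (P : pred I) (F : I -> T -> R[i]) :
  (forall i, measurable_fun setT (F i)) ->
  measurable_fun setT (fun t => \sum_(i <- r | P i) F i t).
Proof.
move=> mF; elim: r => [|i r IH]; first by (under eq_fun do rewrite big_nil); exact: measurable_cst.
under eq_fun do rewrite big_cons.
by case: (P i) => //; exact: measurable_cD.
Qed.

Lemma measurable_sqr_normc f : measurable_fun setT f ->
  measurable_fun setT (fun t => normc (f t) ^+ 2).
Proof.
move=> mf; under eq_fun do rewrite sqr_normc.
by apply: measurable_funD; apply: measurable_funX;
  (exact: measurable_Re || exact: measurable_Im).
Qed.

Lemma measurable_normc f : measurable_fun setT f ->
  measurable_fun setT (fun t => normc (f t)).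
Proof.
(* The modulus is the power [1/2] of its square, which is a polynomial in the real and imaginary
   parts. *)
move=> mf; rewrite (_ : (fun _ => _) = fun t => (normc (f t) ^+ 2) `^ (2^-1)); last first.
  by apply/funext => t; rewrite powR12_sqrt ?sqr_ge0// sqrtr_sqr ger0_norm ?normc_ge0.
apply: (measurableT_comp (f := fun x : R => x `^ 2^-1)).
  exact: measurable_powR.
exact: measurable_sqr_normc.
Qed.

Lemma measurable_coord p q (i : 'I_p) (j : 'I_q) (f : T -> 'M[R[i]]_(p, q)) :
  measurable_fun setT f -> measurable_fun setT (fun t => f t i j).
Proof.
move=> mf; apply: (measurableT_comp (f := fun M : 'M[R[i]]_(p, q) => M i j)) mf.
move=> _ A mA; rewrite setTI; apply: sub_sigma_algebra.
by exists (i, j) => //; exists A => //; rewrite setTI.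
Qed.

Lemma measurable_mulmx p q r (f : T -> 'M[R[i]]_(p, q)) (g : T -> 'M[R[i]]_(q, r)) :
  measurable_fun setT f -> measurable_fun setT g ->
  measurable_fun setT (fun t => f t *m g t).
Proof.
move=> mf mg; apply: measurable_matrixP => i j.
under eq_fun do rewrite mxE.
by apply: measurable_csum => l; apply: measurable_cM; exact: measurable_coord.
Qed.

Lemma measurable_addmx p q (f g : T -> 'M[R[i]]_(p, q)) :
  measurable_fun setT f -> measurable_fun setT g ->
  measurable_fun setT (fun t => f t + g t).
Proof.
move=> mf mg; apply: measurable_matrixP => i j.
under eq_fun do rewrite mxE.
by apply: measurable_cD; exact: measurable_coord.
Qed.

Lemma measurable_oppmx p q (f : T -> 'M[R[i]]_(p, q)) :
  measurable_fun setT f -> measurable_fun setT (fun t => - f t).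
Proof.
move=> mf; apply: measurable_matrixP => i j.
under eq_fun do rewrite mxE.
by apply: measurable_cN; exact: measurable_coord.
Qed.

End complex_measurability.

(** * The unit ball under unitary matrices *)

Section ball_measurable.
Context {R : realType} (n : nat).
Local Notation V := 'cV[R[i]]_n.

Lemma measurable_sqnorm : measurable_fun setT (@sqnorm R n).
Proof.
rewrite /sqnorm; apply: measurable_sum => i.
by apply: measurable_sqr_normc; exact: measurable_coord.
Qed.

Lemma measurable_Bn : measurable (Bn R n).
Proof.
rewrite (_ : Bn R n = sqnorm (n:=n) @^-1` `]-oo, 1[); last first.
  by apply/seteqP; split => z; rewrite /Bn/= in_itv.
by rewrite -[_ @^-1` _]setTI; exact: measurable_sqnorm.
Qed.

Lemma sqnormE (z : V) : (sqnorm z)%:C%C = \sum_i z i 0 * conjc (z i 0).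
Proof. by rewrite rmorph_sum/=; apply: eq_bigr => i _; rewrite mulcJ. Qed.

Lemma sqnormN (z : V) : sqnorm (- z) = sqnorm z.
Proof. by apply: eq_bigr => i _; rewrite mxE normcN. Qed.

Lemma sqnorm_unitary (U : 'M[R[i]]_n) (z : V) : U \is unitarymx ->
  sqnorm (U *m z) = sqnorm z.
Proof.
move=> uU; have key (w : V) : (sqnorm w)%:C%C = ((map_mx Num.conj w)^T *m w) 0 0.
  by rewrite sqnormE mxE; apply: eq_bigr => i _; rewrite !mxE mulrC.
suff: (sqnorm (U *m z))%:C%C = (sqnorm z)%:C%C :> R[i] by case.
rewrite !key map_mxM trmx_mul mulmxA -(mulmxA _ _ U).
have := invmx_unitary uU; rewrite -map_trmx => <-.
by rewrite mulVmx ?mulmx1 ?unitarymx_unit.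
Qed.

Lemma unitary_invmx (U : 'M[R[i]]_n) : U \is unitarymx -> invmx U \is unitarymx.
Proof. by move=> uU; rewrite invmx_unitary// trmxC_unitary. Qed.

Lemma unitary_mulVKmx (U : 'M[R[i]]_n) (v : V) : U \is unitarymx ->
  U *m (invmx U *m v) = v.
Proof. by move=> /unitarymx_unit uU; rewrite mulmxA mulmxV ?mul1mx. Qed.

Lemma unitary_mulKmx (U : 'M[R[i]]_n) (v : V) : U \is unitarymx ->
  invmx U *m (U *m v) = v.
Proof. by move=> /unitarymx_unit uU; rewrite mulmxA mulVmx ?mul1mx. Qed.

Lemma Bn_unitary (U : 'M[R[i]]_n) (z : V) : U \is unitarymx ->
  Bn R n (U *m z) <-> Bn R n z.
Proof. by move=> uU; rewrite /Bn/= sqnorm_unitary. Qed.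

End ball_measurable.

(** * Unitary invariance of Lebesgue measure *)

Section invariant_product.
Context {R : realType} d1 d2 (T1 : measurableType d1) (T2 : measurableType d2).
Variables (m1 : {measure set T1 -> \bar R}) (m2 : {sigma_finite_measure set T2 -> \bar R}).
Local Open Scope ereal_scope.

(** The section at [x] of the preimage is the preimage under [f2] of the section at [f1 x]; so [m2]
    drops [f2], and integrating the measures of the sections drops [f1]. *)
Lemma product_measure_invariant (f1 : T1 -> T1) (f2 : T2 -> T2) :
  measurable_fun setT f1 -> measurable_fun setT f2 ->
  (forall A, measurable A -> m1 (f1 @^-1` A) = m1 A) ->
  (forall A, measurable A -> m2 (f2 @^-1` A) = m2 A) ->
  forall A, measurable A ->
    (m1 \x m2) ((fun p => (f1 p.1, f2 p.2)) @^-1` A) = (m1 \x m2) A.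
Proof.
move=> mf1 mf2 h1 h2 A mA; rewrite /= /product_measure1 /=.
transitivity (\int[m1]_x (m2 \o xsection A) (f1 x)).
  apply: eq_integral => x _ /=; rewrite -(h2 (xsection A _)); last exact: measurable_xsection.
  by congr (m2 _); apply/seteqP; split => y; rewrite /xsection/= !inE.
rewrite -(ge0_integral_pushforward mf1 m1 (D := setT) (f := m2 \o xsection A))//; last exact: measurable_fun_xsection.
by apply: eq_measure_integral => //= B mB _; exact: h1.
Qed.

End invariant_product.

Lemma integral_invariant {R : realType} d (T : measurableType d)
    (mu : {measure set T -> \bar R}) (phi : T -> T) (f : T -> \bar R) :
  measurable_fun setT phi -> (forall A, measurable A -> mu (phi @^-1` A) = mu A) ->
  measurable_fun setT f -> (forall x, 0 <= f x)%E ->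
  (\int[mu]_x f (phi x) = \int[mu]_x f x)%E.
Proof.
move=> mphi h mf f0.
rewrite -(ge0_integral_pushforward mphi mu (D := setT) (f := f))//.
by apply: eq_measure_integral => //= B mB _; exact: h.
Qed.

(** The image measure gives half-open intervals their length, which characterises Lebesgue
    measure. *)
Lemma lebesgue_measure_translation (R : realType) (c : R) (A : set R) : measurable A ->
  @lebesgue_measure R ((fun x => x + c) @^-1` A) = lebesgue_measure A.
Proof.
move=> mA; have mf : measurable_fun setT (fun x : measurableTypeR R => x + c : measurableTypeR R).
  exact: measurable_funD.
apply/esym.
apply: (@lebesgue_measure_unique R (pushforward lebesgue_measure (fun x : measurableTypeR R => x + c : measurableTypeR R))) => //= _ [[a b]] _ <-.
rewrite /pushforward (_ : _ @^-1` _ = `]a - c, b - c]%classic); last first.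
  by apply/seteqP; split => x /=; rewrite !in_itv/= lerBrDr ltrBlDr.
by rewrite !lebesgue_measure_itv/= !lte_fin ltrD2r -!EFinB opprB addrA subrK.
Qed.

(** * Lebesgue measure on [C^n]: translations, cubes, unitary matrices *)

Section lebesgue_on_Cn.
Context {R : realType}.
Local Notation V n := 'cV[R[i]]_n.
Definition sym_itv (r : R) : set R := `]- r, r[%classic.
Local Open Scope ereal_scope.

(** [lebesgue_Cn R n] as a bare set function, under a name that can receive further structures: the
    sigma-finiteness declared below is what Tonelli's theorem asks for. *)
Definition leb n : set (V n) -> \bar R := lebesgue_Cn R n.

HB.instance Definition _ n := Measure.copy (@leb n) (lebesgue_Cn R n).

Lemma lebS n (A : set (V n.+1)) : leb A =
  ((lebesgue_Cn R n \x @lebesgue_measure R) \x @lebesgue_measure R)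
    (@complex_cons R n @^-1` A).
Proof. by []. Qed.

(** In the coordinates of [complex_cons] a translation acts separately on the tail, the real part
    and the imaginary part, so the product lemma applies twice, with the induction hypothesis for
    the tail. *)
Lemma leb_translation n (c : V n) (A : set (V n)) : measurable A ->
  leb ((fun v => v + c)%R @^-1` A) = leb A.
Proof.
elim: n c A => [|n IH] c A mA.
  congr leb; apply/seteqP; split => v /=; by rewrite (flatmx0 c) addr0.
rewrite !lebS.
pose c1 : V n := @dsubmx _ 1 n 1 c; pose c0 := c 0%R 0%R.
rewrite (_ : _ @^-1` _ = (fun p => ((fun q => (q.1 + c1, q.2 + cRe c0)%R) p.1, (p.2 + cIm c0)%R)) @^-1` (@complex_cons R n @^-1` A)); last first.
  apply/funext => -[[v x] y]; rewrite /preimage/mkset/=; congr (A _).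
  rewrite /complex_cons /= -[in LHS](@vsubmxK _ 1 n 1 c) (@add_col_mx _ 1 n 1).
  congr (@col_mx _ 1 n 1 _ _); apply/matrixP => i j; rewrite !ord1 !mxE/= !mulr1n.
  rewrite (_ : lshift n 0 = 0)%R; last exact/val_inj.
  by apply: complexP; rewrite ?cReD ?cImD.
pose f1 (q : V n * R) := ((q.1 + c1)%R, (q.2 + cRe c0)%R).
pose f2 (x : R) := (x + cIm c0)%R.
have H := @product_measure_invariant R _ _ _ _ (lebesgue_Cn R n \x @lebesgue_measure R) (@lebesgue_measure R) f1 f2.
apply: H; rewrite ?/f1 ?/f2.
- apply: measurable_fun_pair.
    apply: measurable_addmx; last exact: measurable_cst.
    exact: measurable_fst.
  by apply: measurable_funD => //; exact: measurable_snd.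
- exact: measurable_funD.
- move=> B mB.
  have H' := @product_measure_invariant R _ _ _ _ (lebesgue_Cn R n) (@lebesgue_measure R) (fun v : V n => (v + c1)%R) (fun x : R => (x + cRe c0)%R).
  apply: H' => //.
  + by apply: measurable_addmx => //; exact: measurable_cst.
  + exact: measurable_funD.
  + by move=> D mD; exact: IH.
  + exact: lebesgue_measure_translation.
- exact: lebesgue_measure_translation.
- by rewrite -[_ @^-1` _]setTI; exact: measurable_complex_cons.
Qed.

(** Cubes in the real coordinates: their measure is computed factor by factor, and comparison with
    them gives sigma-finiteness and a finite positive measure of the ball. *)
Definition box n (r : R) : set (V n) :=
  [set v | forall i, (`|cRe (v i 0)| < r /\ `|cIm (v i 0)| < r)%R].

Lemma measurable_box n r : measurable (@box n r).
Proof.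
rewrite (_ : box r = \bigcap_(i in [set: 'I_n]) ((fun v : V n => cRe (v i 0%R)) @^-1` sym_itv r
  `&` (fun v : V n => cIm (v i 0%R)) @^-1` sym_itv r)); last first.
  apply/seteqP; split => v /=.
    by move=> h i _ /=; rewrite /sym_itv/= !in_itv/= -!ltr_norml; have [-> ->] := h i.
  by move=> h i; have := h i I; rewrite /= /sym_itv/= !in_itv/= -!ltr_norml => -[-> ->].
apply: fin_bigcap_measurable => // i _.
have mI : measurable (sym_itv r) by exact: measurable_itv.
apply: measurableI.
  rewrite -[_ @^-1` _]setTI; apply: (measurable_Re (f := fun v : V n => v i 0%R)) => //.
  exact: measurable_coord.
rewrite -[_ @^-1` _]setTI; apply: (measurable_Im (f := fun v : V n => v i 0%R)) => //.
exact: measurable_coord.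
Qed.

Lemma leb_box n r : (0 < r)%R -> leb (@box n r) = ((r *+ 2) ^+ 2 ^+ n)%:E.
Proof.
move=> r0; elim: n => [|n IH].
  rewrite expr0 /leb /= (_ : box r = setT) ?diracT//.
  by apply/seteqP; split => // v _ [].
rewrite lebS (_ : _ @^-1` _ = (box r `*` sym_itv r) `*` sym_itv r); last first.
  apply/seteqP; split => -[[v x] y] /=.
    move=> h; rewrite /sym_itv/= !in_itv/= -!ltr_norml.
    have := h 0%R; rewrite /complex_cons/= (_ : 0%R = lshift n 0%R :> 'I_(1 + n)); last exact/val_inj.
    rewrite (@col_mxEu _ 1 n) mxE mulr1n /= => -[-> ->]; split => //; split => // i.
    by have := h (rshift 1 i); rewrite /complex_cons/= (@col_mxEd _ 1 n).
  rewrite /sym_itv/= !in_itv/= -!ltr_norml => -[[hv hx] hy] i; rewrite /complex_cons.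
  case: (@split_ordP 1 n i) => j ->.
    by rewrite (@col_mxEu _ 1 n) !ord1 mxE mulr1n.
  by rewrite (@col_mxEd _ 1 n).
have mI : measurable (sym_itv r) by exact: measurable_itv.
rewrite product_measure1E//; last by apply: measurableX => //; exact: measurable_box.
rewrite [X in X * _]product_measure1E//; last exact: measurable_box.
have hs : lebesgue_measure (sym_itv r) = (r *+ 2)%:E.
  by rewrite /sym_itv lebesgue_measure_itv/= lte_fin gtrN// -EFinB opprK -mulr2n.
transitivity ((((r *+ 2) ^+ 2) ^+ n)%:E * (r *+ 2)%:E * (r *+ 2)%:E).
  by congr (_ * _ * _); [exact: IH|exact: hs|exact: hs].
by rewrite -!EFinM [in RHS]exprS [X in _ = X%:E]mulrC expr2 mulrA.
Qed.

Lemma leb_sigma_finite n : sigma_finite setT (@leb n).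
Proof.
exists (fun N => box N.+1%:R); last first.
  by move=> N; split; [exact: measurable_box|rewrite leb_box// ltry].
apply/esym; rewrite -subTset => v _.
pose M := (\sum_i (`|cRe (v i 0)| + `|cIm (v i 0)|))%R.
have M0 : (0 <= M)%R by apply: sumr_ge0 => i _; rewrite addr_ge0.
exists (Num.truncn M) => // i.
have h : (`|cRe (v i 0)| + `|cIm (v i 0)| <= M)%R.
  by rewrite /M (bigD1 i)//= lerDl; apply: sumr_ge0 => *; rewrite addr_ge0.
have hM := truncnS_gt M.
by split; apply: le_lt_trans hM; apply: le_trans h; rewrite ?lerDl ?lerDr.
Qed.

HB.instance Definition _ n :=
  Measure_isSigmaFinite.Build _ _ _ (@leb n) (leb_sigma_finite n).

Lemma leb_ball_lty n : leb (Bn R n) < +oo.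
Proof.
apply: (@le_lt_trans _ _ (leb (@box n 1%R))); last by rewrite leb_box// ltry.
apply: le_measure; rewrite ?inE; [exact: measurable_Bn|exact: measurable_box|].
move=> v; rewrite /Bn/= => h i.
have hi : (normc (v i 0) < 1)%R.
  rewrite -[ltRHS]ger0_norm// -ltr_sqr ?nnegrE ?normc_ge0// normr1 expr1n; apply: le_lt_trans h.
  by rewrite /sqnorm (bigD1 i)//= lerDl; apply: sumr_ge0 => *; exact: sqr_ge0.
by split; apply: le_lt_trans hi; [exact: le_cRe_normc|exact: le_cIm_normc].
Qed.

Lemma box_sub_ball n : exists2 r : R, (0 < r)%R & @box n r `<=` Bn R n.
Proof.
(* With this radius each coordinate has modulus at most [1/(n+1)], so the [n] squares sum to at most
   [n/(n+1)]. *)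
exists (n.+1%:R^-1 / 2)%R; first by rewrite divr_gt0.
move=> v h; rewrite /Bn/= /sqnorm.
apply: (@le_lt_trans _ _ (\sum_(i < n) n.+1%:R^-1)%R); last first.
  by rewrite sumr_const card_ord -[X in (X < _)%R]mulr_natr mulrC ltr_pdivrMr// mul1r ltr_nat.
apply: ler_sum => i _; have [h1 h2] := h i.
have hn : (normc (v i 0) <= n.+1%:R^-1)%R.
  apply: (le_trans (normc_le_ReIm _)); rewrite (splitr n.+1%:R^-1).
  by apply: lerD; exact: ltW.
apply: (@le_trans _ _ (n.+1%:R^-1 ^+ 2)%R).
  by rewrite ler_sqr ?nnegrE ?normc_ge0 ?invr_ge0.
by rewrite expr2 ler_piMl ?invr_ge0 ?invf_le1 ?ler1n.
Qed.

Lemma leb_ball_gt0 n : 0 < leb (Bn R n).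
Proof.
have [r r0 rB] := box_sub_ball n.
apply: (@lt_le_trans _ _ (leb (@box n r))).
  by rewrite leb_box// lte_fin !exprn_gt0// pmulrn_lgt0.
by apply: le_measure; rewrite ?inE; [exact: measurable_box|exact: measurable_Bn|].
Qed.

Lemma leb_indic n (A : set (V n)) : measurable A ->
  leb A = \int[@leb n]_v (\1_A v)%:E.
Proof. by move=> mA; rewrite integral_indic// setIT. Qed.

(* By Tonelli, [1_B(x) 1_A(U y + x)] integrates to [leb B * leb (U^-1 A)] and,
   the unit ball [B] being symmetric and [U]-invariant, to [leb B * leb A]. *)
Lemma leb_unitary n (U : 'M[R[i]]_n) (A : set (V n)) : U \is unitarymx ->
  measurable A -> leb ((fun v => U *m v) @^-1` A) = leb A.
Proof.
move=> uU mA; set B := Bn R n.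
have mB : measurable B by exact: measurable_Bn.
have mU : measurable_fun setT (fun v : V n => U *m v).
  by apply: measurable_mulmx => //; exact: measurable_cst.
have uUV : invmx U \is unitarymx by exact: unitary_invmx.
have UV (v : V n) : U *m (invmx U *m v) = v by exact: unitary_mulVKmx.
have VU (v : V n) : invmx U *m (U *m v) = v by exact: unitary_mulKmx.
have mUA : measurable ((fun v => U *m v) @^-1` A) by rewrite -[_ @^-1` _]setTI; exact: mU.
have mind (E : set (V n)) : measurable E -> measurable_fun setT (fun v : V n => (\1_E v)%:E : \bar R).
  by move=> mE; exact/measurable_EFinP/measurable_indic.
pose g (p : V n * V n) : \bar R := (\1_B p.1)%:E * (\1_A (U *m p.2 + p.1)%R)%:E.
have mg : measurable_fun setT g.
  apply: emeasurable_funM.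
    by apply: (measurableT_comp (mind _ mB)); exact: measurable_fst.
  apply: (measurableT_comp (mind _ mA)); apply: measurable_addmx; last exact: measurable_fst.
  by apply: (measurableT_comp mU); exact: measurable_snd.
have g0 p : 0 <= g p by rewrite /g mule_ge0// lee_fin.
have := fubini_tonelli (m1 := @leb n) (m2 := @leb n) g mg g0.
have -> : \int[@leb n]_x \int[@leb n]_y g (x, y) = leb B * leb ((fun v => U *m v) @^-1` A).
  rewrite (eq_integral (fun x : V n => (\1_B x)%:E * leb ((fun v => U *m v) @^-1` A))).
    rewrite ge0_integralZr//; last exact: mind.
    by rewrite integral_indic// setIT.
  move=> x _; rewrite /g/= ge0_integralZl//; last 1 first.
    - apply: (measurableT_comp (mind _ mA)); apply: measurable_addmx => //; exact: measurable_cst.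
  congr (_ * _); rewrite -(leb_translation (invmx U *m x))//.
  rewrite [RHS]leb_indic; last first.
    rewrite -[_ @^-1` _]setTI; apply: measurable_addmx => //; exact: measurable_cst.
  apply: eq_integral => y _; rewrite !indicE; congr ((nat_of_bool _)%:R%:E)%R.
  by apply/idP/idP; rewrite !inE/= mulmxDr UV.
have -> : \int[@leb n]_y \int[@leb n]_x g (x, y) = leb B * leb A.
  transitivity (\int[@leb n]_y \int[@leb n]_x ((\1_B (x - U *m y)%R)%:E * (\1_A x)%:E)).
    apply: eq_integral => y _.
    rewrite -(integral_invariant (phi := fun x : V n => (x + U *m y)%R) (f := fun x : V n => (\1_B (x - U *m y)%R)%:E * (\1_A x)%:E)).
    - by apply: eq_integral => x _; rewrite /g/= addrK [(U *m y + x)%R]addrC.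
    - by apply: measurable_addmx => //; exact: measurable_cst.
    - by move=> E mE; exact: leb_translation.
    - apply: emeasurable_funM; last exact: mind.
      by apply: (measurableT_comp (mind _ mB)); apply: measurable_addmx => //; exact: measurable_cst.
    - by move=> x; rewrite mule_ge0// lee_fin.
  rewrite (fubini_tonelli (fun p : V n * V n => (\1_B (p.2 - U *m p.1)%R)%:E * (\1_A p.2)%:E))//=; last first.
    - apply: emeasurable_funM; last by apply: (measurableT_comp (mind _ mA)); exact: measurable_snd.
      apply: (measurableT_comp (mind _ mB)); apply: measurable_addmx; first exact: measurable_snd.
      by apply: measurable_oppmx; apply: (measurableT_comp mU); exact: measurable_fst.
  rewrite (eq_integral (fun x => leb B * (\1_A x)%:E)).
    rewrite ge0_integralZl//; last exact: mind.
    by rewrite integral_indic// setIT.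
  move=> x _; rewrite ge0_integralZr//; last first.
    - apply: (measurableT_comp (mind _ mB)); apply: measurable_addmx; first exact: measurable_cst.
      exact: measurable_oppmx.
  congr (_ * _); rewrite -(leb_translation (- (invmx U *m x))%R)//.
  rewrite [RHS]leb_indic; last first.
    rewrite -[_ @^-1` _]setTI; apply: measurable_addmx => //; exact: measurable_cst.
  apply: eq_integral => y _; rewrite !indicE; congr ((nat_of_bool _)%:R%:E)%R.
  have E : B (x - U *m y)%R <-> B (y - invmx U *m x)%R.
    rewrite {1}/B -(Bn_unitary (x - U *m y)%R uUV) mulmxBr VU.
    by rewrite /B /Bn /= -sqnormN opprB.
  by apply/idP/idP; rewrite !inE/= => /E.
(* The factor [leb B] can be cancelled because it is finite and positive. *)
have Bfin : leb B \is a fin_num by rewrite ge0_fin_numE// leb_ball_lty.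
have B0 : 0 < leb B by exact: leb_ball_gt0.
by move=> e; apply/le_anti; rewrite -(lee_pmul2l Bfin B0) e lexx -(lee_pmul2l Bfin B0) e lexx.
Qed.

End lebesgue_on_Cn.

(** * Finiteness of the weighted measure of the ball *)

Section power_integrals.
Context {R : realType}.
Local Notation mu := (@lebesgue_measure R).
Implicit Types l s c x : R.

Lemma measurable_powRl l (D : set R) : measurable_fun D (fun t : R => t `^ l).
Proof. by apply: measurable_funTS; exact: measurable_powR. Qed.

Lemma integral_powR_segment l e s : -1 < l -> 0 < e -> e < s ->
  (\int[mu]_(t in `[e, s]) (t `^ l)%:E = ((s `^ (l + 1) - e `^ (l + 1)) / (l + 1))%:E)%E.
Proof.
move=> l1 e0 es; have l0 : 0 < l + 1 by rewrite -ltrBlDr sub0r.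
have s0 : 0 < s by exact: lt_trans es.
have der x : 0 < x -> is_derive x 1 (fun t : R => (l + 1)^-1 * t `^ (l + 1)) (x `^ l).
  move=> x0; have := is_deriveZ (l + 1)^-1 (is_derive1_powR (l + 1) x0).
  by rewrite /GRing.scale/= mulrA mulVf ?gt_eqF// mul1r addrK.
have cont x : 0 < x -> {for x, continuous (fun t : R => (l + 1)^-1 * t `^ (l + 1))}.
  by move=> x0; apply: differentiable_continuous; apply/derivable1_diffP; exact: (@ex_derive _ _ _ _ _ _ _ (der _ x0)).
rewrite (@continuous_FTC2 _ _ (fun t : R => (l + 1)^-1 * t `^ (l + 1)))//.
- by rewrite -EFinB -mulrBr mulrC.
- apply: continuous_in_subspaceT => x; rewrite inE/= in_itv/= => /andP[ex _].
  apply: differentiable_continuous; apply/derivable1_diffP.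
  by apply: derivable_powR; rewrite in_itv/= andbT (lt_le_trans e0).
- split.
  + by move=> x; rewrite in_itv/= => /andP[ex _]; exact: (@ex_derive _ _ _ _ _ _ _ (der _ (lt_trans e0 ex))).
  + by apply: cvg_at_right_filter; exact: cont.
  + by apply: cvg_at_left_filter; exact: cont.
- move=> x; rewrite in_itv/= => /andP[ex _]; rewrite derive1E.
  exact: (@derive_val _ _ _ _ _ _ _ (der _ (lt_trans e0 ex))).
Qed.

Lemma integral_powR_le l s : -1 < l -> 0 < s ->
  (\int[mu]_(t in `]0%R, s]) (t `^ l)%:E <= (s `^ (l + 1) / (l + 1))%:E)%E.
Proof.
move=> l1 s0; have l0 : 0 < l + 1 by rewrite -ltrBlDr sub0r.
(* The power may be singular at 0, which is reached by monotone convergence; [n.+2] keeps the left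
   end strictly below [s], as the segment formula requires. *)
pose F (n : nat) : set R := `[s / n.+2%:R, s]%classic.
have e0 n : 0 < s / n.+2%:R by rewrite divr_gt0.
have UF : \bigcup_n F n = `]0, s]%classic.
  apply/seteqP; split => x /=.
    by move=> [n _]; rewrite /F/= !in_itv/= => /andP[h ->]; rewrite (lt_le_trans _ h).
  rewrite in_itv/= => /andP[x0 xs]; exists (Num.truncn (s / x)) => //.
  rewrite /F/= in_itv/= xs andbT ler_pdivrMr// mulrC -ler_pdivrMr//.
  apply: (le_trans (ltW (truncnS_gt _))); by rewrite ler_nat.
rewrite -UF; have mF n : measurable (F n) by exact: measurable_itv.
have cv := @ge0_nondecreasing_set_cvg_integral _ (measurableTypeR R) R F (fun t => (t `^ l)%:E) mu.
have {}cv : (\int[mu]_(t in F n) (t `^ l)%:E)%E @[n --> \oo] --> (\int[mu]_(t in \bigcup_n F n) (t `^ l)%:E)%E.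
  apply: cv => //.
  - apply/nondecreasing_seqP => n; apply/subsetPset => x; rewrite /F/= !in_itv/= => /andP[h ->].
    rewrite andbT (le_trans _ h)// ler_pM2l// lef_pV2 ?posrE//; by rewrite ler_nat.
  - by move=> n; apply/measurable_EFinP; exact: measurable_powRl.
  - by move=> n x _; rewrite lee_fin powR_ge0.
rewrite -(cvg_lim _ cv)//; apply: lime_le; first exact: cvgP cv.
apply: nearW => n; rewrite integral_powR_segment//.
  by rewrite lee_fin ler_pM2r ?invr_gt0// lerBlDr lerDl powR_ge0.
by rewrite ltr_pdivrMr// ltr_pMr// (ltr_nat R 1).
Qed.

(** On []0, 1]] the integrand is at most [t^(x-1)]. Beyond 1 it is at most [t^N e^(-t)] with
    [N >= x - 1], and the exponential series gives [t^N <= N! 2^N e^(t/2)], which leaves a multiple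
    of the exponential density of rate [1/2]. *)
Lemma Gamma_lty (x : R) : 0 < x ->
  (\int[mu]_(t in `]0%R, +oo[) (t `^ (x - 1) * expR (- t))%:E < +oo)%E.
Proof.
move=> x0; pose N := (Num.truncn x).+1.
have hN : x - 1 <= N%:R by rewrite lerBlDr ltW// (lt_trans (truncnS_gt x))// ltrDl.
pose K : R := (N`!)%:R * 2 ^+ N.
pose g (t : R) : \bar R := ((t `^ (x - 1)) * \1_(`]0, 1]%classic) t)%:E.
pose h (t : R) : \bar R := (K * 2 * exponential_pdf (2^-1) t)%:E.
have K0 : 0 <= K by rewrite mulr_ge0 ?exprn_ge0.
have mI : measurable (`]0, 1]%classic : set R) by exact: measurable_itv.
have mg : measurable_fun setT g.
  by apply/measurable_EFinP; apply: measurable_funM; [exact: measurable_powR|exact: measurable_indic].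
have mh : measurable_fun setT h.
  apply/measurable_EFinP; apply: measurable_funM => //; exact: measurable_exponential_pdf.
have h0 t : (0 <= h t)%E by rewrite lee_fin !mulr_ge0 ?exponential_pdf_ge0.
have g0 t : (0 <= g t)%E by rewrite lee_fin mulr_ge0 ?powR_ge0.
apply: (@le_lt_trans _ _ (\int[mu]_t (g t + h t))%E); last first.
  rewrite ge0_integralD//; apply: lte_add_pinfty.
    rewrite /g; under eq_integral do rewrite EFinM.
    rewrite -[X in (X < _)%E](_ : (\int[mu]_(t in `]0%R, 1%R]) (t `^ (x - 1))%:E)%E = _).
      apply: (le_lt_trans (integral_powR_le _ _)) => //; last by rewrite ltry.
      by rewrite -subr_gt0 opprK subrK.
    rewrite [LHS]integral_mkcond; apply: eq_integral => t _; rewrite patchE indicE.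
    by case: ifP => _; rewrite ?mule1 ?mule0.
  rewrite /h; under eq_integral do rewrite EFinM.
  rewrite ge0_integralZl//.
  - by rewrite integral_exponential_pdf// mule1 ltry.
  - by apply/measurable_EFinP; exact: measurable_exponential_pdf.
  - by move=> t _; rewrite lee_fin exponential_pdf_ge0.
  - by rewrite lee_fin mulr_ge0.
rewrite integral_mkcond; apply: ge0_le_integral => //.
- by move=> t _; rewrite patchE; case: ifP => // _; rewrite lee_fin mulr_ge0 ?powR_ge0 ?expR_ge0.
- apply/measurable_restrict => //.
  apply/measurable_EFinP; apply: measurable_funM; first exact: measurable_powRl.
  apply: measurable_funTS; apply: measurableT_comp => //; exact: measurable_funN.
- exact: emeasurable_funD.
move=> t _; rewrite patchE; case: ifPn => [|_]; last by rewrite adde_ge0.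
rewrite inE/= in_itv/= andbT => t0.
have [t1|t1] := leP t 1.
  rewrite /g (_ : \1_(_) t = 1); last by rewrite indicE mem_set//= in_itv/= t0.
  rewrite mulr1; apply: (@le_trans _ _ (t `^ (x - 1))%:E); last by rewrite leeDl.
  by rewrite lee_fin ler_piMr ?powR_ge0// -expR0 ler_expR oppr_le0 ltW.
apply: (@le_trans _ _ (h t)); last by rewrite leeDr.
rewrite lee_fin (exponential_pdfE _ (ltW t0)) mulrA -(mulrA K) mulfV ?mulr1//.
have -> : expR (- t) = (expR (2^-1 * t))^-1 * expR (- 2^-1 * t).
  by rewrite -expRN -expRD; congr expR; lra.
rewrite mulrA ler_wpM2r ?expR_ge0// ler_pdivrMr ?expR_gt0//.
apply: (@le_trans _ _ (t `^ N%:R)); first exact: ler_powR (ltW t1) _ _ hN.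
rewrite (powR_mulrn _ (ltW t0)) /K.
have := expR_ge1Dxn (Num.truncn x) (_ : 0 <= 2^-1 * t).
rewrite -/N => /(_ _)/=.
have t2 : 0 <= 2^-1 * t by rewrite mulr_ge0// ltW.
move=> /(_ t2) H; have {}H : (2^-1 * t) ^+ N / N`!%:R <= expR (2^-1 * t).
  by apply: le_trans H; rewrite lerDr.
rewrite ler_pdivrMr ?ltr0n ?fact_gt0// in H.
apply: (@le_trans _ _ (2 ^+ N * (2^-1 * t) ^+ N)).
  by rewrite -exprMn mulrA mulfV// mul1r.
have -> : N`!%:R * 2 ^+ N * expR (2^-1 * t) = 2 ^+ N * (expR (2^-1 * t) * N`!%:R).
  by move: (N`!%:R) (2 ^+ N) (expR _) => a b c; ring.
by rewrite ler_wpM2l// exprn_ge0.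
Qed.

(** [Gamma] is the [fine] part of an extended integral and would be 0 if that integral were
    infinite, so finiteness is part of positivity. The lower bound comes from [[1, 2]], where
    [t^(x-1) >= 1/t >= 1/2] and [e^(-t) >= e^(-2)]. *)
Lemma Gamma_gt0 (x : R) : 0 < x -> 0 < Gamma x.
Proof.
move=> x0; rewrite /Gamma /Rintegral; apply: fine_gt0; rewrite Gamma_lty// andbT.
have mI : measurable (`[1, 2]%classic : set R) by exact: measurable_itv.
have mI' : measurable (`]0, +oo[%classic : set R) by exact: measurable_itv.
have mf (D : set R) : measurable_fun D (fun t : R => (t `^ (x - 1) * expR (- t))%:E).
  apply/measurable_EFinP; apply: measurable_funM; first exact: measurable_powRl.
  apply: measurable_funTS; apply: measurableT_comp => //; exact: measurable_funN.
apply: (@lt_le_trans _ _ (\int[mu]_(t in `[1%R, 2%R]) (2^-1 * expR (- 2))%:E)%E).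
  rewrite (_ : (\int[mu]_(t in _) _ = (2^-1 * expR (- 2))%:E * mu `[1%R, 2%R]%classic)%E); last exact: integral_cst.
  rewrite lebesgue_measure_itv/= lte_fin (ltr_nat R 1)// -EFinB -EFinM lte_fin.
  by rewrite mulr_gt0// ?mulr_gt0 ?expR_gt0// subr_gt0 (ltr_nat R 1).
apply: (@le_trans _ _ (\int[mu]_(t in `[1%R, 2%R]) (t `^ (x - 1) * expR (- t))%:E)%E).
  apply: ge0_le_integral => //.
  - exact: mf.
  - by move=> t; rewrite /= in_itv/= => /andP[t1 t2]; rewrite lee_fin; apply: ler_pM => //; rewrite ?expR_ge0//;
      [apply: (@le_trans _ _ (t `^ (-1))); [rewrite powR_inv1 ?(le_trans _ t1)// lef_pV2 ?posrE// (lt_le_trans _ t1)//|rewrite ler_powR//; lra]|rewrite ler_expR lerN2].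
apply: ge0_subset_integral => //.
- exact: mf.
- by move=> t _; rewrite lee_fin mulr_ge0 ?powR_ge0 ?expR_ge0.
- by move=> t /=; rewrite !in_itv/= andbT => /andP[t1 _]; rewrite (lt_le_trans _ t1).
Qed.

(** Extended by 0, so that [pospow l (c - |z|^2)] already contains the indicator of the ball of
    squared radius [c]: integrals over slices of the ball become integrals over whole lines. *)
Definition pospow l c : R := if 0 < c then c `^ l else 0.

Lemma pospow_ge0 l c : 0 <= pospow l c.
Proof. by rewrite /pospow; case: ifP => // _; exact: powR_ge0. Qed.

Lemma measurable_pospow l : measurable_fun setT (pospow l).
Proof.
apply: (@measurable_fun_ifT _ _ _ _ (fun c : R => c `^ l) (cst 0) (fun c => 0 < c)) => //.
exact: measurable_fun_ltr.
Qed.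

Lemma lebesgue_measure_opp (A : set R) : measurable A ->
  mu ((fun x : R => - x) @^-1` A) = mu A.
Proof. by move=> mA; have := lebesgue_measureN mA. Qed.

(** With [c = s^2], factor [c - x^2 = (s - x)(s + x)]. The smaller factor [u] lies in []0, s]], the
    larger one [v] in [[s, 2s]], so [v^l <= (1 + 2^l) s^l] whatever the sign of [l]. Integrating
    [u^l] over []0, 2s]] once for each half-line gives a multiple of [s^(2l+1)], that is, of
    [c^(l+1/2)]. *)
Lemma integral_pospow_parabola l : -1 < l -> exists2 C : R, 0 <= C &
  forall c, (\int[mu]_x (pospow l (c - x ^+ 2))%:E <= (C * pospow (l + 2^-1) c)%:E)%E.
Proof.
move=> l1; have l0 : 0 < l + 1 by rewrite -ltrBlDr sub0r.
exists ((1 + 2 `^ l) * (2 * (2 `^ (l + 1) / (l + 1)))).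
  by rewrite !mulr_ge0 ?addr_ge0 ?powR_ge0// invr_ge0 ltW.
move=> c; rewrite /pospow; case: ifPn => [c0|]; last first.
  rewrite -leNgt => c0; rewrite mulr0 integral0_eq// => x _.
  by rewrite ltNge subr_le0 (le_trans c0 (sqr_ge0 _)).
pose s := Num.sqrt c.
have s0 : 0 < s by rewrite sqrtr_gt0.
have cs : c = s ^+ 2 by rewrite sqr_sqrtr ?ltW.
pose g (t : R) : R := t `^ l * \1_(`]0, 2 * s]%classic) t.
have g0 t : 0 <= g t by rewrite mulr_ge0 ?powR_ge0.
have mI : measurable (`]0, 2 * s]%classic : set R) by exact: measurable_itv.
have mg : measurable_fun setT g.
  by apply: measurable_funM; [exact: measurable_powR|exact: measurable_indic].
have mN : measurable_fun setT (fun x : R => - x) by exact: measurable_funN.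
have ig : (\int[mu]_t (g t)%:E <= ((2 * s) `^ (l + 1) / (l + 1))%:E)%E.
  apply: le_trans (integral_powR_le l1 (mulr_gt0 _ s0)) => //.
  rewrite [X in (_ <= X)%E]integral_mkcond; apply: ge0_le_integral => //.
  - by move=> t _; rewrite lee_fin.
  - exact/measurable_EFinP.
  - apply/measurable_restrict => //.
    by apply/measurable_EFinP; exact: measurable_powRl.
  - by move=> t _; rewrite patchE /g indicE; case: ifP => _; rewrite ?mulr1 ?mulr0.
have mgD : measurable_fun setT (fun t : R => (g (t + s))%:E).
  by apply/measurable_EFinP; apply: (measurableT_comp mg); exact: measurable_funD.
have mgN : measurable_fun setT (fun t : R => (g (- t + s))%:E).
  by apply/measurable_EFinP; apply: (measurableT_comp mg); apply: measurable_funD.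
have i1 : (\int[mu]_t (g (t + s))%:E = \int[mu]_t (g t)%:E)%E.
  apply: (@integral_invariant R _ _ mu (fun t => t + s) (fun t => (g t)%:E)) => //.
  - exact: measurable_funD.
  - exact: lebesgue_measure_translation.
  - exact/measurable_EFinP.
have i2 : (\int[mu]_t (g (- t + s))%:E = \int[mu]_t (g t)%:E)%E.
  rewrite -i1; apply: (@integral_invariant R _ _ mu (fun t => - t) (fun t => (g (t + s))%:E)) => //.
  - exact: lebesgue_measure_opp.
  - by move=> t; rewrite lee_fin.
have k0 : 0 <= (1 + 2 `^ l) * s `^ l by rewrite mulr_ge0 ?addr_ge0 ?powR_ge0.
apply: (@le_trans _ _ (\int[mu]_x (((1 + 2 `^ l) * s `^ l)%:E * ((g (x + s))%:E + (g (- x + s))%:E)))%E); last first.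
  rewrite ge0_integralZl//; last 2 first.
    - exact: emeasurable_funD.
    - by move=> t _; rewrite -EFinD lee_fin addr_ge0.
  rewrite ge0_integralD//; last 2 first.
    - by move=> t _; rewrite lee_fin.
    - by move=> t _; rewrite lee_fin.
  rewrite i1 i2.
  apply: (@le_trans _ _ (((1 + 2 `^ l) * s `^ l)%:E * (((2 * s) `^ (l + 1) / (l + 1))%:E + ((2 * s) `^ (l + 1) / (l + 1))%:E))%E).
    by apply: lee_wpmul2l; [rewrite lee_fin|apply: leeD].
  have sE : (2 * s) `^ (l + 1) = 2 `^ (l + 1) * s `^ (l + 1) by rewrite powRM// ltW.
  have cE : c `^ (l + 2^-1) = s `^ l * s `^ (l + 1).
    rewrite cs -(powR_mulrn 2 (ltW s0)) -powRrM (_ : 2%:R * _ = l + (l + 1)); last by lra.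
    by rewrite powRD// (gt_eqF s0) implybT.
  rewrite -EFinD -EFinM lee_fin sE cE le_eqVlt; apply/orP; left; apply/eqP; field.
  exact: lt0r_neq0.
apply: ge0_le_integral => //.
- by move=> x _; rewrite lee_fin pospow_ge0.
- apply/measurable_EFinP; apply: (measurableT_comp (measurable_pospow l)).
  by apply: measurable_funB => //; exact: measurable_funX.
- by apply/measurable_funeM; exact: emeasurable_funD.
move=> x _; rewrite -EFinD -EFinM lee_fin.
case: ifPn => [|_]; last by rewrite mulr_ge0// addr_ge0.
rewrite cs subr_gt0 => xs; have {xs} : `|x| < s.
  have s0' := ltW s0; by rewrite -ltr_sqr ?nnegrE// real_normK ?num_real.
rewrite ltr_norml => /andP[x1 x2].
have bnd u v : 0 < u -> u <= s -> s <= v -> v <= 2 * s ->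
    (u * v) `^ l <= (1 + 2 `^ l) * s `^ l * u `^ l.
  move=> u0 us sv vs; have v0 : 0 < v := lt_le_trans s0 sv.
  rewrite (powRM _ (ltW u0) (ltW v0)) mulrC; apply: ler_wpM2r; first exact: powR_ge0.
  have [h|h] := leP 0 l.
    apply: (@le_trans _ _ ((2 * s) `^ l)).
      by apply: ge0_ler_powR; rewrite ?nnegrE//; lra.
    have s0' := ltW s0; rewrite powRM//; apply: ler_wpM2r; first exact: powR_ge0.
    by rewrite lerDr.
  apply: (@le_trans _ _ (s `^ l)); last by rewrite ler_peMl ?powR_ge0// lerDl powR_ge0.
  rewrite -[l]opprK !(powRN _ (- l)) lef_pV2 ?posrE ?powR_gt0//.
  by apply: ge0_ler_powR; rewrite ?nnegrE; lra.
rewrite (_ : s ^+ 2 - x ^+ 2 = (s - x) * (s + x)); last by ring.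
have [x0|x0] := leP 0 x.
  apply: (@le_trans _ _ ((1 + 2 `^ l) * s `^ l * (s - x) `^ l)).
    by apply: bnd; lra.
  rewrite ler_wpM2l// (_ : g (- x + s) = (s - x) `^ l) ?lerDr//.
  by rewrite /g indicE mem_set ?mulr1 1?addrC//= in_itv/=; lra.
rewrite mulrC; apply: (@le_trans _ _ ((1 + 2 `^ l) * s `^ l * (s + x) `^ l)).
  by apply: bnd; lra.
rewrite ler_wpM2l// (_ : g (x + s) = (s + x) `^ l) ?lerDl//.
by rewrite /g indicE mem_set ?mulr1 1?addrC//= in_itv/=; lra.
Qed.

End power_integrals.

(** * Complex integrals *)

Section density_measure.
Context {R : realType} d (T : measurableType d) (mu : {measure set T -> \bar R}).
Variable w : T -> R.
Hypotheses (mw : measurable_fun setT w) (w0 : forall x, 0 <= w x).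
Local Open Scope ereal_scope.

(** The two proofs are arguments so that the term [dens mw w0] by itself carries the structure of a
    measure. *)
Definition dens of measurable_fun setT w & (forall x, (0 <= w x)%R) : set T -> \bar R :=
  fun A => \int[mu]_(x in A) (w x)%:E.

Let dens_set0 : dens mw w0 set0 = 0.
Proof. by rewrite /dens integral_set0. Qed.

Let dens_ge0 A : 0 <= dens mw w0 A.
Proof. by apply: integral_ge0 => x _; rewrite lee_fin. Qed.

Let dens_sigma_additive : semi_sigma_additive (dens mw w0).
Proof.
move=> /= F mF tF mUF; rewrite /dens; apply: cvg_toP.
  apply: ereal_nondecreasing_is_cvgn => m n mn.
  apply: lee_sum_nneg_natr => // k _ _.
  by apply: integral_ge0 => /= x Fkx; rewrite lee_fin.
rewrite ge0_integral_bigcup//=.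
- by apply: measurable_funTS; exact/measurable_EFinP.
- by move=> x _; rewrite lee_fin.
Qed.

HB.instance Definition _ := isMeasure.Build _ _ _ (dens mw w0)
  dens_set0 dens_ge0 dens_sigma_additive.

Lemma dens_eq0 A : measurable A -> mu A = 0 -> dens mw w0 A = 0.
Proof.
move=> mA A0; apply: null_set_integral => //.
by apply: measurable_funTS; exact/measurable_EFinP.
Qed.

Import HBNNSimple.

Let integral_dens_indic E : measurable E ->
  \int[dens mw w0]_x (\1_E x)%:E = \int[mu]_x ((\1_E x)%:E * (w x)%:E).
Proof.
move=> mE; rewrite integral_indic//= setIT /dens integral_mkcond.
by apply: eq_integral => x _; rewrite patchE indicE; case: ifP; rewrite ?mul1e ?mul0e.
Qed.

Let integral_dens_nnsfun (f : {nnsfun T >-> R}) :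
  \int[dens mw w0]_x (f x)%:E = \int[mu]_x ((f x)%:E * (w x)%:E).
Proof.
have mwE : measurable_fun setT (EFin \o w) by exact/measurable_EFinP.
under [LHS]eq_integral do rewrite fimfunE -fsumEFin//.
rewrite [LHS]ge0_integral_fsum//; last 2 first.
  - by move=> r; exact/measurable_EFinP/measurableT_comp.
  - by move=> n x _; rewrite EFinM nnfun_muleindic_ge0.
under [RHS]eq_integral.
  move=> x xD; rewrite fimfunE -fsumEFin// ge0_mule_fsuml; last first.
    by move=> r; rewrite EFinM nnfun_muleindic_ge0.
  over.
rewrite [RHS]ge0_integral_fsum//; last 2 first.
  - move=> r; apply: emeasurable_funM => //.
    by apply/measurable_EFinP; do 2 apply/measurableT_comp => //.
  - move=> n x _; rewrite mule_ge0 ?lee_fin//.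
    by have := nnfun_muleindic_ge0 f n x; rewrite -EFinM.
apply: eq_fsbigr => r rf.
have r0 : (0 <= r)%R.
  by move: rf; rewrite inE => -[x _ <-]; exact: fun_ge0.
have mi : measurable_fun setT (fun x => (\1_(f @^-1` [set r]) x)%:E : \bar R).
  exact/measurable_EFinP/measurable_indic.
under [LHS]eq_integral do rewrite EFinM.
rewrite ge0_integralZl//.
rewrite integral_dens_indic// -ge0_integralZl//; last 2 first.
  - exact: emeasurable_funM.
  - by move=> x _; rewrite mule_ge0 ?lee_fin.
by apply: eq_integral => x _; rewrite muleA -EFinM.
Qed.

(** Passage from indicators to nonnegative simple functions, then to monotone limits on both
    sides. *)
Lemma ge0_integral_dens (f : T -> \bar R) :
  measurable_fun setT f -> (forall x, 0 <= f x) ->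
  \int[dens mw w0]_x f x = \int[mu]_x (f x * (w x)%:E).
Proof.
move=> mf f0.
have mwE : measurable_fun setT (EFin \o w) by exact/measurable_EFinP.
pose f_ := nnsfun_approx measurableT mf.
have mf_ n : measurable_fun setT (fun x => (f_ n x)%:E) by exact/measurable_EFinP.
transitivity (limn (fun n => \int[dens mw w0]_x (f_ n x)%:E)).
  rewrite -monotone_convergence//=.
  - apply: eq_integral => ? /[!inE] xD; apply/esym/cvg_lim => //=.
    exact: cvg_nnsfun_approx.
  - by move=> n ? _; rewrite lee_fin.
  - by move=> ? _ ? ? mn; rewrite lee_fin; exact/lefP/nd_nnsfun_approx.
transitivity (limn (fun n => \int[mu]_x ((f_ n x)%:E * (w x)%:E))).
  by congr (limn _); apply/funext => n; exact: integral_dens_nnsfun.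
rewrite -monotone_convergence//=.
- apply: eq_integral => x _; apply/cvg_lim => //.
  apply: cvgeZr => //; exact: cvg_nnsfun_approx.
- by move=> n; exact: emeasurable_funM.
- by move=> n x _; rewrite mule_ge0 ?lee_fin.
- move=> x _ a b ab; apply: lee_wpmul2r; rewrite lee_fin//.
  exact/lefP/nd_nnsfun_approx.
Qed.

Lemma integral_dens (f : T -> \bar R) : measurable_fun setT f ->
  \int[dens mw w0]_x f x = \int[mu]_x (f x * (w x)%:E).
Proof.
move=> mf; rewrite [LHS]integralE [RHS]integralE.
rewrite !ge0_integral_dens//; [|exact: measurable_funeneg|exact: measurable_funepos].
congr (_ - _); apply: eq_integral => x _.
  by rewrite !funeposE maxe_pMl ?lee_fin// mul0e.
by rewrite !funenegE -mulNe maxe_pMl ?lee_fin// mul0e.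
Qed.

End density_measure.

Section complex_integration.
Context {R : realType} d (T : measurableType d).
Implicit Types (f g : T -> R[i]) (mu : {measure set T -> \bar R}).

Definition cintegrable mu f := measurable_fun setT f /\
  (\int[mu]_x (normc (f x))%:E < +oo)%E.

Local Notation Cint mu f := (Cintegral mu setT f).

Lemma cintegrable_le mu f g : measurable_fun setT f ->
  (forall x, normc (f x) <= normc (g x)) -> cintegrable mu g -> cintegrable mu f.
Proof.
move=> mf fg [mg ig]; split => //; apply: le_lt_trans ig.
apply: ge0_le_integral => //.
- by move=> x _; rewrite lee_fin normc_ge0.
- exact/measurable_EFinP/measurable_normc.
- exact/measurable_EFinP/measurable_normc.
- by move=> x _; rewrite lee_fin.
Qed.

Lemma cintegrable_real mu (h : T -> R) g : measurable_fun setT h ->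
  (forall x, `|h x| <= normc (g x)) -> cintegrable mu g ->
  mu.-integrable setT (EFin \o h).
Proof.
move=> mh hg [mg ig]; apply/integrableP; split; first exact/measurable_EFinP.
apply: le_lt_trans ig; apply: ge0_le_integral => //.
- by do 2 apply: measurableT_comp => //.
- exact/measurable_EFinP/measurable_normc.
- by move=> x _; rewrite /= lee_fin.
Qed.

Lemma integrable_cRe mu f : cintegrable mu f -> mu.-integrable setT (EFin \o (cRe \o f)).
Proof.
move=> cf; apply: (cintegrable_real _ _ cf); first exact: measurable_Re cf.1.
by move=> x; exact: le_cRe_normc.
Qed.

Lemma integrable_cIm mu f : cintegrable mu f -> mu.-integrable setT (EFin \o (cIm \o f)).
Proof.
move=> cf; apply: (cintegrable_real _ _ cf); first exact: measurable_Im cf.1.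
by move=> x; exact: le_cIm_normc.
Qed.

Lemma cintegrableD mu f g : cintegrable mu f -> cintegrable mu g ->
  cintegrable mu (fun x => f x + g x).
Proof.
move=> [mf cf] [mg cg]; split; first exact: measurable_cD.
have mN (h : T -> R[i]) : measurable_fun setT h -> measurable_fun setT (fun x => (normc (h x))%:E).
  by move=> mh; exact/measurable_EFinP/measurable_normc.
apply: (@le_lt_trans _ _ (\int[mu]_x ((normc (f x))%:E + (normc (g x))%:E))%E).
  apply: ge0_le_integral => //.
  - by move=> x _; rewrite lee_fin normc_ge0.
  - exact/mN/measurable_cD.
  - by apply: emeasurable_funD; exact: mN.
  - by move=> x _; rewrite -EFinD lee_fin le_normcD.
rewrite ge0_integralD//; try exact: mN; try by move=> x _; rewrite lee_fin normc_ge0.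
exact: lte_add_pinfty.
Qed.

Lemma cintegrableM mu f (h : T -> R[i]) (M : R) : measurable_fun setT h ->
  (forall x, normc (h x) <= M) -> cintegrable mu f ->
  cintegrable mu (fun x => h x * f x).
Proof.
move=> mh hM [mf cf]; split; first exact: measurable_cM.
apply: (@le_lt_trans _ _ (\int[mu]_x (`|M|%:E * (normc (f x))%:E))%E).
  apply: ge0_le_integral => //.
  - by move=> x _; rewrite lee_fin normc_ge0.
  - exact/measurable_EFinP/measurable_normc/measurable_cM.
  - by apply: measurable_funeM; exact/measurable_EFinP/measurable_normc.
  - move=> x _; rewrite -EFinM lee_fin normcM ler_wpM2r ?normc_ge0//.
    by rewrite (le_trans (hM x))// ler_norm.
rewrite ge0_integralZl//; last 2 first.
- exact/measurable_EFinP/measurable_normc.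
- by move=> x _; rewrite lee_fin normc_ge0.
by apply: lte_mul_pinfty => //; rewrite lee_fin.
Qed.

Lemma cintegrableZ mu f c : cintegrable mu f -> cintegrable mu (fun x => c * f x).
Proof. by apply: (@cintegrableM _ _ (fun=> c) (normc c)). Qed.

Lemma cintegrableN mu f : cintegrable mu f -> cintegrable mu (fun x => - f x).
Proof.
move=> cf; apply: (cintegrable_le _ _ cf); first exact: measurable_cN cf.1.
by move=> x; rewrite normcN.
Qed.

Lemma cintegrableB mu f g : cintegrable mu f -> cintegrable mu g ->
  cintegrable mu (fun x => f x - g x).
Proof. by move=> cf cg; apply: cintegrableD => //; exact: cintegrableN. Qed.

Lemma cintegrableJ mu f : cintegrable mu f -> cintegrable mu (fun x => conjc (f x)).
Proof.
move=> cf; apply: (cintegrable_le _ _ cf); first exact: measurable_cJ cf.1.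
by move=> x; rewrite normcJ.
Qed.

Lemma cintegrable0 mu : cintegrable mu (fun=> 0).
Proof. by split => //; under eq_integral do rewrite normc0; rewrite integral0. Qed.

Lemma cintegrable_sum mu I (r : seq I) (P : pred I) (F : I -> T -> R[i]) :
  (forall i, cintegrable mu (F i)) ->
  cintegrable mu (fun x => \sum_(i <- r | P i) F i x).
Proof.
move=> cF; elim: r => [|i r IH].
  by under eq_fun do rewrite big_nil; exact: cintegrable0.
under eq_fun do rewrite big_cons.
by case: (P i) => //; exact: cintegrableD.
Qed.

Lemma cintegrable_bounded (mu : {finite_measure set T -> \bar R}) f M :
  measurable_fun setT f -> (forall x, normc (f x) <= M) -> cintegrable mu f.
Proof.
move=> mf fM; split => //.
apply: (@le_lt_trans _ _ (\int[mu]_x M%:E)%E).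
  apply: ge0_le_integral => //.
  - by move=> x _; rewrite lee_fin normc_ge0.
  - exact/measurable_EFinP/measurable_normc.
  - by move=> x _; rewrite lee_fin.
rewrite integral_cst// lte_mul_pinfty// ?lee_fin ?(le_trans (normc_ge0 (f point)))//.
by rewrite ltey_eq fin_num_measure.
Qed.

Lemma eq_Cint mu f g : (forall x, f x = g x) -> Cint mu f = Cint mu g.
Proof. by move=> fg; congr (Cintegral _ _); exact/funext. Qed.

Lemma CintD mu f g : cintegrable mu f -> cintegrable mu g ->
  Cint mu (fun x => f x + g x) = Cint mu f + Cint mu g.
Proof.
move=> cf cg; apply: complexP; rewrite ?cReD ?cImD /=.
  under eq_Rintegral do rewrite cReD.
  by rewrite RintegralD//; exact: integrable_cRe.
under eq_Rintegral do rewrite cImD.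
by rewrite RintegralD//; exact: integrable_cIm.
Qed.

Lemma CintZ mu f c : cintegrable mu f -> Cint mu (fun x => c * f x) = c * Cint mu f.
Proof.
move=> cf; have iR := integrable_cRe cf; have iI := integrable_cIm cf.
have iZ (h : T -> R) (k : R) : mu.-integrable setT (EFin \o h) ->
    mu.-integrable setT (EFin \o (fun x => k * h x)).
  by move=> ih; have := integrableZl measurableT k ih.
apply: complexP; rewrite ?cReM ?cImM /=.
  under eq_Rintegral do rewrite cReM.
  rewrite RintegralB//; [|exact: (iZ _ _ iR)|exact: (iZ _ _ iI)].
  by rewrite !RintegralZl.
under eq_Rintegral do rewrite cImM.
rewrite RintegralD//; [|exact: (iZ _ _ iI)|exact: (iZ _ _ iR)].
by rewrite !RintegralZl.
Qed.

Lemma CintN mu f : cintegrable mu f -> Cint mu (fun x => - f x) = - Cint mu f.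
Proof.
move=> cf; rewrite -[RHS]mulN1r -CintZ//; apply: eq_Cint => x.
by rewrite mulN1r.
Qed.

Lemma CintB mu f g : cintegrable mu f -> cintegrable mu g ->
  Cint mu (fun x => f x - g x) = Cint mu f - Cint mu g.
Proof. by move=> cf cg; rewrite CintD ?CintN//; exact: cintegrableN. Qed.

Lemma Cint0 mu : Cint mu (fun=> 0) = 0.
Proof. by rewrite /Cintegral/= /Rintegral integral0. Qed.

Lemma Cint_sum mu I (r : seq I) (P : pred I) (F : I -> T -> R[i]) :
  (forall i, cintegrable mu (F i)) ->
  Cint mu (fun x => \sum_(i <- r | P i) F i x) = \sum_(i <- r | P i) Cint mu (F i).
Proof.
move=> cF; elim: r => [|i r IH].
  by under eq_Cint do rewrite big_nil; rewrite Cint0 big_nil.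
rewrite big_cons -IH; under eq_Cint do rewrite big_cons.
by case: (P i) => //; rewrite CintD//; exact: cintegrable_sum.
Qed.

Lemma CintJ mu f : cintegrable mu f -> Cint mu (fun x => conjc (f x)) = conjc (Cint mu f).
Proof.
move=> cf; apply: complexP; rewrite ?cReJ ?cImJ /=.
  by apply: eq_Rintegral => x _; rewrite cReJ.
rewrite -[RHS]mulN1r -RintegralZl//; last exact: integrable_cIm.
by apply: eq_Rintegral => x _; rewrite cImJ mulN1r.
Qed.

Lemma Rintegral_norm_le mu (h : T -> R) g : measurable_fun setT h ->
  (forall x, `|h x| <= normc (g x)) -> cintegrable mu g ->
  `|\int[mu]_x h x| <= fine (\int[mu]_x (normc (g x))%:E).
Proof.
move=> mh hg cg; have ih := cintegrable_real mh hg cg.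
apply: (le_trans (le_normr_Rintegral measurableT ih)).
rewrite /Rintegral fine_le//.
- exact: (integrable_fin_num measurableT (integrable_norm ih)).
- by rewrite ge0_fin_numE ?cg.2// integral_ge0// => x _; rewrite lee_fin normc_ge0.
apply: ge0_le_integral => //.
- by do 2 apply: measurableT_comp => //.
- by apply/measurable_EFinP/measurable_normc; exact: cg.1.
- by move=> x _; rewrite lee_fin.
Qed.

(** The factor 2 comes from estimating the real and the imaginary part separately; it reappears in
    the constants of all later estimates. *)
Lemma normc_Cint_le mu f : cintegrable mu f ->
  normc (Cint mu f) <= fine (\int[mu]_x (normc (f x))%:E) *+ 2.
Proof.
move=> cf; apply: (le_trans (normc_le_ReIm _)); rewrite mulr2n; apply: lerD => /=.
  apply: (Rintegral_norm_le _ _ cf); first exact: measurable_Re cf.1.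
  by move=> x; exact: le_cRe_normc.
apply: (Rintegral_norm_le _ _ cf); first exact: measurable_Im cf.1.
by move=> x; exact: le_cIm_normc.
Qed.

Lemma Cint_invariant mu (phi : T -> T) f : measurable_fun setT phi ->
  (forall A, measurable A -> mu (phi @^-1` A) = mu A) -> measurable_fun setT f ->
  Cint mu (fun x => f (phi x)) = Cint mu f.
Proof.
move=> mphi h mf.
have key (g : T -> R) : measurable_fun setT g -> \int[mu]_x g (phi x) = \int[mu]_x g x.
  move=> mg; congr fine; rewrite integralE [RHS]integralE.
  have mgE : measurable_fun setT (EFin \o g) by exact/measurable_EFinP.
  congr (_ - _)%E.
    rewrite -(@integral_invariant _ _ _ mu phi (EFin \o g)^\+%E)//.
    - by apply: eq_integral => x _; rewrite !funeposE.
    - exact: measurable_funepos.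
  rewrite -(@integral_invariant _ _ _ mu phi (EFin \o g)^\-%E)//.
  - by apply: eq_integral => x _; rewrite !funenegE.
  - exact: measurable_funeneg.
by apply: complexP => /=; apply: key; [exact: measurable_Re|exact: measurable_Im].
Qed.

Lemma ae_eq_Cint mu f g : measurable_fun setT f -> measurable_fun setT g ->
  {ae mu, forall x, f x = g x} -> Cint mu f = Cint mu g.
Proof.
move=> mf mg fg; have key (c : R[i] -> R) : measurable_fun setT (c \o f) ->
    measurable_fun setT (c \o g) -> \int[mu]_x c (f x) = \int[mu]_x c (g x).
  move=> mcf mcg; congr fine; apply: ae_eq_integral => //; try exact/measurable_EFinP.
  by apply: filterS fg => x fgx _; rewrite fgx.
by apply: complexP => /=; apply: key;
  (exact: measurable_Re || exact: measurable_Im).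
Qed.

End complex_integration.

Notation Cint mu f := (Cintegral mu setT f).

(** * Fubini's theorem for complex integrals *)

Section complex_fubini.
Context {R : realType} d1 d2 (T1 : measurableType d1) (T2 : measurableType d2).
Variables (m1 : {sigma_finite_measure set T1 -> \bar R})
          (m2 : {sigma_finite_measure set T2 -> \bar R}).

Lemma Cint_fubini (f : T1 -> T2 -> R[i]) :
  measurable_fun setT (fun p : T1 * T2 => f p.1 p.2) ->
  (forall x, cintegrable m2 (f x)) -> (forall y, cintegrable m1 (f^~ y)) ->
  (\int[m1]_x \int[m2]_y (normc (f x y))%:E < +oo)%E ->
  Cint m1 (fun x => Cint m2 (f x)) = Cint m2 (fun y => Cint m1 (f^~ y)).
Proof.
move=> mf c2 c1 fin.
have key (g : T1 -> T2 -> R) : measurable_fun setT (fun p : T1 * T2 => g p.1 p.2) ->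
    (forall x y, `|g x y| <= normc (f x y)) ->
    \int[m1]_x \int[m2]_y g x y = \int[m2]_y \int[m1]_x g x y.
  move=> mg gf; congr fine.
  have ig : (m1 \x m2)%E.-integrable setT (fun p => (g p.1 p.2)%:E).
    apply/integrable12ltyP; first exact/measurable_EFinP.
    apply: le_lt_trans fin; apply: ge0_le_integral => //.
    - by move=> x _; exact: integral_ge0.
    - apply: (measurable_fun_fubini_tonelli_F (fun p : T1 * T2 => `|(g p.1 p.2)%:E|%E)) => //.
      by apply: measurableT_comp => //; exact/measurable_EFinP.
    - apply: (measurable_fun_fubini_tonelli_F (fun p : T1 * T2 => (normc (f p.1 p.2))%:E)) => //.
        by apply/measurable_EFinP; apply: measurable_normc.
      by move=> p; rewrite lee_fin normc_ge0.
    - move=> x _; apply: ge0_le_integral => //.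
      + apply: measurableT_comp => //; apply/measurable_EFinP.
        exact: (measurableT_comp mg (pair1_measurable x)).
      + by apply/measurable_EFinP/measurable_normc; exact: (c2 x).1.
      + by move=> y _; rewrite /= lee_fin.
  have := Fubini ig => /=.
  have -> : (\int[m1]_x \int[m2]_y (g x y)%:E = \int[m1]_x (\int[m2]_y g x y)%:E)%E.
    apply: eq_integral => x _; rewrite fineK//.
    apply: (@integrable_fin_num _ _ _ m2 setT _ (fun y => (g x y)%:E)) => //.
    apply: (cintegrable_real _ (gf x) (c2 x)).
    exact: (measurableT_comp mg (pair1_measurable x)).
  have -> // : (\int[m2]_y \int[m1]_x (g x y)%:E = \int[m2]_y (\int[m1]_x g x y)%:E)%E.
  apply: eq_integral => y _; rewrite fineK//.
  apply: (@integrable_fin_num _ _ _ m1 setT _ (fun x => (g x y)%:E)) => //.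
  apply: (cintegrable_real _ (fun x => gf x y) (c1 y)).
  exact: (measurableT_comp mg (pair2_measurable y)).
apply: complexP.
  by apply: key => [|x y]; [exact: measurable_Re|exact: le_cRe_normc].
by apply: key => [|x y]; [exact: measurable_Im|exact: le_cIm_normc].
Qed.

(** The integrals of the positive and of the negative part are measurable by Tonelli's theorem, and
    so are their difference and its [fine] part. *)
Lemma measurable_Cint (f : T1 -> T2 -> R[i]) :
  measurable_fun setT (fun p : T1 * T2 => f p.1 p.2) ->
  measurable_fun setT (fun x => Cint m2 (f x)).
Proof.
move=> mf; have key (g : T1 -> T2 -> R) : measurable_fun setT (fun p : T1 * T2 => g p.1 p.2) ->
    measurable_fun setT (fun x => \int[m2]_y g x y).
  move=> mg; apply: (measurableT_comp (f := @fine R)) => //.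
  have mgE : measurable_fun setT (fun p : T1 * T2 => (g p.1 p.2)%:E) by exact/measurable_EFinP.
  under eq_fun do rewrite integralE.
  apply: emeasurable_funB.
    rewrite (_ : (fun _ => _) = fubini_F m2 (fun p => maxe (g p.1 p.2)%:E 0)%E).
      apply: measurable_fun_fubini_tonelli_F => [|p]; last by rewrite le_max lexx orbT.
      exact: measurable_maxe.
    by apply/funext => x; apply: eq_integral => y _; rewrite funeposE.
  rewrite (_ : (fun _ => _) = fubini_F m2 (fun p => maxe (- (g p.1 p.2)%:E) 0)%E).
    apply: measurable_fun_fubini_tonelli_F => [|p]; last by rewrite le_max lexx orbT.
    by apply: measurable_maxe => //; apply: measurableT_comp.
  by apply/funext => x; apply: eq_integral => y _; rewrite funenegE.
by apply: measurable_complexP; apply: key; [exact: measurable_Re|exact: measurable_Im].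
Qed.

End complex_fubini.

(** * The weighted Bergman measure *)

Section iterated_product.
Context {R : realType} d1 d2 d3 (T1 : measurableType d1) (T2 : measurableType d2)
  (T3 : measurableType d3) (m1 : {sigma_finite_measure set T1 -> \bar R})
  (m2 : {sigma_finite_measure set T2 -> \bar R})
  (m3 : {sigma_finite_measure set T3 -> \bar R}).
Local Open Scope ereal_scope.

(* The library's sigma-finite structure on [m1 \x m2] is not found by
   unification, hence this copy. *)
Let m12 : set (T1 * T2) -> \bar R := m1 \x m2.

HB.instance Definition _ := Measure.copy m12 (m1 \x m2).

Let m12_sigma_finite : sigma_finite setT m12.
Proof.
have /sigma_finiteP[F [TF ndF Foo]] := sigma_finiteT m1.
have /sigma_finiteP[G [TG ndG Goo]] := sigma_finiteT m2.
exists (fun n => F n `*` G n).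
  rewrite -setXTT TF TG predeqE => -[x y]; split.
    move=> [/= [n _ Fnx] [k _ Gky]]; exists (maxn n k) => //; split.
    - by move: x Fnx; exact/subsetPset/ndF/leq_maxl.
    - by move: y Gky; exact/subsetPset/ndG/leq_maxr.
  by move=> [n _ []/= ? ?]; split; exists n.
move=> k; have [? ?] := Foo k; have [? ?] := Goo k.
split; first exact: measurableX.
by rewrite /m12 product_measure1E// lte_mul_pinfty// ge0_fin_numE.
Qed.

HB.instance Definition _ := Measure_isSigmaFinite.Build _ _ _ m12 m12_sigma_finite.

Lemma tonelli3 (f : T1 * T2 * T3 -> \bar R) :
  measurable_fun setT f -> (forall p, 0 <= f p) ->
  \int[((m1 \x m2) \x m3)]_p f p = \int[m1]_x \int[m2]_y \int[m3]_z f (x, y, z).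
Proof.
move=> mf f0; apply: (etrans (fubini_tonelli1 (m1 := m12) (m2 := m3) f mf f0)).
have F0 p : 0 <= fubini_F m3 f p by apply: integral_ge0 => z _; exact: f0.
exact: (fubini_tonelli1 (m1 := m1) (m2 := m2) _ (measurable_fun_fubini_tonelli_F _ mf f0) F0).
Qed.

End iterated_product.

Section weighted_measure.
Context {R : realType}.
Local Notation V n := 'cV[R[i]]_n.
Local Notation mu := (@lebesgue_measure R).

Lemma lebS_integral n (f : V n.+1 -> \bar R) : measurable_fun setT f ->
  (forall z, 0 <= f z)%E ->
  (\int[@leb R n.+1]_z f z =
   \int[@leb R n]_v \int[mu]_x \int[mu]_y f (complex_cons (v, x, y)))%E.
Proof.
move=> mf f0.
have mfc : measurable_fun setT (f \o @complex_cons R n).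
  by apply: (measurableT_comp mf); exact: measurable_complex_cons.
transitivity (\int[((@leb R n \x mu) \x mu)]_p (f \o @complex_cons R n) p)%E.
  rewrite -[LHS]/(integral (pushforward ((lebesgue_Cn R n \x mu) \x mu)%E (@complex_cons R n)) setT f).
  rewrite ge0_integral_pushforward ?preimage_setT//.
  exact: measurable_complex_cons.
exact: (@tonelli3 R _ _ _ _ _ _ (@leb R n) mu mu _ mfc (fun p => f0 _)).
Qed.

Lemma sqnorm_complex_cons n (v : V n) x y :
  sqnorm (complex_cons (v, x, y)) = x ^+ 2 + y ^+ 2 + sqnorm v.
Proof.
rewrite /sqnorm big_ord_recl; congr (_ + _).
  rewrite /complex_cons (_ : ord0 = lshift n 0 :> 'I_(1 + n)); last exact/val_inj.
  by rewrite (@col_mxEu _ 1 n) mxE mulr1n sqr_normc.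
apply: eq_bigr => i _; rewrite /complex_cons.
rewrite (_ : lift ord0 i = rshift 1 i :> 'I_(1 + n)); last exact/val_inj.
by rewrite (@col_mxEd _ 1 n).
Qed.

(** Each of the two real integrations over the new coordinate raises the exponent by [1/2], so the
    induction hypothesis is used at [l + 1]; this is why [l] varies in the induction. *)
Lemma integral_pospow_ball n (l : R) : -1 < l -> exists2 C : R, 0 <= C &
  forall c, (\int[@leb R n]_z (pospow l (c - sqnorm z))%:E <= (C * pospow (l + n%:R) c)%:E)%E.
Proof.
elim: n l => [|n IH] l l1.
  exists 1 => // c; rewrite addr0 mul1r integral_dirac// ?diracT ?mul1e.
    by rewrite /sqnorm big_ord0 subr0.
  apply/measurable_EFinP; apply: (measurableT_comp (measurable_pospow l)).
  by apply: measurable_funB => //; exact: measurable_sqnorm.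
have l2 : -1 < l + 2^-1 by lra.
have l3 : -1 < l + 1 by lra.
have [C1 C10 h1] := integral_pospow_parabola l1.
have [C2 C20 h2] := integral_pospow_parabola l2.
have [C3 C30 h3] := IH _ l3.
have mpp (d : measure_display) (T : measurableType d) (l' : R) (h : T -> R) : measurable_fun setT h ->
    measurable_fun setT (fun x => (pospow l' (h x))%:E).
  by move=> mh; apply/measurable_EFinP; apply: (measurableT_comp (measurable_pospow _)).
exists (C1 * C2 * C3); first by rewrite !mulr_ge0.
move=> c; rewrite lebS_integral; last 2 first.
- by apply: mpp; apply: measurable_funB => //; exact: measurable_sqnorm.
- by move=> z; rewrite lee_fin pospow_ge0.
have mF : measurable_fun setT (fun p : V n * R * R => (pospow l (c - sqnorm (complex_cons p)))%:E : \bar R).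
  apply: mpp; apply: measurable_funB => //.
  by apply: measurableT_comp; [exact: measurable_sqnorm|exact: measurable_complex_cons].
have F0 (p : V n * R * R) : (0 <= (pospow l (c - sqnorm (complex_cons p)))%:E :> \bar R)%E.
  by rewrite lee_fin pospow_ge0.
have mF1 := measurable_fun_fubini_tonelli_F (m2 := mu) _ mF F0.
have F10 p : (0 <= fubini_F mu (fun p : V n * R * R => (pospow l (c - sqnorm (complex_cons p)))%:E) p)%E.
  by apply: integral_ge0 => y _; exact: F0.
have mF2 := measurable_fun_fubini_tonelli_F (m2 := mu) _ mF1 F10.
apply: (@le_trans _ _ (\int[@leb R n]_v ((C1 * C2)%:E * (pospow (l + 1) (c - sqnorm v))%:E))%E).
  apply: ge0_le_integral => //.
  - by move=> v _; apply: integral_ge0 => x _; apply: integral_ge0 => y _; rewrite lee_fin pospow_ge0.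
  - by apply: measurable_funeM; apply: mpp; apply: measurable_funB => //; exact: measurable_sqnorm.
  move=> v _.
  apply: (@le_trans _ _ (\int[mu]_x (C1%:E * (pospow (l + 2^-1) ((c - sqnorm v) - x ^+ 2))%:E))%E).
    apply: ge0_le_integral; first exact: measurableT.
    - by move=> x _; apply: integral_ge0 => y _; rewrite lee_fin pospow_ge0.
    - exact: (measurableT_comp mF1 (pair1_measurable v)).
    - apply: measurable_funeM; apply: mpp; apply: measurable_funB => //; exact: measurable_funX.
    move=> x _; apply: le_trans (h1 (c - sqnorm v - x ^+ 2)).
    rewrite le_eqVlt; apply/orP; left; apply/eqP; apply: eq_integral => y _.
    by rewrite sqnorm_complex_cons; congr (pospow _ _)%:E; ring.
  rewrite ge0_integralZl//; last 2 first.
  - apply: mpp; apply: measurable_funB => //; exact: measurable_funX.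
  - by move=> x _; rewrite lee_fin pospow_ge0.
  rewrite EFinM -muleA; apply: lee_wpmul2l; first by rewrite lee_fin.
  by have := h2 (c - sqnorm v); rewrite -EFinM (_ : l + 2^-1 + 2^-1 = l + 1)//; lra.
rewrite ge0_integralZl//; last 3 first.
- by apply: mpp; apply: measurable_funB => //; exact: measurable_sqnorm.
- by move=> v _; rewrite lee_fin pospow_ge0.
- by rewrite lee_fin mulr_ge0.
apply: (@le_trans _ _ ((C1 * C2)%:E * (C3 * pospow (l + n.+1%:R) c)%:E)%E); last first.
  by rewrite -EFinM mulrA.
apply: lee_wpmul2l; first by rewrite lee_fin mulr_ge0.
by have := h3 c; rewrite -addrA nat1r.
Qed.

Section fixed_dimension.
Variables (n : nat) (la : R).
Local Notation B := (Bn R n).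

(** Cut off at the sphere, so that the weighted measure lives on the whole space and changes of
    variable by unitary matrices carry no domain along. *)
Definition wt (z : V n) : R := weight la z * \1_B z.

Lemma weight_const_ge0 : 0 <= Gamma (n%:R + la + 1) / (pi ^+ n * Gamma (la + 1)).
Proof.
have G0 (x : R) : 0 <= Gamma x.
  by apply: Rintegral_ge0 => t _; rewrite mulr_ge0 ?powR_ge0 ?expR_ge0.
by rewrite divr_ge0 ?mulr_ge0 ?exprn_ge0 ?pi_ge0.
Qed.

Lemma wt_ge0 z : 0 <= wt z.
Proof.
apply: mulr_ge0 => //; apply: mulr_ge0; [exact: weight_const_ge0|exact: powR_ge0].
Qed.

Lemma measurable_weight : measurable_fun setT (@weight R n la).
Proof.
apply: measurable_funM => //.
apply: (measurableT_comp (f := fun t : R => t `^ la)); first exact: measurable_powR.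
by apply: measurable_funB => //; exact: measurable_sqnorm.
Qed.

Lemma measurable_wt : measurable_fun setT wt.
Proof.
apply: measurable_funM; first exact: measurable_weight.
by apply: measurable_indic; exact: measurable_Bn.
Qed.

Lemma wt_gt0 z : -1 < la -> B z -> 0 < wt z.
Proof.
move=> la1 Bz; rewrite /wt indicE mem_set// mulr1 /weight.
rewrite mulr_gt0 ?powR_gt0//; last by rewrite subr_gt0.
have n0 : 0 <= n%:R :> R by [].
by rewrite divr_gt0 ?mulr_gt0 ?exprn_gt0 ?pi_gt0 ?Gamma_gt0//; lra.
Qed.

Hypothesis la1 : -1 < la.

Lemma integral_wt_lty : (\int[@leb R n]_z (wt z)%:E < +oo)%E.
Proof.
have [C C0 h] := integral_pospow_ball n la1.
pose c := Gamma (n%:R + la + 1) / (pi ^+ n * Gamma (la + 1)).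
have mp : measurable_fun setT (fun z : V n => (pospow la (1 - sqnorm z))%:E).
  apply/measurable_EFinP; apply: (measurableT_comp (measurable_pospow _)).
  by apply: measurable_funB => //; exact: measurable_sqnorm.
apply: (@le_lt_trans _ _ (\int[@leb R n]_z (c%:E * (pospow la (1 - sqnorm z))%:E))%E).
  apply: ge0_le_integral => //.
  - by move=> z _; rewrite lee_fin wt_ge0.
  - apply/measurable_EFinP; exact: measurable_wt.
  - exact: measurable_funeM.
  move=> z _; rewrite -EFinM lee_fin /wt indicE.
  have [zB|zB] := boolP (z \in B).
    move: zB; rewrite inE => Bz; rewrite mulr1 /weight /pospow subr_gt0.
    by rewrite (_ : sqnorm z < 1).
  by rewrite mulr0 mulr_ge0 ?weight_const_ge0 ?pospow_ge0.
rewrite ge0_integralZl//; last 2 first.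
- by move=> z _; rewrite lee_fin pospow_ge0.
- by rewrite lee_fin weight_const_ge0.
by rewrite lte_mul_pinfty// ?lee_fin ?weight_const_ge0// (le_lt_trans (h 1))// ltry.
Qed.

(** The measure [dv_lambda] extended by zero off the ball. The proof of [-1 < la] is an argument so
    that finiteness can be attached to the term [bnu la1]. *)
Definition bnu of -1 < la := dens (@leb R n) measurable_wt wt_ge0.

HB.instance Definition _ := Measure.on (bnu la1).

Let bnu_finite : fin_num_fun (bnu la1).
Proof.
move=> A mA; rewrite ge0_fin_numE; last exact: measure_ge0.
apply: le_lt_trans integral_wt_lty; apply: ge0_subset_integral => //.
- by apply/measurable_EFinP; exact: measurable_wt.
- by move=> z _; rewrite lee_fin wt_ge0.
Qed.

HB.instance Definition _ := Measure_isFinite.Build _ _ _ (bnu la1) bnu_finite.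

Lemma bnu_eq0 A : measurable A -> leb A = 0%E -> bnu la1 A = 0%E.
Proof. exact: dens_eq0. Qed.

Lemma ae_bnu (P : V n -> Prop) :
  {ae lebesgue_Cn R n, forall z, P z} -> {ae bnu la1, forall z, P z}.
Proof. by move=> [A [mA A0 PA]]; exists A; split => //; exact: bnu_eq0. Qed.

Lemma ae_bnu_ball : {ae bnu la1, forall z, B z}.
Proof.
exists (~` B); split => //; first by apply: measurableC; exact: measurable_Bn.
rewrite /bnu /dens /= integral0_eq// => z Bz.
by rewrite /wt indicE memNset// mulr0.
Qed.

Lemma bnu_unitary (U : 'M[R[i]]_n) A : U \is unitarymx -> measurable A ->
  bnu la1 ((fun v => U *m v) @^-1` A) = bnu la1 A.
Proof.
move=> uU mA.
have mU : measurable_fun setT (fun v : V n => U *m v).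
  by apply: measurable_mulmx => //; exact: measurable_cst.
rewrite /bnu /dens /= [LHS]integral_mkcond [RHS]integral_mkcond.
rewrite -(@integral_invariant R _ _ (@leb R n) (fun v => U *m v) ((fun z => (wt z)%:E) \_ A))//.
- apply: eq_integral => z _; rewrite !patchE.
  rewrite (_ : (z \in _) = (U *m z \in A)); last first.
    by apply/idP/idP; rewrite !inE.
  case: ifP => // _; rewrite /wt /weight sqnorm_unitary//; congr (_ * _)%:E.
  rewrite !indicE; congr ((nat_of_bool _)%:R).
  by apply/idP/idP; rewrite !inE; rewrite (Bn_unitary _ uU).
- by move=> E mE; exact: leb_unitary.
- by apply/measurable_restrict => //; apply: measurable_funTS; apply/measurable_EFinP; exact: measurable_wt.
- by move=> z; rewrite patchE; case: ifP => // _; rewrite lee_fin wt_ge0.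
Qed.

Lemma Cint_bnu_unitary (U : 'M[R[i]]_n) f : U \is unitarymx ->
  measurable_fun setT f ->
  Cint (bnu la1) (fun z => f (U *m z)) = Cint (bnu la1) f.
Proof.
move=> uU mf; apply: Cint_invariant => //.
  by apply: measurable_mulmx => //; exact: measurable_cst.
by move=> A mA; exact: bnu_unitary.
Qed.

(** If the integral of the weight over [A] were 0, the weight would vanish almost everywhere on [A];
    but it is positive at every point of the ball. *)
Lemma bnu_gt0 A : measurable A -> A `<=` B -> (0 < leb A)%E -> (0 < bnu la1 A)%E.
Proof.
move=> mA AB A0; rewrite lt_neqAle measure_ge0 andbT eq_sym; apply/eqP => nA.
have mw : measurable_fun A (fun z => (wt z)%:E).
  by apply: measurable_funTS; apply/measurable_EFinP; exact: measurable_wt.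
have := (ae_eq_integral_abs (@leb R n) mA mw).1.
rewrite (_ : (\int[_]_(x in A) `|_|)%E = bnu la1 A); last first.
  by apply: eq_integral => z _; rewrite gee0_abs// lee_fin wt_ge0.
move=> /(_ nA) [N [mN N0 AN]].
have : (leb A <= leb N)%E.
  apply: le_measure; rewrite ?inE// => z Az; apply: AN => /= /(_ Az) [] /eqP.
  by rewrite gt_eqF// wt_gt0//; exact: AB.
by rewrite N0 leNgt A0.
Qed.

Lemma inner_bnu (f g : V n -> R[i]) : measurable_fun setT f -> measurable_fun setT g ->
  inner la f g = Cint (bnu la1) (fun z => f z * conjc (g z)).
Proof.
move=> mf mg.
have mfg : measurable_fun setT (fun z => f z * conjc (g z)).
  by apply: measurable_cM => //; exact: measurable_cJ.
have key (c : R[i] -> R) : measurable_fun setT (fun z => c (f z * conjc (g z))) ->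
    (forall x (r : R), c (x * r%:C%C) = c x * r) ->
    \int[lebesgue_Cn R n]_(z in B) c (f z * conjc (g z) * (weight la z)%:C%C) =
    \int[bnu la1]_z c (f z * conjc (g z)).
  move=> mc cM; congr fine; rewrite /bnu integral_dens; last exact/measurable_EFinP.
  rewrite integral_mkcond; apply: eq_integral => z _; rewrite patchE /wt indicE cM.
  by case: ifP => _; rewrite ?mulr1 ?mulr0 ?mule0// EFinM.
by apply: complexP => /=; apply: key;
  do ?[exact: measurable_Re|exact: measurable_Im|
   move=> x r; rewrite ?cReM ?cImM/= mulr0 ?subr0 ?add0r].
Qed.

Lemma L2_bnu (f : V n -> R[i]) : measurable_fun setT f -> L2 la f <->
  (\int[bnu la1]_z (normc (f z) ^+ 2)%:E < +oo)%E.
Proof.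
move=> mf.
suff -> : (\int[bnu la1]_z (normc (f z) ^+ 2)%:E =
    \int[lebesgue_Cn R n]_(z in B) (normc (f z) ^+ 2 * weight la z)%:E)%E.
  by split => [[]//|h]; split => //; exact: measurable_funTS.
rewrite /bnu integral_dens; last exact/measurable_EFinP/measurable_sqr_normc.
rewrite [RHS]integral_mkcond; apply: eq_integral => z _; rewrite patchE /wt indicE.
by case: ifP => _; rewrite ?mulr1 ?mulr0 ?mule0// EFinM.
Qed.

End fixed_dimension.
End weighted_measure.

(** * Closed forms on a rectangle *)

Section closed_forms.
Context {R : realType}.
Local Notation mu := (@lebesgue_measure R).
Implicit Types (P Q : R -> R -> R).

(** The form [P dx + Q dy] is differentiable at the point, and the shared coefficient [B] says that
    [dP/dy = dQ/dx] there. As in Goursat's theorem, only differentiability at the point is asked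
    for. *)
Definition closed_form_at P Q (x y : R) := exists A B C : R, forall e : R, 0 < e ->
  exists2 d : R, 0 < d & forall h k, `|h| <= d -> `|k| <= d ->
    `|P (x + h) (y + k) - (P x y + A * h + B * k)| <= e * (`|h| + `|k|) /\
    `|Q (x + h) (y + k) - (Q x y + B * h + C * k)| <= e * (`|h| + `|k|).

Lemma continuous_of_linear_bound (f : R -> R) (x A : R) :
  (exists2 d : R, 0 < d & forall h, `|h| <= d -> `|f (x + h) - (f x + A * h)| <= `|h|) ->
  {for x, continuous f}.
Proof.
move=> [d d0 H]; apply/cvgrPdist_le => e e0.
have K0 : 0 < 1 + `|A| by rewrite ltr_pwDl.
exists (Num.min d (e / (1 + `|A|))); first by rewrite /= lt_min d0 divr_gt0.
move=> y /=; rewrite lt_min => /andP[h1 h2].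
have hxy : `|y - x| <= d by rewrite distrC ltW.
have xyE : x + (y - x) = y by ring.
have := H _ hxy; rewrite xyE => {}H.
have -> : f x - f y = - (f y - (f x + A * (y - x))) - A * (y - x) by ring.
apply: (le_trans (ler_normB _ _)); rewrite normrN normrM.
apply: (@le_trans _ _ ((1 + `|A|) * `|y - x|)); first by rewrite mulrDl mul1r lerD2r.
by rewrite mulrC -ler_pdivlMr// distrC ltW.
Qed.

Lemma segment_split (f : R -> R) (a b c : R) : a <= b -> b <= c ->
  mu.-integrable `[a, c] (EFin \o f) ->
  \int[mu]_(x in `[a, c]) f x = \int[mu]_(x in `[a, b]) f x + \int[mu]_(x in `[b, c]) f x.
Proof.
move=> ab bc itf.
rewrite -(@Rintegral_itv_obnd_cbnd _ b (BRight c)); last first.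
  by apply: integrableS itf => //; apply: subset_itvr; rewrite bnd_simp.
by rewrite -(@Rintegral_itvB _ f (BLeft a) (BRight c) b)// addrC subrK.
Qed.

Lemma Rintegral_segment_bound (f : R -> R) (a l K e : R) : 0 <= l ->
  mu.-integrable `[a, a + l] (EFin \o f) ->
  (forall x, a <= x <= a + l -> `|f x - K| <= e) ->
  `|\int[mu]_(x in `[a, a + l]) f x - K * l| <= e * l.
Proof.
move=> l0 itf fK.
have mI : measurable (`[a, a + l]%classic : set R) by exact: measurable_itv.
have mul : lebesgue_measure (`[a, a + l]%classic : set R) = l%:E.
  rewrite lebesgue_measure_itv/= lte_fin ltrDl.
  have [_|l1] := ltP 0 l; first by rewrite -EFinB addrAC subrr add0r.
  by congr EFin; apply/le_anti; rewrite l0 l1.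
have ice (c : R) : (\int[mu]_(x in `[a, (a + l)%R]) c%:E = (c * l)%:E)%E.
  by rewrite EFinM; apply: (etrans (integral_cst mu mI c%:E)); congr (_ * _)%E; exact: mul.
have ic (c : R) : mu.-integrable `[a, a + l] (EFin \o cst c).
  apply/integrableP; split; first by apply/measurable_EFinP.
  by apply: (@le_lt_trans _ _ (`|c| * l)%:E); [rewrite -ice|rewrite ltry].
have icE (c : R) : \int[mu]_(x in `[a, a + l]) c = c * l by rewrite /Rintegral ice.
rewrite -icE -RintegralB//; last exact: ic.
have iB : mu.-integrable `[a, a + l] (EFin \o (f \- cst K)).
  exact: (@integrableB _ _ _ mu _ mI _ _ itf (ic K)).
apply: (@le_trans _ _ (\int[mu]_(x in `[a, a + l]) `|(f \- cst K) x|)).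
  exact: le_normr_Rintegral.
rewrite -(icE e); apply: le_Rintegral => //.
  exact: integrable_norm.
exact: ic.
Qed.

Section rectangle.
Variables (P Q : R -> R -> R) (a L b M : R).
Hypotheses (L0 : 0 <= L) (M0 : 0 <= M).
Hypothesis closedPQ : forall x y, a <= x <= a + L -> b <= y <= b + M ->
  closed_form_at P Q x y.

(** The integral of [P dx + Q dy] along the boundary of [[x, x + l] x [y, y + m]], with opposite
    sides grouped together. *)
Let J (x l y m : R) := \int[mu]_(t in `[x, x + l]) (P t y - P t (y + m)) +
  \int[mu]_(t in `[y, y + m]) (Q (x + l) t - Q x t).

Let contP x y : a <= x <= a + L -> b <= y <= b + M -> {for x, continuous (P^~ y)}.
Proof.
move=> hx hy; have [A [B [C H]]] := closedPQ hx hy.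
have [d d0 {}H] := H _ ltr01.
apply: (@continuous_of_linear_bound _ _ A); exists d => // h hh.
have zd : `|0 : R| <= d by rewrite normr0 ltW.
have [+ _] := H h 0 hh zd.
by rewrite addr0 mulr0 addr0 normr0 addr0 mul1r.
Qed.

Let contQ x y : a <= x <= a + L -> b <= y <= b + M -> {for y, continuous (Q x)}.
Proof.
move=> hx hy; have [A [B [C H]]] := closedPQ hx hy.
have [d d0 {}H] := H _ ltr01.
apply: (@continuous_of_linear_bound _ _ C); exists d => // h hh.
have zd : `|0 : R| <= d by rewrite normr0 ltW.
have [_ +] := H 0 h zd hh.
by rewrite addr0 mulr0 addr0 normr0 add0r mul1r.
Qed.

Let intP x l y : 0 <= l -> a <= x -> x + l <= a + L -> b <= y <= b + M ->
  mu.-integrable `[x, x + l] (EFin \o (P^~ y)).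
Proof.
move=> l0 ax xL hy; apply: continuous_compact_integrable; first exact: segment_compact.
apply: continuous_in_subspaceT => t; rewrite inE/= in_itv/= => /andP[t1 t2].
by apply: contP => //; rewrite (le_trans ax)//= (le_trans t2).
Qed.

Let intQ x y m : 0 <= m -> b <= y -> y + m <= b + M -> a <= x <= a + L ->
  mu.-integrable `[y, y + m] (EFin \o (Q x)).
Proof.
move=> m0 ay yM hx; apply: continuous_compact_integrable; first exact: segment_compact.
apply: continuous_in_subspaceT => t; rewrite inE/= in_itv/= => /andP[t1 t2].
by apply: contQ => //; rewrite (le_trans ay)//= (le_trans t2).
Qed.

Let intPB x l y m : 0 <= l -> 0 <= m -> a <= x -> x + l <= a + L -> b <= y -> y + m <= b + M ->
  mu.-integrable `[x, x + l] (EFin \o (fun t => P t y - P t (y + m))).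
Proof.
move=> l0 m0 ax xL ay yM.
have i1 : mu.-integrable `[x, x + l] (EFin \o (P^~ y)) by apply: intP => //; lra.
have i2 : mu.-integrable `[x, x + l] (EFin \o (P^~ (y + m))) by apply: intP => //; lra.
by have := @integrableB _ _ _ mu _ (measurable_itv _) _ _ i1 i2.
Qed.

Let intQB x l y m : 0 <= l -> 0 <= m -> a <= x -> x + l <= a + L -> b <= y -> y + m <= b + M ->
  mu.-integrable `[y, y + m] (EFin \o (fun t => Q (x + l) t - Q x t)).
Proof.
move=> l0 m0 ax xL ay yM.
have i1 : mu.-integrable `[y, y + m] (EFin \o (Q (x + l))) by apply: intQ => //; lra.
have i2 : mu.-integrable `[y, y + m] (EFin \o (Q x)) by apply: intQ => //; lra.
by have := @integrableB _ _ _ mu _ (measurable_itv _) _ _ i1 i2.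
Qed.

Let sub_rect x l y m := [/\ 0 <= l, 0 <= m, a <= x, x + l <= a + L & b <= y /\ y + m <= b + M].

Let J_halfx x l y m : sub_rect x l y m ->
  J x l y m = J x (l / 2) y m + J (x + l / 2) (l / 2) y m.
Proof.
move=> [l0 m0 ax xL [ay yM]]; rewrite /J.
have e : x + l / 2 + l / 2 = x + l by lra.
rewrite (@segment_split _ x (x + l / 2) (x + l)); [|lra|lra|exact: intPB].
rewrite e addrACA; congr (_ + _).
rewrite -RintegralD; [|exact: measurable_itv|by apply: intQB => //; lra|].
  by apply: eq_Rintegral => t _; ring.
by have := @intQB (x + l / 2) (l / 2) y m; rewrite e; apply => //; lra.
Qed.

Let J_halfy x l y m : sub_rect x l y m ->
  J x l y m = J x l y (m / 2) + J x l (y + m / 2) (m / 2).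
Proof.
move=> [l0 m0 ax xL [ay yM]]; rewrite /J.
have e : y + m / 2 + m / 2 = y + m by lra.
rewrite (@segment_split _ y (y + m / 2) (y + m)); [|lra|lra|exact: intQB].
rewrite e addrACA; congr (_ + _).
rewrite -RintegralD; [|exact: measurable_itv|by apply: intPB => //; lra|].
  by apply: eq_Rintegral => t _; ring.
by have := @intPB x l (y + m / 2) (m / 2); rewrite e; apply => //; lra.
Qed.

Let l_ N := L / 2 ^+ N.
Let m_ N := M / 2 ^+ N.

Let l_half N : l_ N / 2 = l_ N.+1.
Proof. by rewrite /l_ exprSr invfM mulrA. Qed.
Let m_half N : m_ N / 2 = m_ N.+1.
Proof. by rewrite /m_ exprSr invfM mulrA. Qed.
Let l_ge0 N : 0 <= l_ N. Proof. by rewrite divr_ge0 ?exprn_ge0. Qed.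
Let m_ge0 N : 0 <= m_ N. Proof. by rewrite divr_ge0 ?exprn_ge0. Qed.

(** Halves the rectangle in [x], then in [y], keeping each time the first half if its boundary
    integral has at least half the modulus and the other one if not. The quarter that remains
    carries at least a quarter of the modulus. *)
Let step N (s : R * R) : R * R :=
  let x := if `|J s.1 (l_ N) s.2 (m_ N)| / 2 <= `|J s.1 (l_ N.+1) s.2 (m_ N)|
           then s.1 else s.1 + l_ N.+1 in
  let y := if `|J x (l_ N.+1) s.2 (m_ N)| / 2 <= `|J x (l_ N.+1) s.2 (m_ N.+1)|
           then s.2 else s.2 + m_ N.+1 in (x, y).

Let seqs := fix seqs N : R * R := if N is N'.+1 then step N' (seqs N') else (a, b).

Let half_choice (u v w : R) : u = v + w -> ~~ (`|u| / 2 <= `|v|) -> `|u| / 2 <= `|w|.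
Proof. by move=> ->; rewrite -ltNge => h; have := ler_normD v w; lra. Qed.

Let seqsP N : sub_rect (seqs N).1 (l_ N) (seqs N).2 (m_ N) /\
  `|J a L b M| / 4 ^+ N <= `|J (seqs N).1 (l_ N) (seqs N).2 (m_ N)|.
Proof.
elim: N => [|N [sr IH]].
  by rewrite /l_ /m_ expr0 !divr1; split => //=; split => //; lra.
rewrite /=; move: (seqs N) sr IH => [x y] /= sr IH.
rewrite /step /=; set x' := if _ then _ else _; set y' := if _ then _ else _.
have lN := l_half N; have mN := m_half N.
have lg := l_ge0 N.+1; have mg := m_ge0 N.+1.
have [_ _ ax xL [ay yM]] := sr.
have sx : sub_rect x' (l_ N.+1) y (m_ N).
  by rewrite /x'; case: ifP => _; split => //; lra.
have sy : sub_rect x' (l_ N.+1) y' (m_ N.+1).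
  have [? ? ? ? [? ?]] := sx.
  by rewrite /y'; case: ifP => _; split => //; lra.
split => //.
have h1 : `|J x (l_ N) y (m_ N)| / 2 <= `|J x' (l_ N.+1) y (m_ N)|.
  rewrite /x'; case: ifPn => // h; apply: half_choice h.
  by rewrite (J_halfx sr) lN.
have h2 : `|J x' (l_ N.+1) y (m_ N)| / 2 <= `|J x' (l_ N.+1) y' (m_ N.+1)|.
  rewrite /y'; case: ifPn => // h; apply: half_choice h.
  by rewrite (J_halfy sx) mN.
have : `|J a L b M| / 4 ^+ N.+1 = `|J a L b M| / 4 ^+ N / 4 by rewrite exprSr invfM mulrA.
by lra.
Qed.

Let seqsS N : [/\ (seqs N).1 <= (seqs N.+1).1, (seqs N).2 <= (seqs N.+1).2,
  (seqs N.+1).1 + l_ N.+1 <= (seqs N).1 + l_ N & (seqs N.+1).2 + m_ N.+1 <= (seqs N).2 + m_ N].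
Proof.
rewrite /=; move: (seqs N) => [x y] /=.
have lN := l_half N; have mN := m_half N.
have lg := l_ge0 N.+1; have mg := m_ge0 N.+1.
by rewrite /step /=; split; case: ifP => _; lra.
Qed.

Let seqs_mono N K : [/\ (seqs N).1 <= (seqs (N + K)%N).1, (seqs N).2 <= (seqs (N + K)%N).2,
  (seqs (N + K)%N).1 + l_ (N + K)%N <= (seqs N).1 + l_ N &
  (seqs (N + K)%N).2 + m_ (N + K)%N <= (seqs N).2 + m_ N].
Proof.
elim: K => [|K [h1 h2 h3 h4]]; first by rewrite addn0.
rewrite addnS; have [k1 k2 k3 k4] := seqsS (N + K).
by split; [exact: le_trans k1|exact: le_trans k2|exact: le_trans h3|exact: le_trans h4].
Qed.

(** Nested intervals: the suprema of the left and of the lower ends, which every right, respectively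
    upper, end bounds from above. *)
Let limit_point : exists x y, forall N, (seqs N).1 <= x <= (seqs N).1 + l_ N /\
  (seqs N).2 <= y <= (seqs N).2 + m_ N.
Proof.
have ubx N K : (seqs K).1 <= (seqs N).1 + l_ N.
  have [NK|KN] := leqP N K.
    by have [_ _ h _] := seqs_mono N (K - N); move: h; rewrite subnKC//; have := l_ge0 K; lra.
  by have [h _ _ _] := seqs_mono K (N - K); move: h; rewrite (subnKC (ltnW KN)); have := l_ge0 N; lra.
have uby N K : (seqs K).2 <= (seqs N).2 + m_ N.
  have [NK|KN] := leqP N K.
    by have [_ _ _ h] := seqs_mono N (K - N); move: h; rewrite subnKC//; have := m_ge0 K; lra.
  by have [_ h _ _] := seqs_mono K (N - K); move: h; rewrite (subnKC (ltnW KN)); have := m_ge0 N; lra.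
pose X := range (fun N => (seqs N).1); pose Y := range (fun N => (seqs N).2).
have X0 : X !=set0 by exists (seqs 0).1; exists 0%N.
have Y0 : Y !=set0 by exists (seqs 0).2; exists 0%N.
exists (sup X), (sup Y) => N; split; apply/andP; split.
- by apply: ub_le_sup; [exists ((seqs 0).1 + l_ 0) => _ [K _ <-]|exists N].
- by apply: ge_sup => // _ [K _ <-].
- by apply: ub_le_sup; [exists ((seqs 0).2 + m_ 0) => _ [K _ <-]|exists N].
- by apply: ge_sup => // _ [K _ <-].
Qed.

(** On a small rectangle around the limit point the affine parts of [P] and [Q] contribute [- B m l]
    and [B l m], which cancel because the form is closed. The remainder is at most [2 e (l + m)^2];
    since [l] and [m] are of order [2^-N], this matches the lower bound [|J| / 4^N] with the factor
    [e] to spare. *)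
Lemma closed_form_rect :
  \int[mu]_(t in `[a, a + L]) (P t b - P t (b + M)) +
  \int[mu]_(t in `[b, b + M]) (Q (a + L) t - Q a t) = 0.
Proof.
rewrite -[LHS]/(J a L b M); apply/eqP; rewrite -normr_le0; apply/ler_addgt0Pr => k k0; rewrite add0r.
have [px [py plim]] := limit_point.
have hx : a <= px <= a + L by have [+ _] := plim 0; rewrite /l_ expr0 divr1.
have hy : b <= py <= b + M by have [_ +] := plim 0; rewrite /m_ expr0 divr1.
have [A [B [C H]]] := closedPQ hx hy.
have D0 : 0 < 2 * (L + M + 1) ^+ 2 by rewrite mulr_gt0// exprn_gt0//; lra.
(* Chosen so that [2 e (L + M)^2 <= k]; the [+ 1] keeps the divisor positive when the rectangle
   degenerates to a point. *)
pose e := k / (2 * (L + M + 1) ^+ 2).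
have e0 : 0 < e by rewrite divr_gt0.
have [d d0 {}H] := H _ e0.
have [N hN] : exists N, l_ N + m_ N <= d.
  exists (Num.truncn ((L + M) / d)).
  set N := Num.truncn _; have h : (L + M) / d < 2 ^+ N.
    apply: (lt_le_trans (truncnS_gt _)); rewrite -/N -natrX ler_nat.
    exact: ltn_expl.
  by rewrite /l_ /m_ -mulrDl ler_pdivrMr ?exprn_gt0// mulrC -ler_pdivrMr// ltW.
have [sr hJ] := seqsP N; have [hpx hpy] := plim N.
move: (seqs N) sr hJ hpx hpy => [x y] /= [l0 m0 ax xL [ay yM]] hJ hpx hpy.
have lN := l_ge0 N; have mN := m_ge0 N.
have key t s : x <= t <= x + l_ N -> y <= s <= y + m_ N ->
    `|P t s - (P px py + A * (t - px) + B * (s - py))| <= e * (l_ N + m_ N) /\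
    `|Q t s - (Q px py + B * (t - px) + C * (s - py))| <= e * (l_ N + m_ N).
  move=> ht hs.
  have ht' : `|t - px| <= l_ N by rewrite ler_norml; lra.
  have hs' : `|s - py| <= m_ N by rewrite ler_norml; lra.
  have htd : `|t - px| <= d by lra.
  have hsd : `|s - py| <= d by lra.
  have [h1 h2] := H _ _ htd hsd.
  rewrite ![_ + (_ - _)]addrC !subrK in h1 h2.
  by split; [apply: (le_trans h1)|apply: (le_trans h2)]; rewrite ler_pM2l// lerD.
have bP : `|\int[mu]_(t in `[x, x + l_ N]) (P t y - P t (y + m_ N)) - (- B * m_ N) * l_ N|
    <= (e * (l_ N + m_ N) * 2) * l_ N.
  apply: Rintegral_segment_bound => //; first exact: intPB.
  have y1 : y <= y <= y + m_ N by rewrite lexx lerDl.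
  have y2 : y <= y + m_ N <= y + m_ N by rewrite lexx lerDl andbT.
  move=> t ht; have [h1 _] := key t y ht y1; have [h2 _] := key t (y + m_ N) ht y2.
  rewrite (_ : P t y - P t (y + m_ N) - - B * m_ N =
    (P t y - (P px py + A * (t - px) + B * (y - py))) -
    (P t (y + m_ N) - (P px py + A * (t - px) + B * (y + m_ N - py)))); last by ring.
  by apply: (le_trans (ler_normB _ _)); lra.
have bQ : `|\int[mu]_(t in `[y, y + m_ N]) (Q (x + l_ N) t - Q x t) - (B * l_ N) * m_ N|
    <= (e * (l_ N + m_ N) * 2) * m_ N.
  apply: Rintegral_segment_bound => //; first exact: intQB.
  have x1 : x <= x <= x + l_ N by rewrite lexx lerDl.
  have x2 : x <= x + l_ N <= x + l_ N by rewrite lexx lerDl andbT.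
  move=> s hs; have [_ h1] := key x s x1 hs; have [_ h2] := key (x + l_ N) s x2 hs.
  rewrite (_ : Q (x + l_ N) s - Q x s - B * l_ N =
    (Q (x + l_ N) s - (Q px py + B * (x + l_ N - px) + C * (s - py))) -
    (Q x s - (Q px py + B * (x - px) + C * (s - py)))); last by ring.
  by apply: (le_trans (ler_normB _ _)); lra.
have bJ : `|J x (l_ N) y (m_ N)| <= 2 * e * (l_ N + m_ N) ^+ 2.
  rewrite /J -[X in `|X|](_ : (\int[mu]_(t in `[x, x + l_ N]) (P t y - P t (y + m_ N)) - (- B * m_ N) * l_ N) +
    (\int[mu]_(t in `[y, y + m_ N]) (Q (x + l_ N) t - Q x t) - (B * l_ N) * m_ N) = _); last by ring.
  apply: (le_trans (ler_normD _ _)); apply: (le_trans (lerD bP bQ)).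
  by rewrite le_eqVlt; apply/orP; left; apply/eqP; ring.
have q0 : 0 < 4 ^+ N :> R by rewrite exprn_gt0.
have := le_trans hJ bJ; rewrite ler_pdivrMr// => /le_trans; apply.
have -> : 2 * e * (l_ N + m_ N) ^+ 2 * 4 ^+ N = 2 * e * (L + M) ^+ 2.
  rewrite /l_ /m_ -mulrDl expr_div_n -exprM mulnC exprM (_ : 2 ^+ 2 = 4 :> R); last by ring.
  by rewrite -mulrA divfK// gt_eqF.
have eK : e * (2 * (L + M + 1) ^+ 2) = k by rewrite /e divfK// gt_eqF.
rewrite -eK (_ : 2 * e * _ = e * (2 * (L + M) ^+ 2)); last by ring.
by rewrite ler_pM2l// ler_pM2l// ler_sqr ?nnegrE; lra.
Qed.

End rectangle.
End closed_forms.

(** * Fourier coefficients on the circle *)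

Section circle.
Context {R : realType}.
Local Notation mu := (@lebesgue_measure R).
Implicit Types (t a : R) (q : int).

Definition ce t : R[i] := Complex (cos t) (sin t).

Lemma ceD a t : ce (a + t) = ce a * ce t.
Proof. by apply: complexP; rewrite ?cReM ?cImM /= ?cosD ?sinD// addrC. Qed.

Lemma ce0 : ce 0 = 1. Proof. by rewrite /ce cos0 sin0. Qed.

Lemma normc_ce t : normc (ce t) = 1.
Proof. by rewrite /= cos2Dsin2 sqrtr1. Qed.

Lemma conjc_ce t : conjc (ce t) = ce (- t).
Proof. by rewrite /ce cosN sinN. Qed.

Lemma ceX t n : ce t ^+ n = ce (n%:R * t).
Proof.
elim: n => [|n IH]; first by rewrite mul0r ce0.
by rewrite exprSr IH -ceD -natr1 mulrDl mul1r.
Qed.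

Lemma ce_2pi : ce (pi *+ 2) = 1.
Proof. by rewrite mulr2n ceD /ce cospi sinpi; apply: complexP => /=; ring. Qed.

Lemma ce_pi : ce pi = - 1.
Proof. by rewrite /ce cospi sinpi; apply: complexP => /=; ring. Qed.

Lemma measurable_ce : measurable_fun setT ce.
Proof.
by apply: measurable_complexP; apply: continuous_measurable_fun;
  [exact: continuous_cos|exact: continuous_sin].
Qed.

Lemma polar (w : R[i]) : normc w = 1 -> exists2 t, 0 <= t <= pi *+ 2 & w = ce t.
Proof.
case: w => x y /= h; have {}h : x ^+ 2 + y ^+ 2 = 1.
  by rewrite -[LHS]sqr_sqrtr ?addr_ge0 ?sqr_ge0// h expr1n.
have x1 : -1 <= x <= 1 by apply/andP; split; nra.
have cx := acosK x1; have sx := sin_acos x1.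
have p0 := pi_gt0 R; have a0 := acos_ge0 x1; have api := acos_lepi x1.
have yE : Num.sqrt (1 - x ^+ 2) = `|y| by rewrite -h [x ^+ 2 + _]addrC addrK sqrtr_sqr.
have [y0|y0] := leP 0 y.
  exists (acos x); first by rewrite mulr2n; lra.
  by rewrite /ce cx sx yE ger0_norm.
exists (pi *+ 2 - acos x); first by rewrite mulr2n; lra.
rewrite ceD ce_2pi mul1r /ce cosN sinN cx sx yE ltr0_norm// opprK //.
Qed.

Definition arc : set R := `[- pi, pi[%classic.

Lemma measurable_arc : measurable (arc : set (measurableTypeR R)). Proof. exact: measurable_itv. Qed.

Let ind_arc_m : measurable_fun setT (\1_arc : R -> R).
Proof. by apply: measurable_indic; exact: measurable_arc. Qed.

Let ind_arc_ge0 t : 0 <= \1_arc t :> R. Proof. by []. Qed.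

(** Lebesgue measure of one period, of total mass [2 pi], as a measure on the whole line, so that
    functions of the angle carry no domain. *)
Definition circ := dens mu ind_arc_m ind_arc_ge0.

HB.instance Definition _ := Measure.on circ.

Lemma circE A : measurable A -> circ A = mu (A `&` arc).
Proof.
move=> mA; rewrite setIC.
exact: (@integral_indic _ (measurableTypeR R) R mu A mA arc measurable_arc).
Qed.

Lemma lebesgue_arc : mu arc = (pi *+ 2)%:E.
Proof.
rewrite /arc lebesgue_measure_itv/= lte_fin gtrN ?pi_gt0// -EFinB opprK mulr2n//.
Qed.

Let circ_finite : fin_num_fun circ.
Proof.
move=> A mA; rewrite ge0_fin_numE; last exact: measure_ge0.
rewrite circE//; apply: (@le_lt_trans _ _ (mu arc)); last by rewrite lebesgue_arc ltry.
have mAa : measurable (A `&` arc) by apply: measurableI => //; exact: measurable_arc.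
by apply: le_measure; rewrite ?inE//; exact: measurable_arc.
Qed.

HB.instance Definition _ := Measure_isFinite.Build _ _ _ circ circ_finite.

Lemma cintegrable_circ (f : R -> R[i]) K : measurable_fun setT f ->
  (forall t, normc (f t) <= K) -> cintegrable circ f.
Proof. exact: (@cintegrable_bounded R _ (measurableTypeR R) circ f K). Qed.

Lemma circT : circ setT = (pi *+ 2)%:E.
Proof. by rewrite circE// setTI lebesgue_arc. Qed.

Lemma integral_circ_cst (c : R) : (\int[circ]_t c%:E = (c * (pi *+ 2))%:E)%E.
Proof.
rewrite EFinM; apply: (etrans (integral_cst circ measurableT c%:E)).
by congr (_ * _)%E; exact: circT.
Qed.

Lemma integral_circ (f : R -> \bar R) : measurable_fun setT f ->
  (\int[circ]_t f t = \int[mu]_(t in arc) f t)%E.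
Proof.
move=> mf; rewrite /circ integral_dens// [RHS]integral_mkcond.
apply: eq_integral => t _; rewrite patchE indicE.
by case: ifP => _; rewrite ?mule1 ?mule0.
Qed.

(** [T] is the rotation by [a] read inside [[-pi, pi[]. It translates two subintervals and exchanges
    them, hence preserves the measure, and [f (T t) = f (t + a)] by periodicity. *)
Lemma Cint_circ_shift (f : R -> R[i]) a : 0 <= a <= pi *+ 2 -> measurable_fun setT f ->
  (forall t, f (t + pi *+ 2) = f t) ->
  Cint circ (fun t => f (t + a)) = Cint circ f.
Proof.
move=> /andP[a0 a2] mf per.
pose T t := if t + a < pi then t + a else t + (a - pi *+ 2).
have mT : measurable_fun setT T.
  apply: (@measurable_fun_ifT _ _ _ _ (fun t => t + a) (fun t => t + (a - pi *+ 2)) (fun t => t + a < pi)).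
  - by apply: measurable_fun_ltr => //; exact: measurable_funD.
  - exact: measurable_funD.
  - exact: measurable_funD.
transitivity (Cint circ (fun t => f (T t))).
  apply: eq_Cint => t; rewrite /T; case: ifP => // _.
  by rewrite -[RHS]per; congr f; ring.
apply: Cint_invariant => // A mA.
have mTA : measurable (T @^-1` A) by rewrite -[_ @^-1` _]setTI; exact: mT.
suff : mu (T @^-1` A `&` arc) = mu (A `&` arc).
  by move=> h; exact: (etrans (circE mTA) (etrans h (esym (circE mA)))).
pose A1 := A `&` `[- pi + a, pi[%classic; pose A2 := A `&` `[- pi, - pi + a[%classic.
have mA1 : measurable A1 by apply: measurableI => //; exact: measurable_itv.
have mA2 : measurable A2 by apply: measurableI => //; exact: measurable_itv.
have -> : A `&` arc = A1 `|` A2.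
  apply/seteqP; split => t /=; rewrite /arc /A1 /A2 /= !in_itv/=.
    by move=> [At ht]; have [h|h] := leP (- pi + a) t; [left|right]; split => //; move: ht; rewrite mulr2n in a2; lra.
  rewrite mulr2n in a2.
  by move=> [[At ht]|[At ht]]; split => //; lra.
have -> : T @^-1` A `&` arc = ((fun t => t + a) @^-1` A1) `|` ((fun t => t + (a - pi *+ 2)) @^-1` A2).
  rewrite mulr2n in a2 *.
  apply/seteqP; split => t /=; rewrite /arc /A1 /A2 /T /= !in_itv/= mulr2n.
    by case: ifPn => [h [At ht]|]; [left; split => //; lra|rewrite -leNgt => h [At ht]; right; split => //; lra].
  move=> [[At ht]|[At ht]].
    by rewrite ifT; [split => //; lra|lra].
  by rewrite ifF; [split => //; lra|apply/negbTE; rewrite -leNgt; lra].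
have mP (c : R) E : measurable E -> measurable ((fun t => t + c) @^-1` E).
  by move=> mE; rewrite -[_ @^-1` _]setTI; apply: measurable_funD.
rewrite !measureU//.
- by congr (_ + _)%E; exact: lebesgue_measure_translation.
- rewrite -subset0 => t [] [_ +] [_]; rewrite /= !in_itv/=; lra.
- exact: mP.
- exact: mP.
- rewrite -subset0 => t [] [_ +] [_]; rewrite /= !in_itv/= mulr2n; lra.
Qed.

Definition kern q t : R[i] := ce (- q%:~R * t).

Lemma normc_kern q t : normc (kern q t) = 1. Proof. exact: normc_ce. Qed.

Lemma measurable_kern q : measurable_fun setT (kern q).
Proof. by apply: (measurableT_comp measurable_ce); exact: measurable_funM. Qed.

Lemma kernDl p q t : kern (p + q) t = kern p t * kern q t.
Proof. by rewrite /kern -ceD -mulrDl intrD opprD. Qed.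

Lemma kern_shift q t a : kern q (t + a) = kern q t * kern q a.
Proof. by rewrite /kern mulrDr ceD. Qed.

Lemma kern_2pi q : kern q (pi *+ 2) = 1.
Proof.
rewrite /kern; case: q => n.
  by rewrite mulNr -conjc_ce -ceX ce_2pi expr1n /conjc; apply: complexP => /=; rewrite ?oppr0.
by rewrite NegzE mulrNz opprK -ceX ce_2pi expr1n.
Qed.

Lemma kern_opp q t : kern q (- t) * kern q t = 1.
Proof. by rewrite -kern_shift addNr /kern mulr0 ce0. Qed.

Lemma kern_periodic q t : kern q (t + pi *+ 2) = kern q t.
Proof. by rewrite kern_shift kern_2pi mulr1. Qed.

Lemma cos_lt_half (d : R) : 0 < d -> d <= pi -> cos d < cos (d / 2).
Proof.
by move=> d0 dpi; rewrite ltr_cos ?in_itv/=; lra.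
Qed.

Lemma cos_le_outside (d t : R) : 0 <= d -> d <= `|t| -> `|t| <= pi -> cos t <= cos d.
Proof.
move=> d0 dt tpi; rewrite -(cos_norm t).
have : d \in `[0, pi] by rewrite in_itv/=; lra.
have : `|t| \in `[0, pi] by rewrite in_itv/= normr_ge0.
by move=> h1 h2; rewrite leNgt ltr_cos// -leNgt.
Qed.

(* Integrate against [(1 + cos t) ^ N], a combination of the [kern q] whose mass
   concentrates at [0]. *)
Lemma fourier_unique (f : R -> R[i]) (K : R) : measurable_fun setT f ->
  (forall t, normc (f t) <= K) ->
  (forall e, 0 < e -> exists2 d : R, 0 < d & forall t, `|t| <= d -> normc (f 0 - f t) <= e) ->
  (forall q, Cint circ (fun t => f t * kern q t) = 0) -> f 0 = 0.
Proof.
move=> mf fK cf fq; pose k N t : R := (1 + cos t) ^+ N.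
have mk N : measurable_fun setT (k N).
  apply: measurable_funX; apply: measurable_funD => //.
  by apply: continuous_measurable_fun; exact: continuous_cos.
have c0 t : 0 <= 1 + cos t by have := cos_geN1 t; lra.
have k0 N t : 0 <= k N t by rewrite exprn_ge0.
have k2 N t : k N t <= 2 ^+ N.
  by rewrite lerXn2r ?nnegrE//; have := cos_le1 t; lra.
have mkC N : measurable_fun setT (fun t => (k N t)%:C%C : R[i]).
  by apply: measurable_complexP => //=; exact: mk.
have bk N t : normc (k N t)%:C%C <= 2 ^+ N by rewrite normc_real ger0_norm.
have ck N : cintegrable circ (fun t => (k N t)%:C%C) by exact: cintegrable_circ (mkC N) (bk N).
have cik N q : cintegrable circ (fun t => f t * (k N t)%:C%C * kern q t).
  apply: (@cintegrable_circ _ (K * 2 ^+ N)).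
    by apply: measurable_cM; [exact: measurable_cM|exact: measurable_kern].
  by move=> t; rewrite !normcM normc_kern mulr1 ler_pM ?normc_ge0.
(* [cos] is the half sum of [kern 1] and [kern (-1)], so one more factor [1 + cos t] only shifts
   [q]; the induction leaves [q] free. *)
have zero N q : Cint circ (fun t => f t * (k N t)%:C%C * kern q t) = 0.
  elim: N q => [|N IH] q; first by under eq_Cint do rewrite /k expr0 mulr1; exact: fq.
  transitivity (Cint circ (fun t => (f t * (k N t)%:C%C * kern q t +
     (2^-1)%:C%C * (f t * (k N t)%:C%C * kern (q + 1) t)) +
     (2^-1)%:C%C * (f t * (k N t)%:C%C * kern (q - 1) t))).
    apply: eq_Cint => t; rewrite !kernDl /k exprSr rmorphM rmorphD/=.
    have -> : (cos t)%:C%C = (2^-1)%:C%C * kern 1 t + (2^-1)%:C%C * kern (-1) t :> R[i].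
      rewrite /kern mulN1r mulrN1z opprK mul1r /ce cosN sinN.
      by apply: complexP => /=; rewrite ?mul0r ?subr0 ?addr0; lra.
    rewrite -[1%:C%C]/(1 : R[i]); ring.
  rewrite !CintD ?CintZ ?IH ?mulr0 ?addr0//; try exact: cintegrableZ.
  by apply: cintegrableD => //; exact: cintegrableZ.
have f0z N : Cint circ (fun t => f t * (k N t)%:C%C) = 0.
  rewrite -(zero N 0); apply: eq_Cint => t.
  by rewrite /kern mulr0z oppr0 mul0r ce0 mulr1.
apply: eq0_normc; apply/le_anti; rewrite normc_ge0 andbT.
apply/ler_addgt0Pr => e e0; rewrite add0r.
(* Two error terms, each at most [e/4] times the mass [I N], are doubled by [normc_Cint_le] and add
   up to [e]. *)
have e4 : 0 < e / 4 by rewrite divr_gt0.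
have [d' d'0 hd'] := cf _ e4; pose d := Num.min d' 1.
have d0 : 0 < d by rewrite lt_min d'0 ltr01.
have p2 := pi_ge2 R.
have dpi : d <= pi by apply: (@le_trans _ _ 1); [rewrite ge_min lexx orbT|lra].
have hd t : `|t| <= d -> normc (f 0 - f t) <= e / 4.
  by move=> h; apply: hd'; apply: (le_trans h); rewrite ge_min lexx.
(* The kernel is at most [c1^N] for [|t| > d] and at least [c2^N] for [|t| <= d/2]. As [c1 < c2],
   the contribution from outside [[-d, d]] is negligible against the mass, which is at least
   [d c2^N]. *)
pose c1 := 1 + cos d; pose c2 := 1 + cos (d / 2).
have c12 : c1 < c2 by rewrite ltrD2l cos_lt_half.
have c1_ge0 : 0 <= c1 by exact: c0.
have c2_gt0 : 0 < c2 by exact: le_lt_trans c12.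
have K0 : 0 <= K by apply: le_trans (fK 0); exact: normc_ge0.
have bnd N t : arc t -> normc ((f 0 - f t) * (k N t)%:C%C) <= e / 4 * k N t + (2 * K) * c1 ^+ N.
  rewrite /arc/= in_itv/= => /andP[t1 t2]; rewrite normcM normc_real ger0_norm//.
  have tpi : `|t| <= pi by rewrite ler_norml; lra.
  have [h|h] := leP `|t| d.
    rewrite -[leLHS]addr0 lerD ?mulr_ge0 ?exprn_ge0//.
    by rewrite ler_wpM2r// hd.
  rewrite -[leLHS]add0r; apply: lerD; first by apply: mulr_ge0 => //; exact: ltW.
  apply: ler_pM; rewrite ?normc_ge0//.
    by apply: (le_trans (le_normcD _ _)); rewrite normcN mulr_natl mulr2n lerD.
  by rewrite lerXn2r ?nnegrE// lerD2l cos_le_outside// ltW.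
have ikN N : circ.-integrable setT (fun t => (k N t)%:E).
  by have := integrable_cRe (ck N).
pose I N := \int[circ]_t k N t.
have I_lb N : d * c2 ^+ N <= I N.
  have mS : measurable (`[- (d / 2), d / 2]%classic : set R) by exact: measurable_itv.
  have hI : (\int[circ]_t (\1_(`[(- (d / 2))%R, (d / 2)%R]%classic) t)%:E = d%:E)%E.
    rewrite integral_circ; last exact/measurable_EFinP/measurable_indic.
    apply: (etrans (@integral_indic _ (measurableTypeR R) R mu _ measurable_arc _ mS)).
    rewrite setIidl; last by move=> t; rewrite /arc/= !in_itv/=; lra.
    apply: (etrans (lebesgue_measure_itv `[(- (d / 2))%R, (d / 2)%R])).
    rewrite /= lte_fin gtrN ?divr_gt0// -EFinB opprK.
    by congr EFin; lra.
  have -> : d * c2 ^+ N = fine (\int[circ]_t (c2 ^+ N * \1_(`[- (d / 2), d / 2]%classic) t)%:E)%E.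
    under eq_integral do rewrite EFinM.
    rewrite ge0_integralZl//; last 2 first.
      - exact/measurable_EFinP/measurable_indic.
      - by rewrite lee_fin exprn_ge0// ltW.
    by rewrite [X in (_ * X)%E]hI -EFinM/= mulrC.
  rewrite /I /Rintegral fine_le//.
  - rewrite ge0_fin_numE; last by apply: integral_ge0 => t _; rewrite lee_fin mulr_ge0 ?exprn_ge0// ltW.
    apply: (@le_lt_trans _ _ (\int[circ]_t (c2 ^+ N)%:E)%E).
      apply: ge0_le_integral => //.
      + by move=> t _; rewrite lee_fin mulr_ge0 ?exprn_ge0// ltW.
      + by apply/measurable_EFinP; apply: measurable_funM => //; exact: measurable_indic.
      + by move=> t _; rewrite lee_fin ler_piMr ?exprn_ge0 ?(ltW c2_gt0)// indicE; case: (_ \in _).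
    by rewrite integral_circ_cst ltry.
  - exact: (integrable_fin_num measurableT (ikN N)).
  apply: ge0_le_integral => //.
  - by move=> t _; rewrite lee_fin mulr_ge0 ?exprn_ge0// ltW.
  - by apply/measurable_EFinP; apply: measurable_funM => //; exact: measurable_indic.
  - by apply/measurable_EFinP; exact: mk.
  move=> t _; rewrite lee_fin indicE; have [|_] := boolP (_ \in _); last by rewrite mulr0.
  rewrite inE/= in_itv/= mulr1 => /andP[t1 t2]; rewrite lerXn2r ?nnegrE ?(ltW c2_gt0)//.
  rewrite lerD2l; have t3 : `|t| <= d / 2 by rewrite ler_norml; lra.
  have d2 : `|d / 2| = d / 2 by apply: ger0_norm; lra.
  by rewrite -(cos_norm t); apply: cos_le_outside; rewrite ?d2 ?normr_ge0//; lra.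
have main N : normc (f 0) * I N <= (e / 4 * I N + 2 * K * c1 ^+ N * (pi *+ 2)) *+ 2.
  have -> : normc (f 0) * I N = normc (Cint circ (fun t => (f 0 - f t) * (k N t)%:C%C)).
    transitivity (normc (Cint circ (fun t => f 0 * (k N t)%:C%C))).
      rewrite CintZ// normcM; congr (_ * _).
      have -> : Cint circ (fun t => (k N t)%:C%C) = (I N)%:C%C.
        by apply: complexP => //=; rewrite /Rintegral integral0.
      by rewrite normc_real ger0_norm//; apply: Rintegral_ge0.
    under [in RHS]eq_Cint do rewrite mulrBl.
    rewrite CintB ?f0z ?subr0//; first exact: cintegrableZ.
    by apply: (@cintegrable_circ _ (K * 2 ^+ N));
      [exact: measurable_cM|move=> t; rewrite normcM ler_pM ?normc_ge0].
  have mB : measurable_fun setT (fun t => (f 0 - f t) * (k N t)%:C%C).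
    by apply: measurable_cM => //; apply: measurable_cD => //; exact: measurable_cN.
  have cB : cintegrable circ (fun t => (f 0 - f t) * (k N t)%:C%C).
    apply: (@cintegrable_circ _ ((K + K) * 2 ^+ N)) => // t.
    rewrite normcM ler_pM ?normc_ge0// (le_trans (le_normcD _ _))// normcN lerD//.
  apply: (le_trans (normc_Cint_le cB)); rewrite lerMn2r/=.
  have ic : circ.-integrable setT (fun=> (2 * K * c1 ^+ N)%:E).
    exact: (@finite_measure_integrable_cst _ (measurableTypeR R) R circ).
  have iZ : circ.-integrable setT (fun t => (e / 4 * k N t)%:E).
    exact: (@integrableZl _ (measurableTypeR R) R circ _ measurableT (e / 4) _ (ikN N)).
  have iR : circ.-integrable setT (fun t => (e / 4 * k N t + 2 * K * c1 ^+ N)%:E).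
    exact: (@integrableD _ (measurableTypeR R) R circ _ measurableT _ _ iZ ic).
  have -> : e / 4 * I N + 2 * K * c1 ^+ N * (pi *+ 2) =
      fine (\int[circ]_t (e / 4 * k N t + 2 * K * c1 ^+ N)%:E).
    under eq_integral do rewrite EFinD.
    rewrite integralD//= integral_circ_cst fineD//; last exact: (integrable_fin_num measurableT iZ).
    congr (_ + _).
    exact: esym (@RintegralZl _ (measurableTypeR R) R circ setT (k N) (e / 4) measurableT (ikN N)).
  apply: fine_le.
  - by rewrite ge0_fin_numE ?cB.2//; apply: integral_ge0 => t _; rewrite lee_fin normc_ge0.
  - exact: (integrable_fin_num measurableT iR).
  have mnB : measurable_fun setT (fun t => (normc ((f 0 - f t) * (k N t)%:C%C))%:E).
    exact/measurable_EFinP/measurable_normc.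
  have mR : measurable_fun setT (fun t => (e / 4 * k N t + 2 * K * c1 ^+ N)%:E).
    apply/measurable_EFinP; apply: measurable_funD => //.
    by apply: measurable_funM => //; exact: mk.
  rewrite !integral_circ//.
  apply: (@ge0_le_integral _ (measurableTypeR R) R mu _ measurable_arc).
  - by move=> t _; rewrite lee_fin normc_ge0.
  - exact: measurable_funTS.
  - exact: measurable_funTS.
  - by move=> t /bnd; rewrite lee_fin; apply.
have r1 : `|c1 / c2| < 1 by rewrite ger0_norm ?divr_ge0 ?(ltW c2_gt0)// ltr_pdivrMr// mul1r.
pose C := (2 * K * (pi *+ 2)) / d.
have C0 : 0 <= C.
  apply: divr_ge0; last exact: ltW.
  by apply: mulr_ge0; [exact: mulr_ge0|rewrite mulrn_wge0 ?pi_ge0].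
have [N hN] : exists N, C * (c1 / c2) ^+ N <= e / 4.
  have : C * (c1 / c2) ^+ N @[N --> \oo] --> C * 0 by apply: cvgM; [exact: cvg_cst|exact: cvg_expr].
  rewrite mulr0 => /cvgrPdist_le /(_ _ e4) [N _ /(_ N (leqnn N))] /=.
  rewrite sub0r normrN ger0_norm; last by rewrite mulr_ge0// exprn_ge0// divr_ge0// ltW.
  by exists N.
have IN0 : 0 < I N by apply: lt_le_trans (I_lb N); rewrite mulr_gt0// exprn_gt0.
rewrite -(ler_pM2r IN0); apply: (le_trans (main N)).
have h : 2 * K * c1 ^+ N * (pi *+ 2) <= e / 4 * I N.
  apply: (@le_trans _ _ (e / 4 * (d * c2 ^+ N))); last by rewrite ler_pM2l.
  have -> : 2 * K * c1 ^+ N * (pi *+ 2) = C * (c1 / c2) ^+ N * (d * c2 ^+ N).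
    by rewrite /C expr_div_n; field; rewrite expf_neq0 ?gt_eqF.
  by rewrite ler_wpM2r// mulr_ge0 ?exprn_ge0// ltW.
by rewrite mulr2n; lra.
Qed.

End circle.

(** * Rotations of a coordinate *)

Section coordinate_rotations.
Context {R : realType} (n : nat).
Local Notation V := 'cV[R[i]]_n.
Local Notation B := (Bn R n).
Implicit Types (i j : 'I_n) (z : V) (w : R[i]) (q : int).

Definition scal i w z : V := \col_j (if j == i then w * z j 0 else z j 0).

Lemma scalM i w w' z : scal i w (scal i w' z) = scal i (w * w') z.
Proof. by apply/colP => j; rewrite !mxE; case: eqP => // _; rewrite mulrA. Qed.

Lemma scalC i j w w' z : scal i w (scal j w' z) = scal j w' (scal i w z).
Proof.
by apply/colP => k; rewrite !mxE; case: (k == i); case: (k == j) => //; ring.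
Qed.

Lemma scal1 i z : scal i 1 z = z.
Proof. by apply/colP => j; rewrite !mxE mul1r; case: eqP. Qed.

(** Stable under rotations and contractions of each coordinate, so a bound on it passes to the
    Fourier coefficients along rotations. *)
Definition polydisc z : set V := [set z' | forall j, normc (z' j 0) <= normc (z j 0)].

Lemma polydisc_refl z : polydisc z z. Proof. by move=> j. Qed.

Lemma polydisc_scal i w z z' : normc w <= 1 -> polydisc z z' -> polydisc z (scal i w z').
Proof.
move=> w1 h j; rewrite mxE; case: ifP => // _; rewrite normcM.
by apply: le_trans (h j); rewrite ler_piMl ?normc_ge0.
Qed.

Lemma polydisc_ball z z' : B z -> polydisc z z' -> B z'.
Proof.
rewrite /Bn/= => Bz h; apply: le_lt_trans Bz; apply: ler_sum => j _.
by rewrite ler_sqr ?nnegrE ?normc_ge0.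
Qed.

Lemma ball_scal i w z : normc w <= 1 -> B z -> B (scal i w z).
Proof.
by move=> w1 Bz; apply: (polydisc_ball Bz); apply: polydisc_scal => //; exact: polydisc_refl.
Qed.

Lemma ball_rot i w z : normc w = 1 -> B (scal i w z) <-> B z.
Proof.
move=> w1; split; last by apply: ball_scal; rewrite w1.
have w0 : w != 0 by rewrite -normc_eq0 w1 oner_neq0.
by move/(@ball_scal i w^-1); rewrite scalM mulVf// scal1; apply; rewrite normcV w1 invr1.
Qed.

Lemma scal_unitary i w : normc w = 1 -> exists2 U : 'M[R[i]]_n,
  U \is unitarymx & forall z, scal i w z = U *m z.
Proof.
move=> w1; pose d : 'rV[R[i]]_n := \row_j (if j == i then w else 1).
exists (diag_mx d); last first.
  move=> z; apply/colP => j; rewrite mxE mul_diag_mx !mxE.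
  by case: ifP => // _; rewrite mul1r.
apply/unitarymxP; apply/matrixP => a b; rewrite mul_diag_mx !mxE.
have [->|ab] := eqVneq a b; last by case: (b =P a) => [e|_]; [rewrite e eqxx in ab|rewrite mulr0n rmorph0 mulr0].
rewrite !mulr1n; case: (b == i); last by rewrite rmorph1 mul1r.
by rewrite [Num.conj w]/(conjc w) mulcJ w1 expr1n.
Qed.

Lemma measurable_scal d (T : measurableType d) i (f : T -> R[i]) (g : T -> V) :
  measurable_fun setT f -> measurable_fun setT g ->
  measurable_fun setT (fun x => scal i (f x) (g x)).
Proof.
move=> mf mg; apply: measurable_matrixP => j k.
under eq_fun do rewrite mxE.
case: (j == i); last exact: measurable_coord.
by apply: measurable_cM => //; exact: measurable_coord.
Qed.

Lemma measurable_rot2 i (G : V -> R[i]) : measurable_fun setT G ->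
  measurable_fun setT (fun p : V * R => G (scal i (ce p.2) p.1)).
Proof.
move=> mG; apply: (measurableT_comp mG); apply: measurable_scal => //.
by apply: (measurableT_comp measurable_ce).
Qed.

Lemma measurable_rot i a (G : V -> R[i]) : measurable_fun setT G ->
  measurable_fun setT (fun z => G (scal i (ce a) z)).
Proof. by move=> mG; apply: (measurableT_comp mG); exact: measurable_scal. Qed.

Lemma measurable_orbit i z (G : V -> R[i]) : measurable_fun setT G ->
  measurable_fun setT (fun t : R => G (scal i (ce t) z)).
Proof.
move=> mG; apply: (measurableT_comp mG); apply: measurable_scal => //.
exact: measurable_ce.
Qed.

(** A class preserved by [fcoef]. For the Fourier coefficients, holomorphy is replaced by this
    condition together with [radial_holomorphic]. *)
Definition locally_tame (G : V -> R[i]) := [/\ measurable_fun setT G,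
  forall z, ~ B z -> G z = 0 &
  forall z, B z -> exists M, forall z', polydisc z z' -> normc (G z') <= M].

(** The [q]-th Fourier coefficient of [G] along the rotations of coordinate [i], without the factor
    [1/(2 pi)]. *)
Definition fcoef i q (G : V -> R[i]) z : R[i] :=
  Cint circ (fun t => G (scal i (ce t) z) * kern q t).

Lemma tame_orbit G i q z : locally_tame G ->
  exists M, forall t, normc (G (scal i (ce t) z) * kern q t) <= M.
Proof.
move=> [mG G0 Gb]; have [Bz|nBz] := pselect (B z).
  have [M hM] := Gb _ Bz; exists M => t; rewrite normcM normc_kern mulr1; apply: hM.
  by apply: polydisc_scal; [rewrite normc_ce|exact: polydisc_refl].
exists 0 => t; rewrite G0 ?mul0r ?normc0//.
by move/(ball_rot _ _ (normc_ce t)).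
Qed.

Lemma measurable_fcoef_integrand (G : V -> R[i]) i q z : measurable_fun setT G ->
  measurable_fun setT (fun t => G (scal i (ce t) z) * kern q t).
Proof.
by move=> mG; apply: measurable_cM; [exact: measurable_orbit|exact: measurable_kern].
Qed.

Lemma cintegrable_orbit G i q z : locally_tame G ->
  cintegrable circ (fun t => G (scal i (ce t) z) * kern q t).
Proof.
move=> tG; have [M hM] := tame_orbit i q z tG.
by apply: cintegrable_circ hM; apply: measurable_fcoef_integrand; case: tG.
Qed.

Lemma normc_Cint_leE d (T : measurableType d) (mu : {measure set T -> \bar R})
    (f : T -> R[i]) : cintegrable mu f ->
  ((normc (Cint mu f))%:E <= 2%:E * \int[mu]_x (normc (f x))%:E)%E.
Proof.
move=> cf; have I0 : (0 <= \int[mu]_x (normc (f x))%:E)%E.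
  by apply: integral_ge0 => x _; rewrite lee_fin normc_ge0.
have If : (\int[mu]_x (normc (f x))%:E)%E \is a fin_num by rewrite ge0_fin_numE// cf.2.
rewrite -(fineK If) -EFinM lee_fin mulr_natl; exact: normc_Cint_le.
Qed.

Lemma fcoef_tame G i q : locally_tame G -> locally_tame (fcoef i q G).
Proof.
move=> tG; have [mG G0 Gb] := tG; split.
- apply: (@measurable_Cint R _ _ V (measurableTypeR R) circ (fun z t => G (scal i (ce t) z) * kern q t)).
  apply: measurable_cM; first exact: measurable_rot2.
  by apply: (measurableT_comp (measurable_kern q)).
- move=> z nBz; rewrite /fcoef; under eq_Cint => t.
    rewrite G0; last by move/(ball_rot _ _ (normc_ce t)).
    rewrite mul0r; over.
  exact: Cint0.
- move=> z Bz; have [M hM] := Gb _ Bz; exists (2 * (M * (pi *+ 2))) => z' zz'.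
  rewrite -lee_fin; apply: (le_trans (normc_Cint_leE (cintegrable_orbit i q z' tG))).
  rewrite EFinM; apply: lee_wpmul2l => //; rewrite -integral_circ_cst.
  apply: (@ge0_le_integral _ (measurableTypeR R) R circ _ measurableT).
  + by move=> t _; rewrite lee_fin normc_ge0.
  + by apply/measurable_EFinP; apply: measurable_normc; exact: measurable_fcoef_integrand.
  + by [].
  + move=> t _; rewrite lee_fin normcM normc_kern mulr1; apply: hM.
    by apply: polydisc_scal => //; rewrite normc_ce.
Qed.

(** Rotations of coordinates commute; the rest is Fubini's theorem on the torus, where the integrand
    is bounded because the orbit stays in the polydisc of [z]. *)
Lemma fcoefC G i j q p z : locally_tame G ->
  fcoef i q (fcoef j p G) z = fcoef j p (fcoef i q G) z.
Proof.
move=> tG; have [mG G0 Gb] := tG.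
pose f (t s : R) := G (scal i (ce t) (scal j (ce s) z)) * kern p s * kern q t.
have mf : measurable_fun setT (fun x : R * R => f x.1 x.2).
  apply: measurable_cM; last by apply: (measurableT_comp (measurable_kern q)).
  apply: measurable_cM; last by apply: (measurableT_comp (measurable_kern p)).
  apply: (measurableT_comp mG); apply: measurable_scal.
    by apply: (measurableT_comp measurable_ce).
  apply: measurable_scal => //.
  by apply: (measurableT_comp measurable_ce).
have [M hM] : exists M, forall t s, normc (f t s) <= M.
  have [Bz|nBz] := pselect (B z).
    have [M hM] := Gb _ Bz; exists M => t s; rewrite !normcM !normc_kern !mulr1; apply: hM.
    by do 2 (apply: polydisc_scal; first by rewrite normc_ce); exact: polydisc_refl.
  exists 0 => t s; rewrite /f G0 ?mul0r ?normc0//.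
  by move/(ball_rot _ _ (normc_ce t))/(ball_rot _ _ (normc_ce s)).
have m1 t : measurable_fun setT (f t) by exact: (measurableT_comp mf (pair1_measurable t)).
have m2 s : measurable_fun setT (f^~ s) by exact: (measurableT_comp mf (pair2_measurable s)).
have c1 t : cintegrable circ (f t) by exact: cintegrable_circ (m1 t) (hM t).
have c2 s : cintegrable circ (f^~ s) by exact: cintegrable_circ (m2 s) (fun t => hM t s).
have fin : (\int[circ]_t \int[circ]_s (normc (f t s))%:E < +oo)%E.
  apply: (@le_lt_trans _ _ (\int[circ]_t (M * (pi *+ 2))%:E)%E).
    apply: (@ge0_le_integral _ (measurableTypeR R) R circ _ measurableT).
    - by move=> t _; apply: integral_ge0 => s _; rewrite lee_fin normc_ge0.
    - apply: (measurable_fun_fubini_tonelli_F (m2 := circ) (fun x : R * R => (normc (f x.1 x.2))%:E)).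
        exact/measurable_EFinP/measurable_normc.
      by move=> x; rewrite lee_fin normc_ge0.
    - by [].
    move=> t _; rewrite -integral_circ_cst.
    apply: (@ge0_le_integral _ (measurableTypeR R) R circ _ measurableT).
    - by move=> s _; rewrite lee_fin normc_ge0.
    - by apply/measurable_EFinP; apply: measurable_normc; exact: m1.
    - by [].
    - by move=> s _; rewrite lee_fin.
  by rewrite integral_circ_cst ltry.
have := Cint_fubini (m1 := circ) (m2 := circ) mf c1 c2 fin.
have -> : fcoef i q (fcoef j p G) z = Cint circ (fun t => Cint circ (f t)).
  apply: eq_Cint => t; rewrite /fcoef mulrC -CintZ.
    by apply: eq_Cint => s; rewrite /f mulrC (scalC j i).
  exact: cintegrable_orbit.
move=> ->; apply: eq_Cint => s; rewrite /fcoef mulrC -CintZ.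
  by apply: eq_Cint => t; rewrite /f mulrCA -mulrA [kern p s * _]mulrC.
exact: cintegrable_orbit.
Qed.

Lemma fcoef_rot G i q a z : 0 <= a <= pi *+ 2 -> locally_tame G ->
  fcoef i q G (scal i (ce a) z) = kern q (- a) * fcoef i q G z.
Proof.
move=> ha tG; have [mG _ _] := tG.
rewrite /fcoef -CintZ; last exact: cintegrable_orbit.
rewrite -(@Cint_circ_shift _ (fun t => kern q (- a) * (G (scal i (ce t) z) * kern q t)) a)//.
- apply: eq_Cint => t; rewrite scalM -ceD kern_shift.
  by rewrite -{1}[kern q t]mulr1 -(kern_opp q a); ring.
- by apply: measurable_cM => //; exact: measurable_fcoef_integrand.
- by move=> t; rewrite kern_periodic ceD ce_2pi mulr1.
Qed.

(** What holomorphy in coordinate [i] becomes on the Fourier side: coefficients of index [p >= 0]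
    are homogeneous of degree [p] under dilations, those of index [Negz p], that is [-(p+1)],
    vanish. *)
Definition radial_holomorphic i (G : V -> R[i]) := forall z, B z ->
  (forall (p : nat) (s : R), 0 <= s <= 1 ->
     fcoef i p G (scal i s%:C%C z) = s%:C%C ^+ p * fcoef i p G z) /\
  (forall p : nat, fcoef i (Negz p) G z = 0).

Definition power_like i (p : nat) (G : V -> R[i]) := forall w z, normc w <= 1 -> B z ->
  G (scal i w z) = w ^+ p * G z.

(** For [w = e^(i a) s] the dilation by [s] is given by [radial_holomorphic] and the rotation by
    [fcoef_rot]. The value [w = 0], which has no argument, is the dilation by [s = 0]. *)
Lemma fcoef_power_like G i (p : nat) : locally_tame G -> radial_holomorphic i G ->
  power_like i p (fcoef i p G).
Proof.
move=> tG hG w z w1 Bz; have [w0|w0] := eqVneq w 0.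
  have [H _] := hG z Bz; rewrite w0; apply: (H p 0).
  by apply/andP; split.
have n0 : 0 < normc w by rewrite normc_gt0.
pose s := normc w; pose v := w / s%:C%C.
have s0 : s%:C%C != 0 :> R[i] by rewrite -normc_eq0 normc_real ger0_norm ?gt_eqF// ltW.
have v1 : normc v = 1 by rewrite /v normcM normcV normc_real ger0_norm ?ltW// mulfV ?gt_eqF.
have [a ha va] := polar v1.
have wE : w = ce a * s%:C%C by rewrite -va /v divfK.
have s01 : 0 <= s <= 1 by rewrite w1 ltW.
rewrite wE -scalM fcoef_rot//; have [+ _] := hG z Bz; move=> /(_ p s s01) ->.
by rewrite exprMn mulrA; congr (_ * _ * _); rewrite /kern mulNr mulrN opprK ceX.
Qed.

Lemma fcoef_radial_holomorphic G i j q : locally_tame G -> radial_holomorphic i G ->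
  radial_holomorphic i (fcoef j q G).
Proof.
move=> tG hG z Bz; split => p.
  move=> s s01; have s1 : normc s%:C%C <= 1 by case/andP: s01 => ? ?; rewrite normc_real ger0_norm.
  rewrite !(fcoefC i j p q _ tG).
  have c := cintegrable_orbit j q z (fcoef_tame i p tG).
  transitivity (Cint circ (fun t => s%:C%C ^+ p * (fcoef i p G (scal j (ce t) z) * kern q t))); last exact: CintZ.
  apply: eq_Cint => t; rewrite scalC mulrA; congr (_ * _).
  have Bt : B (scal j (ce t) z) by apply: ball_scal => //; rewrite normc_ce.
  by have [+ _] := hG _ Bt; apply.
rewrite fcoefC// [LHS]/fcoef; under eq_Cint => t.
  have Bt : B (scal j (ce t) z) by apply: ball_scal => //; rewrite normc_ce.
  have [_ +] := hG _ Bt; move=> ->; rewrite mul0r; over.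
exact: Cint0.
Qed.

Lemma fcoef_keeps_power_like G i j (p : nat) q : locally_tame G -> power_like i p G ->
  power_like i p (fcoef j q G).
Proof.
move=> tG hG w z w1 Bz; rewrite /fcoef -CintZ; last exact: cintegrable_orbit.
apply: eq_Cint => t; rewrite scalC hG ?mulrA//.
by apply: ball_scal => //; rewrite normc_ce.
Qed.

Definition mono (al : 'I_n -> nat) z : R[i] := \prod_i z i 0 ^+ al i.

(** Scaling the constant point [one] by the coordinates of [z] and scaling [z] by [rho] lead to the
    same point; comparing the two values of [G] there expresses [G z] by [mono p z]. The coordinates
    of [one] are a small [rho] so that it lies in the ball. *)
Lemma power_like_mono (p : 'I_n -> nat) G : (forall i, power_like i (p i) G) ->
  exists c, forall z, B z -> G z = c * mono p z.
Proof.
move=> hG.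
have key (s : seq 'I_n) (w : 'I_n -> R[i]) z : uniq s -> (forall i, normc (w i) <= 1) -> B z ->
    B (foldr (fun i x => scal i (w i) x) z s) /\
    G (foldr (fun i x => scal i (w i) x) z s) = (\prod_(i <- s) w i ^+ p i) * G z.
  elim: s => [|i s IH] us w1 Bz; first by rewrite big_nil mul1r.
  case/andP: us => _ us; have [B1 E1] := IH us w1 Bz; split => /=; first exact: ball_scal.
  by rewrite hG// E1 big_cons mulrA.
have allE (w : 'I_n -> R[i]) z : foldr (fun i x => scal i (w i) x) z (enum 'I_n) = \col_j (w j * z j 0).
  have aux (s : seq 'I_n) : uniq s -> foldr (fun i x => scal i (w i) x) z s =
      \col_j (if j \in s then w j * z j 0 else z j 0).
    elim: s => [|i s IH] us; first by apply/colP => j; rewrite mxE.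
    case/andP: us => is_ us; rewrite /= IH//; apply/colP => j; rewrite !mxE in_cons.
    by have [->|] := eqVneq j i; rewrite //= (negbTE is_).
  rewrite aux ?enum_uniq//; apply/colP => j; by rewrite !mxE mem_enum.
have [r r0 rB] := @box_sub_ball R n.
pose rho := Num.min (r / 2) 1.
have rho0 : 0 < rho by rewrite lt_min divr_gt0// ltr01.
have rho1 : rho <= 1 by rewrite ge_min lexx orbT.
pose one : V := const_mx rho%:C%C.
have Bone : B one.
  apply: rB => i; rewrite mxE /= normr0 r0 ger0_norm ?(ltW rho0)//; split => //.
  by apply: (@le_lt_trans _ _ (r / 2)); [rewrite ge_min lexx|rewrite ltr_pdivrMr// ltr_pMr// (ltr_nat R 1)].
exists ((\prod_(i <- enum 'I_n) rho%:C%C ^+ p i)^-1 * G one) => z Bz.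
have rn : normc rho%:C%C <= 1 by rewrite normc_real ger0_norm// ltW.
have zn i : normc (z i 0) <= 1.
  have /ltW := Bz; rewrite /Bn/= /sqnorm (bigD1 i)//= => h.
  rewrite -[leRHS]ger0_norm// -ler_sqr ?nnegrE ?normc_ge0// normr1 expr1n.
  by apply: le_trans h; rewrite lerDl; apply: sumr_ge0 => *; exact: sqr_ge0.
have [_ E1] := key (enum 'I_n) (fun=> rho%:C%C) z (enum_uniq _) (fun=> rn) Bz.
have [_ E2] := key (enum 'I_n) (fun i => z i 0) one (enum_uniq _) zn Bone.
rewrite !allE in E1 E2.
have EE : \col_j (rho%:C%C * z j 0) = \col_j (z j 0 * one j 0) :> V.
  by apply/colP => j; rewrite !mxE mulrC.
rewrite EE E2 in E1.
have pn : \prod_(i <- enum 'I_n) rho%:C%C ^+ p i != 0 :> R[i].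
  rewrite prodf_seq_neq0; apply/allP => i _ /=; apply: expf_neq0.
  by rewrite -normc_eq0 normc_real ger0_norm ?gt_eqF// ltW.
rewrite -[LHS](mulKf pn) -E1 -mulrA; congr (_ * _).
by rewrite mulrC /mono big_enum.
Qed.

End coordinate_rotations.

(** * Totality of the monomials *)

Section totality_of_monomials.
Context {R : realType} (n : nat) (la : R).
Hypothesis la1 : -1 < la.
Local Notation V := 'cV[R[i]]_n.
Local Notation B := (Bn R n).
Local Notation nu := (@bnu R n la la1).
Implicit Types (i j : 'I_n) (z : V) (q : int) (G : V -> R[i]).

Let measurable_scal_fixed i (w : R[i]) : measurable_fun setT (fun z : V => scal i w z).
Proof. exact: measurable_scal. Qed.

Lemma bnu_rot i t A : measurable A -> nu ((fun z => scal i (ce t) z) @^-1` A) = nu A.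
Proof.
have [U uU UE] := scal_unitary i (normc_ce t) => mA.
rewrite (_ : _ @^-1` A = (fun z => U *m z) @^-1` A); first exact: bnu_unitary.
by apply/funext => z; rewrite /preimage/= UE.
Qed.

Lemma integral_bnu_rot i t (f : V -> \bar R) : measurable_fun setT f -> (forall z, 0 <= f z)%E ->
  (\int[nu]_z f (scal i (ce t) z) = \int[nu]_z f z)%E.
Proof.
move=> mf f0; apply: (@integral_invariant R _ V nu (fun z => scal i (ce t) z)) => //.
by move=> A mA; exact: bnu_rot.
Qed.

Lemma integral_bnu_average i (f : V -> \bar R) : measurable_fun setT f -> (forall z, 0 <= f z)%E ->
  (\int[nu]_z \int[circ]_t f (scal i (ce t) z) = (pi *+ 2)%:E * \int[nu]_z f z)%E.
Proof.
move=> mf f0.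
have mff : measurable_fun setT (fun p : V * R => f (scal i (ce p.2) p.1)).
  apply: (measurableT_comp mf); apply: measurable_scal => //.
  by apply: (measurableT_comp measurable_ce).
rewrite (fubini_tonelli (m1 := nu) (m2 := circ) (fun p : V * R => f (scal i (ce p.2) p.1)) mff); last first.
  by move=> p; exact: f0.
under eq_integral do rewrite /= integral_bnu_rot//.
rewrite (_ : (pi *+ 2)%:E = circ setT); last by rewrite circT.
rewrite muleC; exact: (integral_cst circ measurableT).
Qed.

Definition dist1 i t G : \bar R := (\int[nu]_z (normc (G (scal i (ce t) z) - G z))%:E)%E.

(** Continuity of the rotations of coordinate [i] in [L1]: it makes the pairing with a bounded
    function continuous in the angle at 0, as [fourier_unique] demands. *)
Definition rot_continuous i G := forall e : R, 0 < e -> exists2 d : R, 0 < d &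
  forall t, `|t| <= d -> (dist1 i t G <= e%:E)%E.

Definition rotation_regular G := [/\ locally_tame G, cintegrable nu G,
  forall i, rot_continuous i G & forall i, radial_holomorphic i G].

Let normcE_measurable G : measurable_fun setT G -> measurable_fun setT (fun z => (normc (G z))%:E).
Proof. by move=> mG; exact/measurable_EFinP/measurable_normc. Qed.

(** Tonelli and rotation invariance; [4 pi] is the length of the circle times the factor 2 of the
    complex estimate. [H] is kept apart from [fcoef i q G] because the lemma is also applied to a
    rotated function minus the function itself, whose coefficient is written as a difference. *)
Lemma fcoef_L1 G H i q : measurable_fun setT H -> measurable_fun setT G ->
  (forall z, fcoef i q G z = H z) -> (forall z, cintegrable circ (fun t => G (scal i (ce t) z) * kern q t)) ->
  (\int[nu]_z (normc (H z))%:E <= (pi *+ 4)%:E * \int[nu]_z (normc (G z))%:E)%E.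
Proof.
move=> mH mG GH cG.
have mGi : measurable_fun setT (fun z => \int[circ]_t (normc (G (scal i (ce t) z)))%:E)%E.
  apply: (measurable_fun_fubini_tonelli_F (m2 := circ) (fun p : V * R => (normc (G (scal i (ce p.2) p.1)))%:E)).
    by apply/measurable_EFinP/measurable_normc; exact: measurable_rot2.
  by move=> p; rewrite lee_fin normc_ge0.
apply: (@le_trans _ _ (\int[nu]_z (2%:E * \int[circ]_t (normc (G (scal i (ce t) z)))%:E))%E).
  apply: ge0_le_integral => //.
  - by move=> z _; rewrite lee_fin normc_ge0.
  - exact: normcE_measurable.
  - exact: measurable_funeM.
  move=> z _; rewrite -GH; apply: (le_trans (normc_Cint_leE (cG z))).
  by under eq_integral do rewrite normcM normc_kern mulr1.
rewrite ge0_integralZl//; last by move=> z _; apply: integral_ge0 => t _; rewrite lee_fin normc_ge0.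
rewrite (integral_bnu_average i (f := fun z => (normc (G z))%:E)); last 2 first.
- exact: normcE_measurable.
- by move=> z; rewrite lee_fin normc_ge0.
by rewrite muleA -EFinM mulr_natl -mulrnA.
Qed.

Lemma fcoef_rotation_regular G i q : rotation_regular G -> rotation_regular (fcoef i q G).
Proof.
move=> [tG cG rG hG]; have [mG _ _] := tG.
have tS := fcoef_tame i q tG; have [mS _ _] := tS.
have I0 (H : V -> R[i]) : (0 <= \int[nu]_z (normc (H z))%:E)%E.
  by apply: integral_ge0 => z _; rewrite lee_fin normc_ge0.
split => //.
- split => //; apply: (le_lt_trans (fcoef_L1 mS mG (fun=> erefl) _)).
    by move=> z; exact: cintegrable_orbit.
  by rewrite lte_mul_pinfty// ?cG.2// lee_fin mulrn_wge0// pi_ge0.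
- move=> j e e0; have p0 := pi_gt0 R.
  have e'0 : 0 < e / (pi *+ 4) by rewrite divr_gt0// pmulrn_lgt0.
  have [d d0 hd] := rG j _ e'0; exists d => // a ha.
  have mR : measurable_fun setT (fun z => G (scal j (ce a) z)) by exact: measurable_rot.
  have cR z : cintegrable circ (fun t => G (scal j (ce a) (scal i (ce t) z)) * kern q t).
    have := cintegrable_orbit i q (scal j (ce a) z) tG.
    by under eq_fun do rewrite scalC.
  apply: (@le_trans _ _ ((pi *+ 4)%:E * dist1 j a G)%E); last first.
    apply: (@le_trans _ _ ((pi *+ 4)%:E * (e / (pi *+ 4))%:E)%E).
      by apply: lee_wpmul2l; [rewrite lee_fin mulrn_wge0// pi_ge0|exact: hd].
    by rewrite -EFinM mulrC divfK// gt_eqF// pmulrn_lgt0.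
  apply: (@fcoef_L1 (fun z => G (scal j (ce a) z) - G z) (fun z => fcoef i q G (scal j (ce a) z) - fcoef i q G z) i q).
  + apply: measurable_cD; [exact: measurable_rot|exact: measurable_cN].
  + apply: measurable_cD; [exact: measurable_rot|exact: measurable_cN].
  + move=> z; rewrite /fcoef -CintB; [|by under eq_fun do rewrite scalC; exact: cR|exact: cintegrable_orbit].
    by apply: eq_Cint => t; rewrite mulrBl [in RHS]scalC.
  + move=> z; under eq_fun do rewrite mulrBl.
    by apply: cintegrableB; [exact: cR|exact: cintegrable_orbit].
- by move=> j; exact: fcoef_radial_holomorphic.
Qed.

Section pairing.
Variables (u : V -> R[i]) (K : R).
Hypotheses (mu : measurable_fun setT u) (uK : forall z, normc (u z) <= K).

Let cint_u G : cintegrable nu G -> cintegrable nu (fun z => u z * G z).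
Proof. by move=> cG; exact: cintegrableM uK cG. Qed.

Let K_ge0 : 0 <= K. Proof. by apply: le_trans (uK 0); exact: normc_ge0. Qed.

Let cint_rot G i t : cintegrable nu G -> cintegrable nu (fun z => G (scal i (ce t) z)).
Proof.
move=> [mG iG]; split; first exact: measurable_rot.
rewrite (integral_bnu_rot i t (f := fun z => (normc (G z))%:E))//.
- exact: normcE_measurable.
- by move=> z; rewrite lee_fin normc_ge0.
Qed.

Let pair_bound G : cintegrable nu G ->
  ((normc (Cint nu (fun z => u z * G z)))%:E <= (2 * K)%:E * \int[nu]_z (normc (G z))%:E)%E.
Proof.
move=> cG; apply: (le_trans (normc_Cint_leE (cint_u cG))).
rewrite EFinM -muleA; apply: lee_wpmul2l => //.
rewrite -ge0_integralZl//; last 2 first.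
- by apply: normcE_measurable; case: cG.
- by move=> z _; rewrite lee_fin normc_ge0.
apply: ge0_le_integral => //.
- by move=> z _; rewrite lee_fin normc_ge0.
- by apply: normcE_measurable; apply: measurable_cM => //; case: cG.
- by apply: measurable_funeM; apply: normcE_measurable; case: cG.
- by move=> z _; rewrite -EFinM lee_fin normcM ler_wpM2r ?normc_ge0.
Qed.

(** [Psi] is the pairing as a function of the rotation angle. By Fubini its Fourier coefficients are
    the pairings with [fcoef i q G], which vanish; hence so does [Psi 0]. *)
Lemma pairing_fourier_unique G i : rotation_regular G ->
  (forall q, Cint nu (fun z => u z * fcoef i q G z) = 0) ->
  Cint nu (fun z => u z * G z) = 0.
Proof.
move=> [tG cG rG hG] hq; have [mG G0 Gb] := tG.
pose Psi t := Cint nu (fun z => u z * G (scal i (ce t) z)).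
have -> : Cint nu (fun z => u z * G z) = Psi 0.
  by apply: eq_Cint => z; rewrite ce0 scal1.
have IG : (\int[nu]_z (normc (G z))%:E)%E \is a fin_num.
  by rewrite ge0_fin_numE ?cG.2//; apply: integral_ge0 => z _; rewrite lee_fin normc_ge0.
have mf : measurable_fun setT (fun p : R * V => u p.2 * G (scal i (ce p.1) p.2)).
  apply: measurable_cM; first by apply: (measurableT_comp mu).
  apply: (measurableT_comp mG); apply: measurable_scal => //.
  by apply: (measurableT_comp measurable_ce).
have mPsi : measurable_fun setT Psi.
  exact: (@measurable_Cint R _ _ (measurableTypeR R) V nu (fun t z => u z * G (scal i (ce t) z))).
have rotI t : (\int[nu]_z (normc (G (scal i (ce t) z)))%:E = \int[nu]_z (normc (G z))%:E)%E.
  rewrite (integral_bnu_rot i t (f := fun z => (normc (G z))%:E))//; first exact: normcE_measurable.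
  by move=> z; rewrite lee_fin normc_ge0.
apply: (@fourier_unique _ Psi (2 * K * fine (\int[nu]_z (normc (G z))%:E))) => //.
- move=> t; rewrite -lee_fin EFinM fineK// -(rotI t).
  by apply: pair_bound; exact: cint_rot.
- move=> e e0; have K1 : 0 < 2 * K + 1 by rewrite ltr_wpDl// mulr_ge0.
  have e'0 : 0 < e / (2 * K + 1) by rewrite divr_gt0.
  have [d d0 hd] := rG i _ e'0; exists d => // t ht.
  rewrite normcB /Psi -CintB; [|exact/cint_u/cint_rot|exact/cint_u/cint_rot].
  under eq_Cint do rewrite -mulrBr ce0 scal1.
  have cD : cintegrable nu (fun z => G (scal i (ce t) z) - G z).
    by apply: cintegrableB => //; exact: cint_rot.
  rewrite -lee_fin; apply: (le_trans (pair_bound cD)).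
  apply: (@le_trans _ _ ((2 * K)%:E * (e / (2 * K + 1))%:E)%E).
    by apply: lee_wpmul2l; [rewrite lee_fin mulr_ge0|exact: hd].
  by rewrite -EFinM lee_fin mulrCA ger_pMr// ler_pdivrMr// mul1r lerDl.
- move=> q; rewrite -(hq q).
  pose f t z := u z * (G (scal i (ce t) z) * kern q t).
  have fin : (\int[circ]_t \int[nu]_z (normc (f t z))%:E < +oo)%E.
    apply: (@le_lt_trans _ _ (\int[circ]_t (K * fine (\int[nu]_z (normc (G z))%:E))%:E)%E); last first.
      by rewrite integral_circ_cst ltry.
    apply: (@ge0_le_integral _ (measurableTypeR R) R circ _ measurableT).
    - by move=> t _; apply: integral_ge0 => z _; rewrite lee_fin normc_ge0.
    - apply: (@measurable_fun_fubini_tonelli_F _ _ (measurableTypeR R) V R nu (fun x => (normc (f x.1 x.2))%:E)).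
        apply/measurable_EFinP; apply: measurable_normc.
        apply: measurable_cM; first by apply: (measurableT_comp mu).
        apply: measurable_cM; last by apply: (measurableT_comp (measurable_kern q)).
        apply: (measurableT_comp mG); apply: measurable_scal => //.
        by apply: (measurableT_comp measurable_ce).
      by move=> x; rewrite lee_fin normc_ge0.
    - by [].
    move=> t _; rewrite EFinM fineK// -(rotI t) -ge0_integralZl//; last 2 first.
    - by apply: normcE_measurable; exact: measurable_rot.
    - by move=> z _; rewrite lee_fin normc_ge0.
    apply: ge0_le_integral => //.
    - by move=> z _; rewrite lee_fin normc_ge0.
    - apply: normcE_measurable; apply: measurable_cM => //; apply: measurable_cM => //.
      exact: measurable_rot.
    - by apply: measurable_funeM; apply: normcE_measurable; exact: measurable_rot.
    - move=> z _; rewrite -EFinM lee_fin !normcM normc_kern mulr1.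
      by rewrite ler_wpM2r ?normc_ge0.
  have mff : measurable_fun setT (fun x : R * V => f x.1 x.2).
    apply: measurable_cM; first by apply: (measurableT_comp mu).
    apply: measurable_cM; last by apply: (measurableT_comp (measurable_kern q)).
    apply: (measurableT_comp mG); apply: measurable_scal => //.
    by apply: (measurableT_comp measurable_ce).
  have c1 t : cintegrable nu (f t).
    have := cintegrableZ (kern q t) (cint_u (cint_rot i t cG)).
    by congr cintegrable; apply/funext => z; rewrite /f; ring.
  have c2 z : cintegrable circ (f^~ z) by apply: cintegrableZ; exact: cintegrable_orbit.
  transitivity (Cint circ (fun t => Cint nu (f t))).
    apply: eq_Cint => t; rewrite mulrC /Psi -CintZ; last exact/cint_u/cint_rot.
    by apply: eq_Cint => z; rewrite /f; ring.
  rewrite (@Cint_fubini R _ _ (measurableTypeR R) V circ nu f)//.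
  by apply: eq_Cint => z; rewrite /fcoef -CintZ//; exact: cintegrable_orbit.
Qed.

(** In [key], [l] is the number of coordinates still untreated, and [G] is [power_like] in all the
    others. The last untreated coordinate is handled by passing to the Fourier coefficients along
    it: those of negative index vanish, the others are [power_like] there too. For [l = 0] the
    function is a multiple of a monomial. *)
Lemma totality G :
  (forall p : 'I_n -> nat, Cint nu (fun z => u z * ball_restrict (mono p) z) = 0) ->
  rotation_regular G -> Cint nu (fun z => u z * G z) = 0.
Proof.
move=> hu gG.
suff key l : forall (p : 'I_n -> nat) G, rotation_regular G ->
    (forall i : 'I_n, (l <= i)%N -> power_like i (p i) G) ->
    (l <= n)%N -> Cint nu (fun z => u z * G z) = 0.
  by apply: (key n (fun=> 0%N)) => // i; rewrite leqNgt ltn_ord.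
elim: l => [|l IH] p {}G {}gG pG ln.
  have [c Gc] := @power_like_mono R n p G (fun i => pG i (leq0n i)).
  have [[mG G0 _] _ _ _] := gG.
  have GE z : G z = c * ball_restrict (mono p) z.
    rewrite /ball_restrict patchE; case: ifPn => [|/negP zB].
      by rewrite inE => Bz; exact: Gc.
    by rewrite mulr0 G0// => Bz; apply: zB; rewrite inE.
  have [c0|c0] := eqVneq c 0; first by rewrite -[RHS](Cint0 nu); apply: eq_Cint => z; rewrite GE c0 mul0r mulr0.
  apply: (mulfI (invr_neq0 c0)); rewrite mulr0 -(hu p) -CintZ; last first.
    by apply: cint_u; case: gG.
  by apply: eq_Cint => z; rewrite GE; field.
pose i := Ordinal ln.
apply: (@pairing_fourier_unique G i) => // -[q|q]; last first.
  rewrite -[RHS](Cint0 nu); apply: eq_Cint => z.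
  have [tG _ _ hG] := gG; have [Bz|nBz] := pselect (B z).
    by have [_ ->] := hG i z Bz; rewrite mulr0.
  by have [_ -> //] := fcoef_tame i (Negz q) tG; rewrite mulr0.
have [tG _ _ hG] := gG.
apply: (IH (fun j => if j == i then q else p j)); [exact: fcoef_rotation_regular| |exact: ltnW].
move=> j lj; have [->|ji] := eqVneq j i; first exact: fcoef_power_like.
apply: fcoef_keeps_power_like => //; apply: pG.
by rewrite ltn_neqAle lj andbT; apply: contraNneq ji => e; apply/eqP/val_inj.
Qed.

End pairing.
End totality_of_monomials.

(** * Holomorphic functions *)

Section complex_derivative.
Context {R : realType}.
Local Notation C := R[i].
Implicit Types (f g : C -> C) (w : C).

Definition cont0 (psi : C -> C) := forall e : R, 0 < e ->
  exists2 d : R, 0 < d & forall u, normc u < d -> normc (psi u - psi 0) <= e.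

Lemma cont0_cst c : cont0 (fun=> c).
Proof. by move=> e e0; exists 1 => // u _; rewrite subrr normc0 ltW. Qed.

Lemma cont0_id : cont0 id.
Proof. by move=> e e0; exists e => // u ue; rewrite subr0 ltW. Qed.

Lemma cont0D psi chi : cont0 psi -> cont0 chi -> cont0 (fun u => psi u + chi u).
Proof.
move=> cp cc e e0; have e2 : 0 < e / 2 by rewrite divr_gt0.
have [d d0 hd] := cp _ e2; have [d' d'0 hd'] := cc _ e2.
exists (Num.min d d'); first by rewrite lt_min d0.
move=> u; rewrite lt_min => /andP[/hd h /hd' h'].
have -> : psi u + chi u - (psi 0 + chi 0) = (psi u - psi 0) + (chi u - chi 0) by ring.
by apply: (le_trans (le_normcD _ _)); lra.
Qed.

Lemma cont0M psi chi : cont0 psi -> cont0 chi -> cont0 (fun u => psi u * chi u).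
Proof.
move=> cp cc e e0; pose K := 1 + normc (psi 0) + normc (chi 0).
have p0 := normc_ge0 (psi 0); have c0 := normc_ge0 (chi 0).
have K0 : 0 < K by rewrite /K; lra.
pose e' := Num.min 1 (e / K).
have e'0 : 0 < e' by rewrite lt_min ltr01 divr_gt0.
have e'1 : e' <= 1 by rewrite ge_min lexx.
have e'K : e' * K <= e by rewrite -ler_pdivlMr// ge_min lexx orbT.
have [d d0 hd] := cp _ e'0; have [d' d'0 hd'] := cc _ e'0.
exists (Num.min d d'); first by rewrite lt_min d0.
move=> u; rewrite lt_min => /andP[/hd h /hd' h'].
have -> : psi u * chi u - psi 0 * chi 0 = (psi u - psi 0) * (chi u - chi 0) +
    (psi 0 * (chi u - chi 0) + (psi u - psi 0) * chi 0) by ring.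
apply: (le_trans (le_normcD _ _)); apply: le_trans e'K; rewrite normcM.
apply: (@le_trans _ _ (e' * 1 + (normc (psi 0) * e' + e' * normc (chi 0)))); last by rewrite /K; lra.
apply: lerD; first by apply: ler_pM; rewrite ?normc_ge0//; apply: le_trans h' _.
by apply: (le_trans (le_normcD _ _)); rewrite !normcM lerD ?ler_wpM2l ?ler_wpM2r.
Qed.

Lemma cont0_comp psi chi : cont0 psi -> cont0 chi -> chi 0 = 0 -> cont0 (fun u => psi (chi u)).
Proof.
move=> cp cc c0 e e0; have [d d0 hd] := cp _ e0.
have d2 : 0 < d / 2 by rewrite divr_gt0.
have [d' d'0 hd'] := cc _ d2; exists d' => // u /hd'; rewrite c0 subr0 => h.
by apply: hd; apply: le_lt_trans h _; rewrite ltr_pdivrMr// ltr_pMr// (ltr_nat R 1).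
Qed.

(* Caratheodory's formulation of complex differentiability makes the product and
   chain rules algebraic. *)
Definition cdiff f w := exists psi : C -> C,
  (forall u, f (w + u) = f w + psi u * u) /\ cont0 psi.

Lemma cdiffM f g w : cdiff f w -> cdiff g w -> cdiff (fun x => f x * g x) w.
Proof.
move=> [pf [fE cf]] [pg [gE cg]].
exists (fun u => (pf u * g w + f w * pg u) + (pf u * pg u) * u); split.
  by move=> u; rewrite fE gE; ring.
apply: cont0D; last by apply: cont0M; [exact: cont0M|exact: cont0_id].
by apply: cont0D; apply: cont0M => //; exact: cont0_cst.
Qed.

Lemma cdiff_comp f g w : cdiff g w -> cdiff f (g w) -> cdiff (f \o g) w.
Proof.
move=> [pg [gE cg]] [pf [fE cf]].
exists (fun u => pf (pg u * u) * pg u); split.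
  by move=> u /=; rewrite gE fE; ring.
apply: cont0M => //; apply: (@cont0_comp pf (fun u => pg u * u)) => //; last by rewrite mulr0.
by apply: cont0M => //; exact: cont0_id.
Qed.

Lemma cdiff_linear (c : C) w : cdiff (fun x => c * x) w.
Proof. by exists (fun=> c); split => [u|]; [rewrite mulrDr|exact: cont0_cst]. Qed.

Lemma cdiff_bound f w : (exists c : C, forall e : R, 0 < e -> exists2 d : R, 0 < d &
    forall u, normc u < d -> normc (f (w + u) - f w - c * u) <= e * normc u) -> cdiff f w.
Proof.
move=> [c hc]; exists (fun u => if u == 0 then c else (f (w + u) - f w) / u); split.
  move=> u; have [->|u0] := eqVneq u 0; first by rewrite addr0 mulr0 addr0.
  by rewrite divfK//; ring.
move=> e e0; have [d d0 hd] := hc _ e0; exists d => // u ud.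
rewrite eqxx; have [_|u0] := eqVneq u 0; first by rewrite subrr normc0 ltW.
have n0 : 0 < normc u by rewrite normc_gt0.
rewrite -(ler_pM2r n0) -normcM mulrBl divfK//; exact: hd.
Qed.

Lemma linear_approx_is_derive (f : R -> R) (x c : R) : is_derive x (1 : R) f c ->
  forall e : R, 0 < e -> exists2 d : R, 0 < d &
    forall h, `|h| < d -> `|f (x + h) - f x - c * h| <= e * `|h|.
Proof.
move=> [dv dE] e e0; have := dv; rewrite /derivable -/(derive f x 1) => /cvgrPdist_le.
rewrite -/(derive f x 1) dE => /(_ e e0)[d /= d0 hd]; exists d => // h hdl.
have [->|h0] := eqVneq h 0; first by rewrite addr0 mulr0 subrr subr0 normr0 mulr0.
have := hd h; rewrite /ball_/= sub0r normrN => /(_ hdl h0).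
rewrite /shift/= [h *: 1]mulr1 [h + x]addrC => H.
have n0 : 0 < `|h| by rewrite normr_gt0.
have -> : f (x + h) - f x - c * h = - ((c - h^-1 *: (f (x + h) - f x)) * h).
  by rewrite /GRing.scale/=; field.
by rewrite normrN normrM ler_pM2r.
Qed.

Definition cexp (x : C) : C := (expR (cRe x))%:C%C * ce (cIm x).

Lemma cexpD x y : cexp (x + y) = cexp x * cexp y.
Proof. by rewrite /cexp cReD cImD expRD rmorphM ceD; ring. Qed.

Lemma cdiff_cexp0 : cdiff cexp 0.
Proof.
apply: cdiff_bound; exists 1 => e e0.
(* [e1 <= 1] bounds [|1 + h|] by 2 and [expR h] by 3. The four error terms below then add up to at
   most [8 e1 |u|], for which [e / 20] leaves room. *)
have [e1 [e10 e11 e1e]] : exists e1 : R, [/\ 0 < e1, e1 <= 1 & e1 <= e / 20].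
  exists (Num.min 1 (e / 20)); split; first by rewrite lt_min ltr01 divr_gt0.
    by rewrite ge_min lexx.
  by rewrite ge_min lexx orbT.
have [d1 d10 h1] := linear_approx_is_derive (is_derive_expR (0 : R)) e10.
have [d2 d20 h2] := linear_approx_is_derive (is_derive_cos (0 : R)) e10.
have [d3 d30 h3] := linear_approx_is_derive (is_derive_sin (0 : R)) e10.
exists (Num.min e1 (Num.min d1 (Num.min d2 d3))); first by rewrite !lt_min e10 d10 d20 d30.
move=> u; rewrite !lt_min => /and4P[ue u1 u2 u3].
set h := cRe u; set k := cIm u.
have hu : `|h| <= normc u := le_cRe_normc u.
have ku : `|k| <= normc u := le_cIm_normc u.
have := h1 h (le_lt_trans hu u1); have := h2 k (le_lt_trans ku u2).
have := h3 k (le_lt_trans ku u3).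
rewrite !add0r expR0 sin0 cos0 oppr0 addr0 mul0r !mul1r !subr0.
move=> hs hc he.
have nu0 := normc_ge0 u.
apply: (le_trans (normc_le_ReIm _)).
have -> : cRe (cexp u - cexp 0 - u) = expR h * cos k - 1 - h.
  by rewrite !cReB /cexp !cReM /= expR0 sin0 cos0 /h /k; ring.
have -> : cIm (cexp u - cexp 0 - u) = expR h * sin k - k.
  by rewrite !cImB /cexp !cImM /= expR0 sin0 cos0 /h /k; ring.
have cb : `|cos k| <= 1 by rewrite ler_norml cos_geN1 cos_le1.
have hE : `|expR h - 1| <= 2 * normc u.
  rewrite (_ : expR h - 1 = (expR h - 1 - h) + h); last by ring.
  apply: (le_trans (ler_normD _ _)); apply: (@le_trans _ _ (e1 * `|h| + `|h|)).
    by rewrite lerD2r.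
  by nra.
have hE3 : `|expR h| <= 3.
  rewrite (_ : expR h = (expR h - 1) + 1); last by ring.
  apply: (le_trans (ler_normD _ _)); rewrite normr1; lra.
have -> : expR h * cos k - 1 - h = (expR h - 1 - h) * cos k + (1 + h) * (cos k - 1) by ring.
have -> : expR h * sin k - k = expR h * (sin k - k) + (expR h - 1) * k by ring.
have b1 : `|(expR h - 1 - h) * cos k| <= e1 * normc u.
  rewrite normrM; apply: (@le_trans _ _ ((e1 * `|h|) * 1)); first by apply: ler_pM.
  by rewrite mulr1 ler_pM2l.
have b2 : `|(1 + h) * (cos k - 1)| <= 2 * (e1 * normc u).
  rewrite normrM; apply: ler_pM => //.
    by apply: (le_trans (ler_normD _ _)); rewrite normr1; lra.
  by apply: (le_trans hc); rewrite ler_pM2l.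
have b3 : `|expR h * (sin k - k)| <= 3 * (e1 * normc u).
  rewrite normrM; apply: ler_pM => //.
  by apply: (le_trans hs); rewrite ler_pM2l.
have b4 : `|(expR h - 1) * k| <= (2 * normc u) * e1.
  rewrite normrM; apply: ler_pM => //.
  by apply: (le_trans ku); exact: ltW.
have := ler_normD ((expR h - 1 - h) * cos k) ((1 + h) * (cos k - 1)).
have := ler_normD (expR h * (sin k - k)) ((expR h - 1) * k).
move=> t1 t2; apply: (@le_trans _ _ (8 * (e1 * normc u))); first lra.
by rewrite mulrA ler_wpM2r//; lra.
Qed.

Lemma cdiff_cexp w : cdiff cexp w.
Proof.
have [p [pE cp]] := cdiff_cexp0; exists (fun u => cexp w * p u); split.
  move=> u; rewrite cexpD -[in LHS](add0r u) pE /cexp/= expR0 ce0; ring.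
by apply: cont0M => //; exact: cont0_cst.
Qed.

(** With [f = u + i v], the form [f dz] is [(u dx - v dy) + i (v dx + u dy)], and the Cauchy-Riemann
    equations, read off from the complex derivative [p 0], say that both parts are closed. *)
Lemma cdiff_closed_form f x y : cdiff f (Complex x y) ->
  closed_form_at (fun x y => cRe (f (Complex x y))) (fun x y => - cIm (f (Complex x y))) x y /\
  closed_form_at (fun x y => cIm (f (Complex x y))) (fun x y => cRe (f (Complex x y))) x y.
Proof.
move=> [p [pE cp]].
have key (e : R) : 0 < e -> exists2 d : R, 0 < d & forall h k, `|h| <= d -> `|k| <= d ->
    normc (f (Complex (x + h) (y + k)) - f (Complex x y) - p 0 * Complex h k) <= e * (`|h| + `|k|).
  move=> e0; have [d d0 hd] := cp _ e0; exists (d / 3); first by rewrite divr_gt0.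
  move=> h k hh kk.
  have -> : Complex (x + h) (y + k) = Complex x y + Complex h k by [].
  have u2 : normc (Complex h k) <= `|h| + `|k| := normc_le_ReIm (Complex h k).
  rewrite pE (_ : _ - _ = (p (Complex h k) - p 0) * Complex h k); last by ring.
  rewrite normcM; apply: ler_pM => //; rewrite ?normc_ge0//.
  by apply: hd; lra.
split.
- exists (cRe (p 0)), (- cIm (p 0)), (- cRe (p 0)) => e e0; have [d d0 hd] := key e e0.
  exists d => // h k hh kk; have := hd h k hh kk => H; split; apply: le_trans H.
  + apply: le_trans (le_cRe_normc _); rewrite !cReB cReM/=.
    by rewrite le_eqVlt; apply/orP; left; apply/eqP; congr (`|_|); ring.
  + apply: le_trans (le_cIm_normc _); rewrite !cImB cImM/= -normrN.
    by rewrite le_eqVlt; apply/orP; left; apply/eqP; congr (`|_|); ring.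
- exists (cIm (p 0)), (cRe (p 0)), (- cIm (p 0)) => e e0; have [d d0 hd] := key e e0.
  exists d => // h k hh kk; have := hd h k hh kk => H; split; apply: le_trans H.
  + apply: le_trans (le_cIm_normc _); rewrite !cImB cImM/=.
    by rewrite le_eqVlt; apply/orP; left; apply/eqP; congr (`|_|); ring.
  + apply: le_trans (le_cRe_normc _); rewrite !cReB cReM/=.
    by rewrite le_eqVlt; apply/orP; left; apply/eqP; congr (`|_|); ring.
Qed.

End complex_derivative.

Section holomorphic_functions.
Context {R : realType} (n : nat).
Local Notation V := 'cV[R[i]]_n.
Local Notation B := (Bn R n).
Implicit Types (F : V -> R[i]) (z : V) (i : 'I_n).

(** Neighbourhoods with a real radius. The radius of a ball of ['cV[R[i]]_n] is a positive element
    of [R[i]], hence real, but of the complex type. *)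
Definition coord_close (d : R) z z' := forall j, normc (z' j 0 - z j 0) < d.

Lemma differentiable_coord_close F z : differentiable F z -> forall e : R, 0 < e ->
  exists2 d : R, 0 < d & forall z', coord_close d z z' -> normc (F z' - F z) <= e.
Proof.
move=> dF e e0; have /cvgrPdist_le := differentiable_continuous dF.
have ee : 0 < e%:C%C :> R[i] by rewrite ltcR.
move=> /(_ _ ee)/nbhs_ballP[r /= r0 H].
move: r0; rewrite ltcE/= => /andP[/eqP ri r0].
exists (cRe r) => // z' zz'; have := H z'; rewrite (_ : `|_| = (normc (F z - F z'))%:C%C); last by case: (_ - _).
rewrite lecR normcB; apply.
split => [|i j]; first by rewrite ltcE/= ri eqxx.
rewrite (ord1 j) /ball/=.
rewrite (_ : `|_| = (normc (z i 0 - z' i 0))%:C%C); last by case: (_ - _).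
rewrite normcB ltcE/= -ri eqxx/=; exact: zz'.
Qed.

Lemma cdiff_scal F i w z : differentiable F (scal i w z) ->
  cdiff (fun x => F (scal i x z)) w.
Proof.
move=> dF; set p := scal i w z; pose v : V := z i 0 *: delta_mx i 0.
have sE u : scal i (w + u) z = u *: v + p.
  apply/colP => j; rewrite !mxE; case: eqP => [->|_]/=; first by rewrite mulr1; ring.
  by rewrite mulr0 mulr0 add0r.
apply: cdiff_bound.
have /cvg_ex[c /cvgrPdist_le hc] := @diff_derivable _ _ _ F p v dF.
exists c => e e0; have ee : 0 < e%:C%C :> R[i] by rewrite ltcR.
have [d /= d0 hd] := hc _ ee.
move: d0; rewrite ltcE/= => /andP[/eqP di d0].
exists (cRe d) => // u ud; have [->|u0] := eqVneq u 0.
  by rewrite addr0 mulr0 subrr subr0 normc0 mulr0.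
have := hd u; rewrite /ball_/= sub0r normrN (_ : `|_| = (normc u)%:C%C); last by case: (u).
rewrite ltcE/= -di eqxx/= => /(_ ud u0).
rewrite /shift/= -/p => H; rewrite sE.
have n0 : 0 < normc u by rewrite normc_gt0.
move: H; rewrite (_ : `|_| = (normc (c - u^-1 *: (F (u *: v + p) - F p)))%:C%C); last by case: (_ - _).
rewrite lecR => H.
rewrite (_ : _ - _ = - ((c - u^-1 *: (F (u *: v + p) - F p)) * u)); last first.
  by rewrite /GRing.scale/=; field.
by rewrite normcN normcM ler_pM2r.
Qed.

(** In polar coordinates [Phi] maps a compact real box onto the polydisc. Near each point of the box
    continuity bounds [F] by its value there plus 1, and compactness makes the bound uniform. *)
Lemma polydisc_bounded F : (forall z, B z -> differentiable F z) ->
  forall z, B z -> exists M, forall z', polydisc z z' -> normc (F z') <= M.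
Proof.
move=> dF z Bz.
pose Phi (v : 'rV[R]_(n + n)) : V :=
  \col_j ((normc (z j 0) * v 0 (lshift n j))%:C%C * ce (v 0 (rshift n j))).
pose A (j : 'I_(n + n)) : set R := if fintype.split j is inl _ then `[0%R, 1%R]%classic else `[0%R, pi *+ 2]%classic.
have cA : compact [set v : 'rV[R]_(n + n) | forall j, A j (v ord0 j)].
  by apply: rV_compact => j; rewrite /A; case: fintype.split => _; exact: segment_compact.
have AP (v : 'rV[R]_(n + n)) : (forall j, A j (v ord0 j)) -> polydisc z (Phi v).
  move=> Av j; rewrite mxE normcM normc_ce mulr1 normc_real normrM.
  have := Av (lshift n j); rewrite /A (unsplitK (inl j)) /= in_itv/= => /andP[h0 h1].
  by rewrite !ger0_norm ?normc_ge0// ler_piMr// normc_ge0.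
have /compact_near_coveringP := cA.
move=> /(_ R (pinfty_nbhs R) (fun M v => normc (F (Phi v)) <= M) _) hM.
have {}hM : \forall M \near +oo, [set v : 'rV[R]_(n + n) | forall j, A j (v ord0 j)] `<=`
    (fun v => normc (F (Phi v)) <= M).
  apply: hM => v Av.
  have [d d0 hd] := differentiable_coord_close (dF _ (polydisc_ball Bz (AP _ Av))) ltr01.
  have d2 : 0 < d / 2 by rewrite divr_gt0.
  have hnear : \forall v' \near v, coord_close d (Phi v) (Phi v').
    suff h j : \forall v' \near v, normc (Phi v' j 0 - Phi v j 0) < d.
      exact: (@filter_forall _ _ (fun j v' => normc (Phi v' j 0 - Phi v j 0) < d) _ _ h).
    pose g (h : R -> R) (v' : 'rV[R]_(n + n)) := normc (z j 0) * v' 0 (lshift n j) * h (v' 0 (rshift n j)).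
    have cg h : continuous h -> {for v, continuous (g h)}.
      move=> ch.
      have c1 : {for v, continuous (fun v' : 'rV[R]_(n + n) => normc (z j 0) * v' 0 (lshift n j))}.
        apply: (@continuousM R _ (cst (normc (z j 0))) (fun v' : 'rV[R]_(n + n) => v' 0 (lshift n j)) v).
          exact: cst_continuous.
        exact: coord_continuous.
      apply: (continuousM c1).
      apply: (@continuous_comp _ _ _ (fun v' : 'rV[R]_(n + n) => v' 0 (rshift n j)) h).
        exact: coord_continuous.
      exact: ch.
    have /cvgrPdist_lt/(_ _ d2) h1 := cg _ (@continuous_cos R).
    have /cvgrPdist_lt/(_ _ d2) h2 := cg _ (@continuous_sin R).
    near=> v'; apply: (le_lt_trans (normc_le_ReIm _)).
    rewrite (splitr d) cReB cImB !mxE !cReM !cImM /= !mul0r !subr0 !addr0; apply: ltrD.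
      by rewrite distrC; near: v'; exact: h1.
    by rewrite distrC; near: v'; exact: h2.
  exists ([set v' | coord_close d (Phi v) (Phi v')], [set M | normc (F (Phi v)) + 1 <= M]).
    by split => /=; [exact: hnear|apply: nbhs_pinfty_ge; exact: num_real].
  move=> [v' M] /= [/hd H]; apply: le_trans.
  rewrite -(subrK (F (Phi v)) (F (Phi v'))) addrC; apply: (le_trans (le_normcD _ _)).
  by rewrite lerD2l.
have [M hMM] := filter_ex hM; exists M => z' zz'.
have /choice[f hf] (j : 'I_n) : exists p : R * R, [/\ 0 <= p.1 <= 1, 0 <= p.2 <= pi *+ 2 &
    z' j 0 = (normc (z j 0) * p.1)%:C%C * ce p.2].
  have := zz' j; have [z0|z0] := eqVneq (normc (z' j 0)) 0.
    move=> _; exists (0, 0); split => /=.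
    - by rewrite lexx ler01.
    - by rewrite lexx mulrn_wge0// pi_ge0.
    - by apply/eqP; rewrite mulr0 mul0r -normc_eq0 z0.
  have zj0 : 0 < normc (z' j 0) by rewrite lt_neqAle eq_sym z0 normc_ge0.
  move=> le; have zp : 0 < normc (z j 0) by apply: lt_le_trans le.
  have nz : (normc (z' j 0))%:C%C != 0 :> R[i] by rewrite -normc_eq0 normc_real normr_eq0.
  have w1 : normc (z' j 0 / (normc (z' j 0))%:C%C) = 1.
    by rewrite normcM normcV normc_real ger0_norm ?normc_ge0// mulfV.
  have [t t01 tE] := polar w1.
  exists (normc (z' j 0) / normc (z j 0), t); split => //=.
    by rewrite divr_ge0 ?normc_ge0//= ler_pdivrMr// mul1r.
  by rewrite -tE [normc (z j 0) * _]mulrC divfK ?gt_eqF// mulrC divfK.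
pose v : 'rV[R]_(n + n) := row_mx (\row_j (f j).1) (\row_j (f j).2).
have -> : z' = Phi v.
  by apply/colP => j; have [_ _ ->] := hf j; rewrite mxE row_mxEl row_mxEr !mxE.
apply: hMM => j; rewrite /A; case: (split_ordP j) => k -> ; have [h1 h2 _] := hf k.
  by rewrite /v row_mxEl mxE /= in_itv/=.
by rewrite /v row_mxEr mxE /= in_itv/=.
Unshelve. all: by end_near.
Qed.

End holomorphic_functions.

(** * Fourier coefficients of holomorphic functions *)

Section radial_dependence.
Context {R : realType} (n : nat).
Local Notation V := 'cV[R[i]]_n.
Local Notation B := (Bn R n).
Variable F : V -> R[i].
Hypotheses (tF : locally_tame F) (dF : forall z, B z -> differentiable F z).
Implicit Types (z : V) (i : 'I_n) (q : int).

Let cexp_real (x : R) y : cexp (Complex x y) = (expR x)%:C%C * ce y. Proof. by []. Qed.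

(* The integral of a closed form along the boundary of a rectangle vanishes; in
   logarithmic coordinates the horizontal sides cancel by periodicity. *)
Lemma fcoef_dilation i q z (x : R) : B z -> x <= 0 ->
  fcoef i q F z = (expR (- (q%:~R * x)))%:C%C * fcoef i q F (scal i (expR x)%:C%C z).
Proof.
move=> Bz x0; have [mF F0 Fb] := tF.
(* At abscissa [a], [f] is [e^(-q a)] times the integrand of the coefficient at the point dilated by
   [e^a]; for [a <= 0] this point stays in the ball. *)
pose f (w : R[i]) := F (scal i (cexp w) z) * cexp ((- q%:~R)%:C%C * w).
have ball_cexp a b : a <= 0 -> B (scal i (cexp (Complex a b)) z).
  move=> a0; apply: ball_scal => //; rewrite cexp_real normcM normc_ce mulr1 normc_real.
  by rewrite ger0_norm ?expR_ge0// -expR0 ler_expR.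
have cf a b : a <= 0 -> cdiff f (Complex a b).
  move=> a0; apply: cdiffM; last first.
    apply: (@cdiff_comp R cexp (fun w => (- q%:~R)%:C%C * w)); [exact: cdiff_linear|exact: cdiff_cexp].
  apply: (@cdiff_comp R (fun w => F (scal i w z)) cexp); first exact: cdiff_cexp.
  by apply: cdiff_scal; apply: dF; exact: ball_cexp.
have fE a b : f (Complex a b) = (expR (- (q%:~R * a)))%:C%C *
    (F (scal i (ce b) (scal i (expR a)%:C%C z)) * kern q b).
  rewrite /f cexp_real /cexp cReM cImM /= !mul0r subr0 addr0 scalM [ce b * _]mulrC.
  by rewrite mulNr /kern; ring.
have fper a : f (Complex a (- pi + pi *+ 2)) = f (Complex a (- pi)).
  by rewrite !fE kern_periodic ceD ce_2pi mulr1.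
have mf (g : R[i] -> R) a : (forall h : R -> R[i], measurable_fun setT h -> measurable_fun setT (g \o h)) ->
    measurable_fun setT (fun b => g (f (Complex a b))).
  move=> mg; apply: (mg (fun b => f (Complex a b))); under eq_fun do rewrite fE.
  by apply: measurable_cM => //; exact: measurable_fcoef_integrand.
have ci a : cintegrable circ (fun b => f (Complex a b)).
  under eq_fun do rewrite fE; apply: cintegrableZ; exact: cintegrable_orbit.
have pi2 : 0 <= pi *+ 2 :> R by rewrite mulrn_wge0// pi_ge0.
have seg_circ (h : R -> R) : measurable_fun setT h ->
    \int[lebesgue_measure]_(t in `[- pi, - pi + pi *+ 2]) h t = \int[circ]_t h t.
  move=> mh; congr fine.
  rewrite integral_circ; last exact/measurable_EFinP.
  rewrite /arc (_ : - pi + pi *+ 2 = pi); last by rewrite mulr2n; ring.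
  apply/esym/integral_itv_bndo_bndc; apply: measurable_funTS; exact/measurable_EFinP.
have key (P Q : R -> R -> R) :
    (forall a, measurable_fun setT (Q a)) ->
    (forall a, circ.-integrable setT (EFin \o Q a)) ->
    (forall a, P a (- pi + pi *+ 2) = P a (- pi)) ->
    (forall a b, a <= 0 -> closed_form_at P Q a b) ->
    \int[circ]_b Q 0 b = \int[circ]_b Q x b.
  move=> mQ iQ Pper PQ.
  have L0 : 0 <= - x by rewrite oppr_ge0.
  have := @closed_form_rect R P Q x (- x) (- pi) (pi *+ 2) L0 pi2.
  have e0 : x + - x = 0 by rewrite subrr.
  have hPQ a b : x <= a <= 0 -> - pi <= b <= - pi + pi *+ 2 -> closed_form_at P Q a b.
    by move=> /andP[_ a0] _; exact: PQ.
  rewrite e0 => /(_ hPQ); rewrite (_ : \int[lebesgue_measure]_(t in _) (P t _ - _) = 0); last first.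
    under eq_Rintegral do rewrite Pper subrr.
    by rewrite Rintegral_cst//= mul0r.
  rewrite add0r seg_circ; last exact: measurable_funB.
  rewrite (@RintegralB _ (measurableTypeR R) R circ setT)//.
  by move/eqP; rewrite subr_eq0 => /eqP.
have mRe a : measurable_fun setT (fun b => cRe (f (Complex a b))) by case: (ci a) => m _; exact: measurable_Re.
have mIm a : measurable_fun setT (fun b => cIm (f (Complex a b))) by case: (ci a) => m _; exact: measurable_Im.
have eqC : Cint circ (fun b => f (Complex 0 b)) = Cint circ (fun b => f (Complex x b)).
  apply: complexP => /=.
    apply: (key (fun a b => cIm (f (Complex a b))) (fun a b => cRe (f (Complex a b)))) => //.
    - by move=> a; exact: integrable_cRe.
    - by move=> a; rewrite fper.
    - by move=> a b a0; have [] := cdiff_closed_form (cf a b a0).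
  (* The second component of this closed form is [- Im f], so the equality of the imaginary parts is
     proved with the opposite sign. *)
  apply: oppr_inj.
  have H : \int[circ]_b (- cIm (f (Complex 0 b))) = \int[circ]_b (- cIm (f (Complex x b))).
    apply: (key (fun a b => cRe (f (Complex a b))) (fun a b => - cIm (f (Complex a b)))) => //.
    - by move=> a; exact: measurable_funN.
    - by move=> a; have := integrableN (integrable_cIm (ci a)).
    - by move=> a; rewrite fper.
    - by move=> a b a0; have [] := cdiff_closed_form (cf a b a0).
  have E a : \int[circ]_b (- cIm (f (Complex a b))) = - \int[circ]_b cIm (f (Complex a b)).
    under eq_Rintegral do rewrite -mulN1r.
    by rewrite (@RintegralZl _ (measurableTypeR R) R circ setT)//; [rewrite mulN1r|exact: integrable_cIm].
  by rewrite -!E.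
have -> : fcoef i q F z = Cint circ (fun b => f (Complex 0 b)).
  by apply: eq_Cint => b; rewrite fE mulr0 oppr0 expR0 mul1r scal1.
rewrite eqC -CintZ; last exact: cintegrable_orbit.
by apply: eq_Cint => b; rewrite fE.
Qed.

(** For a negative index the dilation formula gives a positive power of [s] times a quantity bounded
    on the polydisc; let [s] tend to 0. The value [s = 0] is out of reach of logarithmic
    coordinates: there, for index [p > 0], the rotation by [pi/p] fixes the point and changes the
    sign of the coefficient, and index 0 follows by continuity of [F]. *)
Lemma tame_radial_holomorphic i : radial_holomorphic i F.
Proof.
move=> z Bz; have [mF F0 Fb] := tF.
have exp_ln (s : R) : 0 < s -> expR (ln s) = s by move=> s0; rewrite lnK.
have dil q (s : R) : 0 < s -> s <= 1 ->
    fcoef i q F z = (expR (- (q%:~R * ln s)))%:C%C * fcoef i q F (scal i s%:C%C z).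
  by move=> s0 s1; rewrite (fcoef_dilation i q Bz (ln_le0 s1)) exp_ln.
have ball0 : B (scal i 0 z) by apply: ball_scal => //; rewrite normc0 ler01.
have powln (p : nat) (s : R) : 0 < s -> expR (p%:R * ln s) = s ^+ p.
  by move=> s0; rewrite mulrC -powR_mulrn ?ltW// /powR gt_eqF// mulrC.
split=> p; last first.
  have [_ _ Sb] := fcoef_tame i (Negz p) tF.
  have [M hM] := Sb _ Bz.
  have M0 : 0 <= M by apply: le_trans (hM _ (polydisc_refl z)); exact: normc_ge0.
  apply/eqP; rewrite -normc_eq0 -normr_le0 ger0_norm ?normc_ge0//; apply/ler_addgt0Pr => e e0; rewrite add0r.
  pose s := Num.min 1 (e / (M + 1)).
  have M1 : 0 < M + 1 by rewrite ltr_wpDl.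
  have s0 : 0 < s by rewrite lt_min ltr01 divr_gt0.
  have s1 : s <= 1 by rewrite ge_min lexx.
  have sM : s * (M + 1) <= e by rewrite -ler_pdivlMr// ge_min lexx orbT.
  rewrite (dil _ s)// normcM normc_real ger0_norm ?expR_ge0//.
  rewrite NegzE mulrNz mulNr opprK powln//.
  apply: le_trans sM; apply: ler_pM.
  - by rewrite exprn_ge0// (ltW s0).
  - exact: normc_ge0.
  - by rewrite exprS ler_piMr ?(ltW s0)// exprn_ile1// (ltW s0).
  apply: (@le_trans _ _ M); last by rewrite lerDl.
  apply: hM; apply: polydisc_scal; last exact: polydisc_refl.
  by rewrite normc_real ger0_norm// ltW.
move=> s /andP[s0 s1]; have [s0'|s0'] := eqVneq s 0; last first.
  have {}s0 : 0 < s by rewrite lt_neqAle eq_sym s0'.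
  rewrite (dil p s)// mulrA -rmorphXn -rmorphM/= -powln// -expRD subrr expR0 mul1r//.
rewrite {s s0 s1}s0'; case: p => [|p]; last first.
  rewrite expr0n/= mul0r.
  have pi0 := pi_gt0 R.
  have p1 : 1 <= p.+1%:R :> R by rewrite (ler_nat R 1).
  have p0 : 0 < p.+1%:R :> R by rewrite ltr0n.
  have ha : 0 <= (pi / p.+1%:R : R) <= pi *+ 2.
    rewrite divr_ge0 ?pi_ge0//= ler_pdivrMr//.
    by rewrite mulr2n; nra.
  have := fcoef_rot i p.+1 (scal i 0 z) ha tF.
  rewrite scalM mulr0 /kern mulrN mulNr opprK [_ * (_ / _)]mulrC divfK ?gt_eqF// ce_pi mulN1r.
  move/eqP; rewrite -subr_eq0 opprK -mulr2n mulrn_eq0/= => /eqP; exact.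
rewrite expr0 mul1r; apply/eqP; rewrite -subr_eq0 -normc_eq0 -normr_le0 ger0_norm ?normc_ge0//.
apply/ler_addgt0Pr => e e0; rewrite add0r.
have e'0 : 0 < e / (pi *+ 4) by rewrite divr_gt0// pmulrn_lgt0// pi_gt0.
have [d d0 hd] := differentiable_coord_close (dF ball0) e'0.
have K0 : 0 < normc (z i 0) + 1 by rewrite ltr_wpDl// normc_ge0.
pose s := Num.min 1 (d / (normc (z i 0) + 1)).
have s0 : 0 < s by rewrite lt_min ltr01 divr_gt0.
have s1 : s <= 1 by rewrite ge_min lexx.
have sK : s * (normc (z i 0) + 1) <= d by rewrite -ler_pdivlMr// ge_min lexx orbT.
rewrite (dil 0%N s)// mul0r oppr0 expR0 mul1r /fcoef -CintB; [|exact: cintegrable_orbit..].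
have -> : e = 2 * (e / (pi *+ 4) * (pi *+ 2)).
  have -> : pi *+ 4 = 2 * (pi *+ 2) :> R by ring.
  by rewrite mulrCA divfK// gt_eqF// mulr_gt0// pmulrn_lgt0// pi_gt0.
rewrite -lee_fin; apply: (le_trans (normc_Cint_leE (cintegrableB (cintegrable_orbit i 0 _ tF) (cintegrable_orbit i 0 _ tF)))).
rewrite EFinM; apply: lee_wpmul2l => //; rewrite -integral_circ_cst.
apply: (@ge0_le_integral _ (measurableTypeR R) R circ _ measurableT).
- by move=> t _; rewrite lee_fin normc_ge0.
- apply/measurable_EFinP; apply: measurable_normc; apply: measurable_cD.
    exact: measurable_fcoef_integrand.
  by apply: measurable_cN; exact: measurable_fcoef_integrand.
- by [].
- move=> t _; rewrite lee_fin -mulrBl normcM normc_kern mulr1 normcB !scalM mulr0; apply: hd => j.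
  rewrite !mxE; case: (j =P i) => [->|_]; last by rewrite subrr normc0.
  rewrite mul0r subr0 !normcM normc_ce mul1r normc_real ger0_norm ?ltW//.
  apply: lt_le_trans sK; rewrite ltr_pM2l// ltrDl ltr01//.
Qed.
End radial_dependence.

(** * Regularity of Bergman functions under rotations *)

Section bergman_functions.
Context {R : realType} (n : nat) (la : R).
Hypothesis la1 : -1 < la.
Local Notation V := 'cV[R[i]]_n.
Local Notation B := (Bn R n).
Local Notation nu := (@bnu R n la la1).
Implicit Types (F : V -> R[i]) (z : V) (i : 'I_n).

Lemma normc_ce_sub1 : exists2 d : R, 0 < d & forall t : R, `|t| < d -> normc (ce t - 1) <= 3 * `|t|.
Proof.
have [d d0 hd] := linear_approx_is_derive (is_derive_cos (0 : R)) (@ltr01 R).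
have [d' d'0 hd'] := linear_approx_is_derive (is_derive_sin (0 : R)) (@ltr01 R).
exists (Num.min d d'); first by rewrite lt_min d0.
move=> t; rewrite lt_min => /andP[/hd + /hd'].
rewrite !add0r sin0 cos0 oppr0 addr0 mul0r !mul1r !subr0 => h1 h2.
apply: (le_trans (normc_le_ReIm _)); rewrite /= oppr0 addr0.
have := ler_normD (sin t - t) t; rewrite subrK => h3; lra.
Qed.

Lemma ball_restrict_out F z : ~ B z -> ball_restrict F z = 0.
Proof. by move=> nB; rewrite /ball_restrict patchE memNset. Qed.

Lemma ball_restrict_in F z : B z -> ball_restrict F z = F z.
Proof. by move=> nB; rewrite /ball_restrict patchE mem_set. Qed.

Lemma measurable_ball_restrict F : measurable_fun B F -> measurable_fun setT (ball_restrict F).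
Proof.
move=> mF; apply: measurable_fun_if => //.
- apply: (measurable_fun_bool true); rewrite setTI (_ : _ @^-1` _ = B); first exact: measurable_Bn.
  by apply/seteqP; split => z; [move=> /set_mem|move=> /mem_set].
- by apply: measurable_funS mF; [exact: measurable_Bn|move=> z [_ /set_mem]].
Qed.

Lemma bergman_measurable F : bergman_space la F -> measurable_fun setT F.
Proof. by move=> [FE _ [mF _]]; rewrite FE; exact: measurable_ball_restrict. Qed.

Lemma bergman_out F z : bergman_space la F -> ~ B z -> F z = 0.
Proof. by move=> [-> _ _]; exact: ball_restrict_out. Qed.

Lemma bergman_square F : bergman_space la F -> (\int[nu]_z (normc (F z) ^+ 2)%:E < +oo)%E.
Proof. by move=> bF; apply/L2_bnu; [exact: bergman_measurable|case: bF]. Qed.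

(** The measure is finite and [|F| <= 1 + |F|^2]. *)
Lemma bergman_cintegrable F : bergman_space la F -> cintegrable nu F.
Proof.
move=> bF; have mF := bergman_measurable bF; split => //.
have mF2 : measurable_fun setT (fun z => (normc (F z) ^+ 2)%:E).
  exact/measurable_EFinP/measurable_sqr_normc.
apply: (@le_lt_trans _ _ (\int[nu]_z (1 + (normc (F z) ^+ 2)%:E))%E).
  apply: ge0_le_integral => //.
  - by move=> z _; rewrite lee_fin normc_ge0.
  - exact/measurable_EFinP/measurable_normc.
  - exact: emeasurable_funD.
  - by move=> z _; rewrite -EFinD lee_fin; have := sqr_ge0 (normc (F z) - 1); have := normc_ge0 (F z); nra.
rewrite ge0_integralD//; last by move=> z _; rewrite lee_fin sqr_ge0.
apply: lte_add_pinfty; last exact: bergman_square.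
by rewrite integral_cst// mul1e; exact: fin_num_fun_lty.
Qed.

Lemma rot_tendsto F i z : (forall z, ~ B z -> F z = 0) -> (forall z, B z -> differentiable F z) ->
  forall e : R, 0 < e -> exists2 d : R, 0 < d &
  forall t, `|t| <= d -> normc (F (scal i (ce t) z) - F z) <= e.
Proof.
move=> F0 dF e e0; have [Bz|nBz] := pselect (B z); last first.
  exists 1 => // t _; rewrite !F0//; first by rewrite subrr normc0 ltW.
  by move/(ball_rot _ _ (normc_ce t)).
have [d d0 hd] := differentiable_coord_close (dF z Bz) e0.
have [d' d'0 hd'] := normc_ce_sub1.
have K0 : 0 < 3 * normc (z i 0) + 1 by rewrite ltr_wpDl// mulr_ge0// normc_ge0.
pose r := Num.min (d' / 2) (d / (3 * normc (z i 0) + 1)).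
have r0 : 0 < r by rewrite lt_min !divr_gt0.
have rd' : r < d' by rewrite gt_min ltr_pdivrMr// ltr_pMr// (ltr_nat R 1).
have rK : r * (3 * normc (z i 0) + 1) <= d by rewrite -ler_pdivlMr// ge_min lexx orbT.
exists r => // t tr; apply: hd => j; rewrite mxE.
case: (j =P i) => [->|_]; last by rewrite subrr normc0.
rewrite -{2}[z i 0]mul1r -mulrBl normcM.
have h := hd' _ (le_lt_trans tr rd').
apply: (@le_lt_trans _ _ (3 * r * normc (z i 0))).
  by rewrite ler_wpM2r ?normc_ge0//; apply: (le_trans h); rewrite ler_pM2l.
by apply: lt_le_trans rK; rewrite mulrDr mulrCA mulrA ltrDl mulr1.
Qed.

(* Fatou's lemma applied to |F o rot| + |F| - |F o rot - F|. *)
Lemma cintegrable_rot_continuous F i : cintegrable nu F -> (forall z, ~ B z -> F z = 0) ->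
  (forall z, B z -> differentiable F z) -> rot_continuous la1 i F.
Proof.
move=> [mF iF] F0 dF e e0; apply: contrapT => H.
(* If continuity failed, there would be angles tending to 0 along which the [L1] distance exceeds
   [e]. With [I] the integral of [|F|], Fatou's lemma would then give [2 I <= 2 I - e]. *)
have /choice[t ht] (k : nat) : exists t : R, `|t| <= k.+1%:R^-1 /\ (e%:E < dist1 la1 i t F)%E.
  apply: contrapT => h; apply: H; exists k.+1%:R^-1; first by rewrite invr_gt0 ltr0n.
  by move=> t tk; rewrite leNgt; apply/negP => et; apply: h; exists t.
pose rot k z := F (scal i (ce (t k)) z).
pose f k z : \bar R := (normc (rot k z) + normc (F z) - normc (rot k z - F z))%:E.
have mrot k : measurable_fun setT (rot k) by exact: measurable_rot.
have mN G : measurable_fun setT G -> measurable_fun setT (fun z : V => (normc (G z))%:E).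
  by move=> mG; exact/measurable_EFinP/measurable_normc.
have mD k : measurable_fun setT (fun z => rot k z - F z).
  by apply: measurable_cD => //; exact: measurable_cN.
have mf k : measurable_fun setT (f k).
  apply/measurable_EFinP; apply: measurable_funB; last exact: measurable_normc.
  by apply: measurable_funD; exact: measurable_normc.
have f0 k z : (0 <= f k z)%E.
  by rewrite lee_fin subr_ge0 -[normc (F z)]normcN; exact: le_normcD.
have I_fin : (\int[nu]_z (normc (F z))%:E)%E \is a fin_num.
  by rewrite ge0_fin_numE//; apply: integral_ge0 => z _; rewrite lee_fin normc_ge0.
have flim z : (f^~ z @ \oo --> (2 * normc (F z))%:E)%E.
  apply/fine_cvgP; split; first by near=> k.
  apply/cvgrPdist_le => r r0; have r2 : 0 < r / 2 by rewrite divr_gt0.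
  have [d d0 hd] := rot_tendsto i z F0 dF r2.
  have [N] := ltr_add_invr d0; rewrite add0r => hN.
  exists N => // k /= Nk; have [tk _] := ht k.
  have {}tk : `|t k| <= d.
    apply: (le_trans tk); apply: le_trans (ltW hN).
    by rewrite lef_pV2 ?posrE ?ltr0n// ler_nat.
  have := hd _ tk; rewrite -/(rot k z) => h.
  have h1 := le_normcD (rot k z - F z) (F z); rewrite subrK in h1.
  have h2 := le_normcD (F z - rot k z) (rot k z); rewrite subrK [normc (F z - _)]normcB in h2.
  by have := normc_ge0 (rot k z - F z); rewrite ler_norml; lra.
have := fatou nu measurableT mf (fun k z _ => f0 k z).
apply/negP; rewrite -ltNge.
under [X in (_ < X)%E]eq_integral do rewrite (cvg_limn_einf_sup (flim _)).1 EFinM.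
rewrite ge0_integralZl//; last 2 first.
- exact: mN.
- by move=> z _; rewrite lee_fin normc_ge0.
set I := (\int[nu]_z (normc (F z))%:E)%E.
apply: (@le_lt_trans _ _ (2%:E * I - e%:E)%E); last first.
  by rewrite /I -(fineK I_fin) -EFinM -EFinB lte_fin ltrBlDr ltrDl.
rewrite limn_einf_lim; apply: lime_le; first exact: is_cvg_einfs.
near=> k; apply: (@le_trans _ _ (\int[nu]_z f k z)%E).
  by apply: ereal_inf_lbound; exists k => //=.
have rotE : (\int[nu]_z (normc (rot k z))%:E = I)%E.
  rewrite (integral_bnu_rot la1 i (t k) (f := fun z => (normc (F z))%:E))//; first exact: mN.
  by move=> z; rewrite lee_fin normc_ge0.
have sumE : (\int[nu]_z f k z + dist1 la1 i (t k) F = 2%:E * I)%E.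
  rewrite -ge0_integralD//; last 2 first.
  - by move=> z _; rewrite lee_fin normc_ge0.
  - by apply/measurable_EFinP/measurable_normc; exact: (mD k).
  transitivity (\int[nu]_z ((normc (rot k z))%:E + (normc (F z))%:E))%E.
    by apply: eq_integral => z _; rewrite -!EFinD; congr EFin; rewrite subrK.
  rewrite ge0_integralD//.
  - by rewrite rotE (_ : 2%:E = 1 + 1)%E// ge0_muleDl// mul1e.
  - by move=> z _; rewrite lee_fin normc_ge0.
  - exact: mN.
  - by move=> z _; rewrite lee_fin normc_ge0.
  - exact: mN.
have [_ ek] := ht k.
rewrite -sumE leeBrDr//; apply: leeD => //; exact: ltW.
Unshelve. all: by end_near.
Qed.

Lemma bergman_rotation_regular F : bergman_space la F -> rotation_regular la1 F.
Proof.
move=> bF; have [_ dF _] := bF; have mF := bergman_measurable bF.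
have F0 z : ~ B z -> F z = 0 := bergman_out bF.
have tF : locally_tame F by split => // z Bz; exact: polydisc_bounded.
split => //; first exact: bergman_cintegrable.
- by move=> i; apply: cintegrable_rot_continuous => //; exact: bergman_cintegrable.
- by move=> i; exact: tame_radial_holomorphic.
Qed.

End bergman_functions.

(** The first-order expansion of [f] at [x] is also one of [g], and [diff_unique] identifies the
    differentials. This moves differentiability from a function to its restriction to the ball. *)
Lemma differentiable_near_eq (K : numFieldType) (V W : normedModType K) (f g : V -> W) (x : V) :
  (\forall y \near x, f y = g y) -> differentiable f x -> differentiable g x.
Proof.
move=> fg /diff_locallyP[cf /eqaddoP ef].
have eg : g \o shift x = cst (g x) + 'd f x +o_ (0 : V) id.
  apply/eqaddoP => e e0; have := ef e e0.
  have fgx : f x = g x by exact: (nbhs_singleton fg).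
  have fg0 : \forall y \near (0 : V), f (y + x) = g (y + x).
    by move: fg; rewrite (near_shift 0) subr0.
  move=> h; apply: filterS2 fg0 h => y /= E; by rewrite !fctE /= E fgx.
have dgf := diff_unique cf eg.
by apply/diff_locallyP; rewrite dgf.
Qed.

(** * Monomials and Toeplitz operators *)

Section monomials.
Context {R : realType} (n : nat).
Local Notation V := 'cV[R[i]]_n.
Local Notation B := (Bn R n).
Implicit Types (z : V) (p : 'I_n -> nat).

Lemma ball_coord_close z : B z -> exists2 d : R, 0 < d & forall z', coord_close d z z' -> B z'.
Proof.
(* Since [|z_i| <= 1] and [d <= 1], a squared modulus grows by at most [2 d + d^2 <= 3 d]; the [n]
   increments stay strictly below [d K <= 1 - |z|^2]. *)
move=> Bz; pose K : R := 3 * n%:R + 1.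
have K0 : 0 < K by rewrite ltr_wpDl// mulr_ge0.
have s1 : 0 < 1 - sqnorm z by rewrite subr_gt0.
pose d := Num.min 1 ((1 - sqnorm z) / K).
have d0 : 0 < d by rewrite lt_min ltr01 divr_gt0.
have d1 : d <= 1 by rewrite ge_min lexx.
have dK : d * K <= 1 - sqnorm z by rewrite -ler_pdivlMr// ge_min lexx orbT.
have zn i : normc (z i 0) <= 1.
  have /ltW := Bz; rewrite /Bn/= /sqnorm (bigD1 i)//= => h.
  rewrite -[leRHS]ger0_norm// -ler_sqr ?nnegrE ?normc_ge0// normr1 expr1n.
  by apply: le_trans h; rewrite lerDl; apply: sumr_ge0 => *; exact: sqr_ge0.
exists d => // z' zz'; rewrite /Bn/=.
apply: (@le_lt_trans _ _ (\sum_(i < n) (normc (z i 0) ^+ 2 + 3 * d))); last first.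
  rewrite big_split/= sumr_const card_ord -[(3 * d) *+ n]mulr_natr -/(sqnorm z).
  have : d * K = 3 * d * n%:R + d by rewrite /K; ring.
  lra.
apply: ler_sum => i _.
have h : normc (z' i 0) <= normc (z i 0) + d.
  rewrite -{1}(subrK (z i 0) (z' i 0)) addrC; apply: (le_trans (le_normcD _ _)).
  by rewrite lerD2l ltW.
have := normc_ge0 (z' i 0); have := normc_ge0 (z i 0); have := zn i.
set a := normc (z i 0) in h *; set b := normc (z' i 0) in h * => a1 a0 b0.
apply: (@le_trans _ _ ((a + d) ^+ 2)); first by rewrite ler_sqr ?nnegrE// addr_ge0// ltW.
nra.
Qed.

Lemma nbhs_Bn z : B z -> \forall y \near z, B y.
Proof.
move=> /ball_coord_close[d d0 hd]; apply/nbhs_ballP; exists d%:C%C; first by rewrite /= ltcR.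
move=> y [_ zy]; apply: hd => i; have := zy i 0; rewrite /ball/=.
rewrite (_ : `|_| = (normc (z i 0 - y i 0))%:C%C); last by case: (_ - _).
by rewrite ltcR normcB.
Qed.

Lemma differentiable_ball_restrict (f : V -> R[i]) z : B z -> differentiable f z ->
  differentiable (ball_restrict f) z.
Proof.
move=> Bz; apply: differentiable_near_eq.
by apply: filterS (nbhs_Bn Bz) => y By; rewrite ball_restrict_in.
Qed.

Lemma differentiable_prod_expr (g : 'I_n -> V -> R[i]) p z :
  (forall i, differentiable (g i) z) -> differentiable (fun z => \prod_i g i z ^+ p i) z.
Proof.
move=> dg; have dX i k : differentiable (fun z : V => g i z ^+ k) z.
  elim: k => [|k IH]; first by under eq_fun do rewrite expr0; exact: differentiable_cst.
  under eq_fun do rewrite exprS.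
  exact: (differentiableM (dg i) IH).
elim: (index_enum _) => [|i s IH].
  by under eq_fun do rewrite big_nil; exact: differentiable_cst.
by under eq_fun do rewrite big_cons; exact: (differentiableM (dX i (p i)) IH).
Qed.

Lemma differentiable_mono p z : differentiable (mono p) z.
Proof. by apply: differentiable_prod_expr => i; exact: differentiable_coord. Qed.

Lemma differentiable_mono_mulmx (A : 'M[R[i]]_n) p z : differentiable (fun z => mono p (A *m z)) z.
Proof.
apply: differentiable_prod_expr => i; under eq_fun do rewrite mxE.
elim: (index_enum _) => [|j s IH].
  by under eq_fun do rewrite big_nil; exact: differentiable_cst.
under eq_fun do rewrite big_cons; apply: differentiableD IH.
by apply: differentiableM; [exact: differentiable_cst|exact: differentiable_coord].
Qed.

Lemma measurable_mono p : measurable_fun setT (mono p : V -> R[i]).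
Proof.
by apply: measurable_cprod => i; apply: measurable_cX; exact: measurable_coord.
Qed.

Lemma normc_mono p z : B z -> normc (mono p z) <= 1.
Proof.
move=> Bz; rewrite normc_prod; apply: prodr_ile1 => i _; rewrite normc_ge0/= normcX.
apply: exprn_ile1; first exact: normc_ge0.
have /ltW := Bz; rewrite /Bn/= /sqnorm (bigD1 i)//= => h.
rewrite -[leRHS]ger0_norm// -ler_sqr ?nnegrE ?normc_ge0// normr1 expr1n.
by apply: le_trans h; rewrite lerDl; apply: sumr_ge0 => *; exact: sqr_ge0.
Qed.

End monomials.

(** * Computing a Toeplitz operator by testing against monomials *)

Section toeplitz_characterization.
Context {R : realType} (n : nat) (la : R).
Hypothesis la1 : -1 < la.
Local Notation V := 'cV[R[i]]_n.
Local Notation B := (Bn R n).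
Local Notation nu := (@bnu R n la la1).
Local Notation e p := (ball_restrict (mono p) : V -> R[i]).
Implicit Types (f g h : V -> R[i]) (z : V) (p : 'I_n -> nat).

Lemma measurable_e p : measurable_fun setT (e p).
Proof. by apply: measurable_ball_restrict; apply: measurable_funTS; exact: measurable_mono. Qed.

Lemma normc_e p z : normc (e p z) <= 1.
Proof.
have [Bz|nBz] := pselect (B z); first by rewrite ball_restrict_in// normc_mono.
by rewrite ball_restrict_out// normc0.
Qed.

Lemma bergman_bounded f (K : R) : measurable_fun setT f -> (forall z, normc (f z) <= K) ->
  (forall z, ~ B z -> f z = 0) -> (forall z, B z -> differentiable f z) -> bergman_space la f.
Proof.
move=> mf fK f0 df; split => //.
  apply/funext => z; have [Bz|nBz] := pselect (B z); first by rewrite ball_restrict_in.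
  by rewrite ball_restrict_out// f0.
apply/(L2_bnu la1 mf); apply: (@le_lt_trans _ _ (\int[nu]_z (K ^+ 2)%:E)%E).
  apply: ge0_le_integral => //.
  - by move=> z _; rewrite lee_fin sqr_ge0.
  - exact/measurable_EFinP/measurable_sqr_normc.
  - by move=> z _; rewrite lee_fin ler_sqr ?nnegrE ?normc_ge0// (le_trans (normc_ge0 (f z))).
rewrite integral_cst//; apply: lte_mul_pinfty => //; first by rewrite lee_fin sqr_ge0.
exact: fin_num_fun_lty.
Qed.

Lemma bergman_polynomial D (c : 'I_D -> R[i]) (p : 'I_D -> 'I_n -> nat) :
  bergman_space la (fun z => \sum_x c x * e (p x) z).
Proof.
apply: (@bergman_bounded _ (\sum_x normc (c x))).
- by apply: measurable_csum => x; apply: measurable_cM => //; exact: measurable_e.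
- move=> z; apply: (le_trans (le_normc_sum _ _ _)); apply: ler_sum => x _.
  by rewrite normcM ler_piMr ?normc_ge0// normc_e.
- by move=> z nB; apply: big1 => x _; rewrite ball_restrict_out ?mulr0.
move=> z Bz; elim: (index_enum _) => [|x s IH].
  by under eq_fun do rewrite big_nil; exact: differentiable_cst.
under eq_fun do rewrite big_cons; apply: differentiableD IH.
apply: differentiableM; first exact: differentiable_cst.
exact: (differentiable_ball_restrict Bz (differentiable_mono _ _)).
Qed.

Lemma bergman_e p : bergman_space la (e p).
Proof.
have := @bergman_polynomial 1 (fun=> 1) (fun=> p).
by under [fun _ => _]funext do rewrite big_ord1 mul1r.
Qed.

(** Around a point where [f] does not vanish, continuity keeps [|f|] above half its value on a small
    cube inside the ball, and this cube has positive weighted measure. *)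
Lemma square_integral_eq0 f : measurable_fun setT f ->
  (forall z, B z -> forall r : R, 0 < r -> exists2 d : R, 0 < d &
     forall z', coord_close d z z' -> normc (f z' - f z) <= r) ->
  (\int[nu]_z (normc (f z) ^+ 2)%:E = 0)%E -> forall z, B z -> f z = 0.
Proof.
move=> mf cf I0 z Bz; apply/eqP/negPn/negP => fz0.
have n0 : 0 < normc (f z) by rewrite normc_gt0.
have n2 : 0 < normc (f z) / 2 by rewrite divr_gt0.
have [d d0 hd] := cf z Bz _ n2; have [d' d'0 hd'] := ball_coord_close Bz.
pose r := Num.min d d' / 2.
have m0 : 0 < Num.min d d' by rewrite lt_min d0.
have r0 : 0 < r by rewrite divr_gt0.
pose U : set V := (fun v => v + (- z)) @^-1` (box r).
have Uclose v : U v -> coord_close (Num.min d d') z v.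
  move=> Uv i; have [] := Uv i; rewrite !mxE => h1 h2.
  apply: (le_lt_trans (normc_le_ReIm _)); rewrite (splitr (Num.min d d')) -/r.
  exact: ltrD.
have mU : measurable U.
  rewrite -[U]setTI; apply: (measurable_addmx (f := id) (g := fun=> - z)) => //; exact: measurable_box.
have UB : U `<=` B.
  by move=> v /Uclose h; apply: hd' => i; apply: lt_le_trans (h i) _; rewrite ge_min lexx orbT.
have U0 : (0 < leb U)%E.
  by rewrite leb_translation ?leb_box// ?lte_fin ?exprn_gt0// ?pmulrn_lgt0//; exact: measurable_box.
have := bnu_gt0 la1 mU UB U0.
have Uf v : U v -> normc (f z) / 2 <= normc (f v).
  move=> Uv; have h1 : normc (f v - f z) <= normc (f z) / 2.
    by apply: hd => i; apply: lt_le_trans (Uclose v Uv i) _; rewrite ge_min lexx.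
  have := le_normcD (f z - f v) (f v); rewrite subrK normcB => h2; lra.
apply/negP; rewrite -leNgt.
set c := (normc (f z) / 2) ^+ 2; have c0 : 0 < c by rewrite exprn_gt0.
suff : (c%:E * nu U <= 0)%E by rewrite pmule_rle0// lte_fin.
rewrite -I0; apply: (@le_trans _ _ (\int[nu]_v (c%:E * (\1_U v)%:E))%E).
  rewrite ge0_integralZl//; last by rewrite lee_fin ltW.
    by rewrite integral_indic// setIT.
  by apply/measurable_EFinP; exact: measurable_indic.
apply: ge0_le_integral => //.
- by move=> v _; rewrite -EFinM lee_fin mulr_ge0// ltW.
- by apply: measurable_funeM; apply/measurable_EFinP; exact: measurable_indic.
- exact/measurable_EFinP/measurable_sqr_normc.
- move=> v _; rewrite -EFinM lee_fin indicE.
  have [/set_mem Uv|_] := boolP (v \in U); last by rewrite mulr0 sqr_ge0.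
  by rewrite mulr1 ler_sqr ?nnegrE ?normc_ge0// ?(ltW n2)//; exact: Uf.
Qed.

Lemma cintegrable_square_product f g : measurable_fun setT f -> measurable_fun setT g ->
  (\int[nu]_z (normc (f z) ^+ 2)%:E < +oo)%E -> (\int[nu]_z (normc (g z) ^+ 2)%:E < +oo)%E ->
  cintegrable nu (fun z => f z * conjc (g z)).
Proof.
move=> mf mg f2 g2; have mfg : measurable_fun setT (fun z => f z * conjc (g z)).
  by apply: measurable_cM => //; exact: measurable_cJ.
have m2 h : measurable_fun setT h -> measurable_fun setT (fun z => (normc (h z) ^+ 2)%:E).
  by move=> mh; exact/measurable_EFinP/measurable_sqr_normc.
split => //; apply: (@le_lt_trans _ _ (\int[nu]_z ((normc (f z) ^+ 2)%:E + (normc (g z) ^+ 2)%:E))%E).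
  apply: ge0_le_integral => //.
  - by move=> z _; rewrite lee_fin normc_ge0.
  - exact/measurable_EFinP/measurable_normc.
  - by apply: emeasurable_funD; exact: m2.
  - move=> z _; rewrite -EFinD lee_fin normcM normcJ.
    have := sqr_ge0 (normc (f z) - normc (g z)); have := normc_ge0 (f z); have := normc_ge0 (g z); nra.
rewrite ge0_integralD//; try (by move=> z _; rewrite lee_fin sqr_ge0); try exact: m2.
exact: lte_add_pinfty.
Qed.

(** Testing against [g] and against [h] makes [g - h] orthogonal to itself; by continuity it
    vanishes on the ball, and off the ball both functions are 0. *)
Lemma bergman_ext g h : bergman_space la g -> bergman_space la h ->
  (forall k, bergman_space la k -> Cint nu (fun z => (g z - h z) * conjc (k z)) = 0) -> g = h.
Proof.
move=> bg bh gh; have mg := bergman_measurable bg; have mh := bergman_measurable bh.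
have mgh : measurable_fun setT (fun z => g z - h z) by apply: measurable_cD => //; exact: measurable_cN.
have ci k l : bergman_space la k -> bergman_space la l -> cintegrable nu (fun z => k z * conjc (l z)).
  by move=> bk bl; exact: (cintegrable_square_product (bergman_measurable bk) (bergman_measurable bl) (bergman_square la1 bk) (bergman_square la1 bl)).
have cig k : bergman_space la k -> cintegrable nu (fun z => (g z - h z) * conjc (k z)).
  by move=> bk; under eq_fun do rewrite mulrBl; apply: cintegrableB; exact: ci.
have I0 : Cint nu (fun z => (g z - h z) * conjc (g z - h z)) = 0.
  under eq_Cint do rewrite rmorphB mulrBr.
  by rewrite CintB ?gh ?subr0//; exact: cig.
have E0 : (\int[nu]_z (normc (g z - h z) ^+ 2)%:E = 0)%E.
  have c2 : cintegrable nu (fun z => (g z - h z) * conjc (g z - h z)).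
    by under eq_fun do rewrite rmorphB mulrBr; apply: cintegrableB; exact: cig.
  have fin : (\int[nu]_z (normc (g z - h z) ^+ 2)%:E)%E \is a fin_num.
    rewrite ge0_fin_numE; last by apply: integral_ge0 => z _; rewrite lee_fin sqr_ge0.
    by case: c2 => _; under eq_integral do rewrite normcM normcJ -expr2.
  rewrite -(fineK fin); congr EFin; move/(congr1 cRe): I0 => /= <-.
  by apply: eq_Rintegral => z _; rewrite mulcJ.
apply/funext => z; have [Bz|nBz] := pselect (B z); last by rewrite (bergman_out bg nBz) (bergman_out bh nBz).
apply/eqP; rewrite -subr_eq0; apply/eqP.
apply: (square_integral_eq0 mgh _ E0 Bz) => {Bz}z Bz r r0.
have [_ dg _] := bg; have [_ dh _] := bh.
have r2 : 0 < r / 2 by rewrite divr_gt0.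
have [d d0 hd] := differentiable_coord_close (dg z Bz) r2.
have [d' d'0 hd'] := differentiable_coord_close (dh z Bz) r2.
exists (Num.min d d'); first by rewrite lt_min d0.
move=> z' zz'; have {}hd := hd z' (fun j => _); have {}hd' := hd' z' (fun j => _).
have -> : g z' - h z' - (g z - h z) = (g z' - g z) + (h z - h z') by ring.
apply: (le_trans (le_normcD _ _)); rewrite [normc (h z - _)]normcB (splitr r); apply: lerD.
  by apply: hd => j; apply: lt_le_trans (zz' j) _; rewrite ge_min lexx.
by apply: hd' => j; apply: lt_le_trans (zz' j) _; rewrite ge_min lexx orbT.
Qed.

(** Values above the essential bound, and values off the ball, are replaced by 0. A bound at every
    point is what makes the integrals over group orbits finite. *)
Lemma bounded_representative (a : V -> R[i]) : Linfty a -> exists a' : V -> R[i],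
  [/\ measurable_fun setT a', exists M : R, forall z, normc (a' z) <= M,
      forall z, ~ B z -> a' z = 0 & {ae lebesgue_Cn R n, forall z, B z -> a z = a' z}].
Proof.
move=> [ma [M hM]]; have m1 := measurable_ball_restrict ma.
exists (fun z => if normc (ball_restrict a z) <= M then ball_restrict a z else 0); split.
- apply: measurable_fun_ifT => //.
  by apply: measurable_fun_ler => //; exact: measurable_normc.
- by exists (Num.max M 0) => z; case: ifP => h; rewrite le_max ?h// normc0 lexx orbT.
- by move=> z nB; rewrite ball_restrict_out// if_same.
- by apply: filterS hM => z h Bz; rewrite ball_restrict_in// h.
Qed.

Lemma inner_ae f g h : measurable_fun B f -> measurable_fun setT g -> measurable_fun setT h ->
  {ae lebesgue_Cn R n, forall z, B z -> f z = g z} -> inner la f h = inner la g h.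
Proof.
move=> mf mg mh fg.
have m1 := measurable_ball_restrict mf.
have E k : inner la k h = inner la (ball_restrict k) h.
  by apply: complexP; apply: eq_Rintegral => z /set_mem Bz; rewrite ball_restrict_in.
rewrite E !inner_bnu//; apply: ae_eq_Cint.
- by apply: measurable_cM => //; exact: measurable_cJ.
- by apply: measurable_cM => //; exact: measurable_cJ.
have := ae_bnu la1 fg; apply: filterS2 (ae_bnu_ball n la1) => z Bz /(_ Bz) <-.
by rewrite ball_restrict_in.
Qed.

(** The choice made in [bergman_proj] is resolved by uniqueness ([bergman_ext]). Since [a' phi - g]
    is bounded, [totality] extends its orthogonality from the monomials to every Bergman
    function. *)
Lemma toeplitz_eq (a a' phi g : V -> R[i]) (M K L : R) :
  measurable_fun B a -> {ae lebesgue_Cn R n, forall z, B z -> a z = a' z} ->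
  measurable_fun setT a' -> (forall z, normc (a' z) <= M) ->
  measurable_fun setT phi -> (forall z, normc (phi z) <= K) ->
  bergman_space la g -> (forall z, normc (g z) <= L) ->
  (forall p, Cint nu (fun z => (a' z * phi z - g z) * conjc (e p z)) = 0) ->
  toeplitz la a phi = g.
Proof.
move=> ma aa' ma' aM mphi phiK bg gL hp; have mg := bergman_measurable bg.
have mB : measurable B by exact: measurable_Bn.
pose b z := a' z * phi z.
have mb : measurable_fun setT b by exact: measurable_cM.
have innerE h k : bergman_space la k -> bergman_space la h ->
    inner la ((fun z => a z * phi z) - k) h = Cint nu (fun z => (b z - k z) * conjc (h z)).
  move=> bk bh; have mk := bergman_measurable bk; have mh := bergman_measurable bh.
  have mbk : measurable_fun setT (fun z => b z - k z).
    by apply: measurable_cD => //; exact: measurable_cN.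
  rewrite -inner_bnu//; apply: inner_ae => //; last first.
    by apply: filterS aa' => z h1 Bz; rewrite /b -h1.
  apply: (@eq_measurable_fun _ _ _ _ _ (fun z => ball_restrict a z * phi z - k z)).
    by move=> z /set_mem Bz; rewrite ball_restrict_in.
  apply: measurable_funTS; apply: measurable_cD; last exact: measurable_cN.
  by apply: measurable_cM => //; exact: measurable_ball_restrict.
have cb k h : bergman_space la k -> bergman_space la h -> cintegrable nu (fun z => (b z - k z) * conjc (h z)).
  move=> bk bh; under eq_fun do rewrite mulrBl; apply: cintegrableB.
    rewrite /b; apply: (@cintegrableM _ _ _ nu (fun z => conjc (h z)) b (M * K)) => //.
      by move=> z; rewrite normcM ler_pM ?normc_ge0.
    by apply: cintegrableJ; exact: bergman_cintegrable.
  exact: (cintegrable_square_product (bergman_measurable bk) (bergman_measurable bh) (bergman_square la1 bk) (bergman_square la1 bh)).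
have gP h : bergman_space la h -> Cint nu (fun z => (b z - g z) * conjc (h z)) = 0.
  (* [totality] pairs without conjugation, so the whole pairing is conjugated. *)
  move=> bh; pose u z := conjc (b z - g z).
  have mu : measurable_fun setT u.
    by apply: measurable_cJ; apply: measurable_cD => //; exact: measurable_cN.
  have uK z : normc (u z) <= M * K + L.
    rewrite normcJ; apply: (le_trans (le_normcD _ _)); rewrite normcN lerD// normcM.
    by rewrite ler_pM ?normc_ge0.
  have E k : bergman_space la k -> Cint nu (fun z => u z * k z) = conjc (Cint nu (fun z => (b z - g z) * conjc (k z))).
    move=> bk; rewrite -CintJ; last exact: cb.
    by apply: eq_Cint => z; rewrite rmorphM /= conjcK.
  rewrite -[LHS]conjcK -E// (_ : Cint nu _ = 0) ?conjc0//.
  apply: (totality mu uK); last exact: bergman_rotation_regular.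
  by move=> p; rewrite E ?hp ?conjc0//; exact: bergman_e.
rewrite /toeplitz /bergman_proj; apply: xget_unique.
  by split => // h bh; rewrite innerE// gP.
move=> g' [bg' hg']; apply: bergman_ext => // h bh.
have := hg' h bh; rewrite innerE// => E'.
transitivity (Cint nu (fun z => (b z - g z) * conjc (h z)) - Cint nu (fun z => (b z - g' z) * conjc (h z))).
  by rewrite -CintB; [apply: eq_Cint => z; ring|exact: cb|exact: cb].
by rewrite gP// E' subrr.
Qed.

End toeplitz_characterization.

(** With [d = |p - q|], the number [w = e^(i pi / d)] satisfies [w^d = -1]. The value [-1] turns
    separation of exponents into a change of sign of an integrand, hence into a vanishing
    integral. *)
Lemma separating_unimodular {R : realType} (p q : nat) : p != q ->
  exists2 w : R[i], normc w = 1 & w ^+ p * conjc (w ^+ q) = -1.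
Proof.
move=> pq; pose d := (maxn p q - minn p q)%N; pose w : R[i] := ce (pi / d%:R).
have d0 : d%:R != 0 :> R by rewrite pnatr_eq0 /d; lia.
have wd : w ^+ d = -1 by rewrite /w ceX mulrC divfK// ce_pi.
have w1 : normc w = 1 by rewrite normc_ce.
have wJ r : w ^+ r * conjc (w ^+ r) = 1 by rewrite mulcJ normcX w1 !expr1n.
exists w => //; have [qp|pq'] := leqP q p.
  have -> : p = (d + q)%N by rewrite /d; lia.
  by rewrite exprD -mulrA wJ mulr1.
have -> : q = (d + p)%N by rewrite /d; lia.
by rewrite exprD rmorphM mulrCA wJ mulr1 wd rmorphN rmorph1.
Qed.

Lemma separating_torus {R : realType} n (p q : 'I_n -> nat) : p <> q ->
  exists2 w : 'I_n -> R[i], forall i, normc (w i) = 1 &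
  (\prod_i w i ^+ p i) * conjc (\prod_i w i ^+ q i) = -1.
Proof.
move=> pq; have [i pqi] : exists i, p i != q i.
  apply: contrapT => h; apply: pq; apply/funext => i; apply/eqP/negPn/negP => pqi.
  by apply: h; exists i.
have [w0 w01 w0E] := @separating_unimodular R _ _ pqi.
pose w j := if j == i then w0 else 1 : R[i].
have wE r : \prod_j w j ^+ r j = w0 ^+ r i.
  rewrite (bigD1 i)//= {1}/w eqxx big1 ?mulr1// => j /negbTE ji.
  by rewrite /w ji expr1n.
by exists w => [j|]; [rewrite /w; case: ifP => // _; rewrite normc1|rewrite !wE].
Qed.

(** * Orthogonality of the monomials *)

Section torus_orthogonality.
Context {R : realType} (n : nat) (la : R).
Hypothesis la1 : -1 < la.
Local Notation V := 'cV[R[i]]_n.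
Local Notation B := (Bn R n).
Local Notation nu := (@bnu R n la la1).
Local Notation e p := (ball_restrict (mono p) : V -> R[i]).
Implicit Types (f g h : V -> R[i]) (z : V) (p q : 'I_n -> nat) (w : 'I_n -> R[i]).

Definition dmx w : 'M[R[i]]_n := diag_mx (\row_i w i).

Lemma dmx_coord w z i : (dmx w *m z) i 0 = w i * z i 0.
Proof. by rewrite mul_diag_mx !mxE. Qed.

Lemma dmx_unitary w : (forall i, normc (w i) = 1) -> dmx w \is unitarymx.
Proof.
move=> w1; apply/unitarymxP; apply/matrixP => a b; rewrite mul_diag_mx !mxE.
have [->|ab] := eqVneq a b; last by rewrite mulr0n rmorph0 mulr0.
by rewrite ?eqxx !mulr1n [Num.conj _]/(conjc _) mulcJ w1 expr1n.
Qed.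

Lemma mono_dmx w p z : mono p (dmx w *m z) = (\prod_i w i ^+ p i) * mono p z.
Proof. by rewrite /mono -big_split; apply: eq_bigr => i _; rewrite dmx_coord exprMn. Qed.

Lemma e_dmx w p z : (forall i, normc (w i) = 1) ->
  e p (dmx w *m z) = (\prod_i w i ^+ p i) * e p z.
Proof.
move=> w1; have BU := Bn_unitary z (dmx_unitary w1).
have [Bz|nBz] := pselect (B z); first by rewrite !ball_restrict_in ?mono_dmx ?BU.
by rewrite !ball_restrict_out ?mulr0 ?BU.
Qed.

Lemma Cint_antiinvariant (U : 'M[R[i]]_n) h : U \is unitarymx -> cintegrable nu h ->
  {ae nu, forall z, h (U *m z) = - h z} -> Cint nu h = 0.
Proof.
move=> uU ch hU; have [mh _] := ch.
have mhU : measurable_fun setT (fun z => h (U *m z)).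
  by apply: (measurableT_comp mh); apply: measurable_mulmx => //; exact: measurable_cst.
have := Cint_bnu_unitary la1 uU mh.
rewrite (ae_eq_Cint mhU (measurable_cN mh) hU) CintN// => E.
apply/eqP; have : Cint nu h *+ 2 == 0 by rewrite mulr2n -{1}E addNr.
by rewrite mulrn_eq0.
Qed.

Lemma Cint_e_eq0 w h (K : R) (c : R[i]) q : measurable_fun setT h -> (forall z, normc (h z) <= K) ->
  (forall i, normc (w i) = 1) -> {ae nu, forall z, h (dmx w *m z) = c * h z} ->
  c * conjc (\prod_i w i ^+ q i) = -1 -> Cint nu (fun z => h z * conjc (e q z)) = 0.
Proof.
move=> mh hK w1 hw cw.
apply: (Cint_antiinvariant (dmx_unitary w1)).
  apply: (@cintegrable_bounded _ _ _ nu _ K).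
    by apply: measurable_cM => //; apply: measurable_cJ; exact: measurable_e.
  move=> z; rewrite normcM normcJ; apply: le_trans (hK z).
  by rewrite ler_piMr ?normc_ge0// normc_e.
apply: filterS hw => z hz; rewrite hz e_dmx// rmorphM -mulN1r -cw; ring.
Qed.

Lemma cintegrable_ee p q : cintegrable nu (fun z => e p z * conjc (e q z)).
Proof.
apply: (@cintegrable_bounded _ _ _ nu _ 1).
  by apply: measurable_cM; [|apply: measurable_cJ]; exact: measurable_e.
by move=> z; rewrite normcM normcJ mulr_ile1 ?normc_ge0 ?normc_e.
Qed.

Lemma e_orthogonal p q : p <> q -> Cint nu (fun z => e p z * conjc (e q z)) = 0.
Proof.
move=> /(@separating_torus R)[w w1 wE].
apply: (@Cint_e_eq0 w _ 1 (\prod_j w j ^+ p j)) => //.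
- exact: measurable_e.
- by move=> z; exact: normc_e.
- by apply: aeW => z; exact: e_dmx.
Qed.

Definition gram p := Cint nu (fun z => e p z * conjc (e p z)).

(** A monomial of norm 0 would vanish on the whole ball, yet it is nonzero at a point without zero
    coordinates. *)
Lemma gram_neq0 p : gram p != 0.
Proof.
apply/eqP => G0.
have I0 : (\int[nu]_z (normc (e p z) ^+ 2)%:E = 0)%E.
  have [_] := cintegrable_ee p p; under eq_integral do rewrite normcM normcJ -expr2.
  move=> fin; have {}fin : (\int[nu]_z (normc (e p z) ^+ 2)%:E)%E \is a fin_num.
    by rewrite ge0_fin_numE//; apply: integral_ge0 => z _; rewrite lee_fin sqr_ge0.
  rewrite -(fineK fin); congr EFin; move/(congr1 cRe): G0 => /= <-.
  by apply: eq_Rintegral => z _; rewrite mulcJ.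
have [r r0 rB] := @box_sub_ball R n.
pose one : V := const_mx (r / 2)%:C%C.
have r2 : 0 < r / 2 by rewrite divr_gt0.
have Bone : B one.
  apply: rB => i; rewrite mxE /= normr0 r0 ger0_norm ?(ltW r2)//; split => //.
  by rewrite ltr_pdivrMr// ltr_pMr// (ltr_nat R 1).
have := square_integral_eq0 (measurable_e p) _ I0 Bone.
have c z : B z -> forall s : R, 0 < s -> exists2 d : R, 0 < d &
    forall z', coord_close d z z' -> normc (e p z' - e p z) <= s.
  move=> Bz s s0; apply: differentiable_coord_close => //.
  exact: (differentiable_ball_restrict Bz (differentiable_mono _ _)).
move=> /(_ c)/eqP; rewrite ball_restrict_in// /mono; apply/negP.
apply/prodf_neq0 => i _; apply: expf_neq0; rewrite mxE -normc_eq0 normc_real ger0_norm ?(ltW r2)//.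
by rewrite gt_eqF.
Qed.

End torus_orthogonality.

(** * Bases and traces *)

Section finite_dimensional_trace.
Context (K : fieldType) (V : lmodType K).
Implicit Types (W : set V) (T : V -> V).

(** The row of vectors [e] times the matrix [M]; iterated combinations then correspond to matrix
    products. *)
Definition comb N p (e : 'I_N -> V) (M : 'M[K]_(N, p)) j : V := \sum_i M i j *: e i.

Lemma comb_mul N p q (e : 'I_N -> V) (M : 'M[K]_(N, p)) (P : 'M[K]_(p, q)) :
  comb (comb e M) P =1 comb e (M *m P).
Proof.
move=> j; rewrite /comb; under eq_bigr do rewrite scaler_sumr.
rewrite exchange_big; apply: eq_bigr => i _; rewrite mxE scaler_suml.
by apply: eq_bigr => l _; rewrite scalerA mulrC.
Qed.

Lemma comb1 N (e : 'I_N -> V) : comb e 1%:M =1 e.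
Proof.
move=> j; rewrite /comb (bigD1 j)//= mxE eqxx scale1r big1 ?addr0// => i ij.
by rewrite mxE (negbTE ij) scale0r.
Qed.

Lemma eq_comb N p (e f : 'I_N -> V) (M : 'M[K]_(N, p)) : e =1 f -> comb e M =1 comb f M.
Proof. by move=> ef j; apply: eq_bigr => i _; rewrite ef. Qed.

Lemma lin_span_range N (e : 'I_N -> V) x : lin_span (range e) x <->
  exists c : 'I_N -> K, x = \sum_i c i *: e i.
Proof.
split=> [[N0 [c [s [hs ->]]]]|[c ->]]; last by exists N, c, e; split => // i; exists i.
have /choice[f hf] (i : 'I_N0) : exists j, e j = s i by have [j _ <-] := hs i; exists j.
exists (fun j => \sum_(i | f i == j) c i).
rewrite (partition_big f predT)//=; apply: eq_bigr => j _.
by rewrite scaler_suml; apply: eq_bigr => i /eqP <-; rewrite hf.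
Qed.

Lemma lin_span_comb N N' (e : 'I_N -> V) (f : 'I_N' -> V) :
  (forall j, lin_span (range e) (f j)) -> exists P : 'M[K]_(N, N'), f =1 comb e P.
Proof.
move=> h; have /choice[c hc] j : exists c : 'I_N -> K, f j = \sum_i c i *: e i.
  by apply/lin_span_range.
by exists (\matrix_(i, j) c j i) => j; rewrite hc; apply: eq_bigr => i _; rewrite mxE.
Qed.

Lemma basis_in W N (e : 'I_N -> V) j : is_basis W e -> W (e j).
Proof. by move=> [_ <-]; exists 1%N, (fun=> 1), (fun=> e j); split => [|]; [exists j|rewrite big_ord1 scale1r]. Qed.

Lemma basis_inj W N p (e : 'I_N -> V) (M P : 'M[K]_(N, p)) : is_basis W e ->
  comb e M =1 comb e P -> M = P.
Proof.
move=> [fe _] MP; apply/matrixP => i j; apply/eqP; rewrite -subr_eq0; apply/eqP.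
apply: (fe (fun i => M i j - P i j)).
under eq_bigr do rewrite scalerBl; rewrite big_split/= sumrN.
by have := MP j; rewrite /comb => ->; rewrite subrr.
Qed.

Lemma basis_change W N N' (e : 'I_N -> V) (f : 'I_N' -> V) : is_basis W e -> is_basis W f ->
  exists (P : 'M[K]_(N, N')) (Q : 'M[K]_(N', N)), [/\ f =1 comb e P, P *m Q = 1%:M & Q *m P = 1%:M].
Proof.
move=> be bf.
have [P hP] : exists P : 'M[K]_(N, N'), f =1 comb e P.
  by apply: lin_span_comb => j; rewrite be.2; exact: (basis_in j bf).
have [Q hQ] : exists Q : 'M[K]_(N', N), e =1 comb f Q.
  by apply: lin_span_comb => j; rewrite bf.2; exact: (basis_in j be).
exists P, Q; split => //.
  by apply: (basis_inj be) => j; rewrite -comb_mul -(eq_comb _ hP) -hQ comb1.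
by apply: (basis_inj bf) => j; rewrite -comb_mul -(eq_comb _ hQ) -hP comb1.
Qed.

Lemma fin_dim_basis W N (e : 'I_N -> V) : is_basis W e -> fin_dim W = N.
Proof.
move=> be; apply: xget_unique; first by exists e.
move=> N' [f bf]; have [P [Q [_ PQ QP]]] := basis_change be bf.
by apply/eqP; rewrite eqn_leq (mulmx1_min PQ) (mulmx1_min QP).
Qed.

(** [trace_on] ranges over all bases, so its value is settled by invariance of the trace under a
    change of basis. Linearity is assumed on combinations of [e], the form in which it is proved for
    [toeplitz]. *)
Lemma trace_on_basis W T N (e : 'I_N -> V) (M : 'M[K]_N) : is_basis W e ->
  (forall c : 'I_N -> K, T (\sum_j c j *: e j) = \sum_j c j *: T (e j)) ->
  (forall j, T (e j) = comb e M j) -> trace_on W T = \tr M.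
Proof.
move=> be Tlin Te; apply: xget_unique; first by exists N, e, M.
move=> t [N' [f [M' [bf Tf ->]]]].
have [P [Q [hP PQ QP]]] := basis_change be bf.
have MP : M *m P = P *m M'.
  apply: (basis_inj be) => j; rewrite -!comb_mul -(eq_comb _ hP).
  rewrite [RHS]/comb -Tf hP /comb Tlin; apply: eq_bigr => i _.
  by rewrite Te.
by rewrite -[M']mul1mx -QP -mulmxA mxtrace_mulC -MP -mulmxA PQ mulmx1.
Qed.

Lemma scalar_on_eq W T c x : W x -> x != 0 -> (forall y, W y -> T y = c *: y) ->
  scalar_on W T = c.
Proof.
move=> Wx x0 Tc; apply: xget_unique => // d Td.
have : (d - c) *: x == 0 by rewrite scalerBl -Td// -Tc// subrr.
by rewrite scaler_eq0 (negbTE x0) orbF subr_eq0 => /eqP.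
Qed.

End finite_dimensional_trace.

(** * Block degrees and block unitary matrices *)

Section multidegree.
Context {n m : nat} (blk : 'I_n -> 'I_m).
Implicit Types (kappa : 'I_m -> nat) (p : 'I_n -> nat).

Definition has_degree kappa p := forall j, (\sum_(a | blk a == j) p a)%N = kappa j.

(** An exponent of block degrees [kappa] has entries at most [N], the total degree, so these
    exponents are finitely many and are enumerated as finite functions into ['I_N.+1]. *)
Lemma exponents kappa : exists (D : nat) (ex : 'I_D -> 'I_n -> nat), injective ex /\
  forall p, has_degree kappa p <-> exists x, p = ex x.
Proof.
pose N := (\sum_j kappa j)%N.
pose P := [pred f : {ffun 'I_n -> 'I_N.+1} |
  [forall j, (\sum_(a | blk a == j) f a)%N == kappa j]].
exists #|P|, (fun x i => val ((enum_val x : {ffun 'I_n -> 'I_N.+1}) i)); split.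
  move=> x y exy; apply: enum_val_inj; apply/ffunP => i; apply: val_inj.
  exact: (congr1 (@^~ i) exy).
move=> p; split=> [hp|[x ->] j]; last first.
  by have := enum_valP x; rewrite inE => /forallP /(_ j)/eqP.
have pN a : (p a < N.+1)%N.
  rewrite ltnS; apply: (@leq_trans (kappa (blk a))).
    by rewrite -hp (bigD1 a)//= leq_addr.
  by rewrite /N (bigD1 (blk a))//= leq_addr.
pose f : {ffun 'I_n -> 'I_N.+1} := [ffun a => Ordinal (pN a)].
have Pf : f \in P.
  rewrite inE; apply/forallP => j; rewrite -hp; apply/eqP.
  by apply: eq_bigr => a _; rewrite ffunE.
by exists (enum_rank_in Pf f); apply/funext => a; rewrite enum_rankK_in// ffunE.
Qed.

Lemma prod_degree (A : comNzRingType) (t : 'I_m -> A) kappa p : has_degree kappa p ->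
  \prod_a t (blk a) ^+ p a = \prod_j t j ^+ kappa j.
Proof.
move=> hp; rewrite (partition_big blk predT)//=.
apply: eq_bigr => j _; rewrite -hp -prodrXr.
by apply: eq_bigr => a /eqP ->.
Qed.

End multidegree.

(** Passes from the pairs (block, position) used in [Pk] to coordinates with their block map
    [tagnat.sig1], the form used in [has_degree]. *)
Lemma sum_block m (k : 'I_m -> nat) (F : 'I_(\sum_j k j) -> nat) j :
  (\sum_(i < k j) F (tagnat.Rank j i) = \sum_(a | tagnat.sig1 a == j) F a)%N.
Proof.
rewrite -[LHS](big_pred1_eq addn j (fun j' => \sum_(i < k j') F (tagnat.Rank j' i))%N).
rewrite sig_big_dep/= [RHS](reindex (@tagnat.rank m k)) /=; last first.
  by exists (@tagnat.sig m k) => x _; [exact: tagnat.rankK|exact: tagnat.sigK].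
apply: eq_big => [p|p _]; last by rewrite tagnat.rankE.
by rewrite tagnat.rankE tagnat.Rank1K andbT.
Qed.

Section block_unitary.
Context {R : realType} {n m : nat} (blk : 'I_n -> 'I_m).
Local Notation V := 'cV[R[i]]_n.
Implicit Types (A C : 'M[R[i]]_n) (t : 'I_m -> R[i]) (z : V).

Definition block_diagonal A := forall a b, blk a != blk b -> A a b = 0.

(** [U(k)] described by conditions on the entries, which suits measurability and adjoints better
    than the family of blocks in [Uk]; the two agree by [UkP]. *)
Definition Ublk A := A \is unitarymx /\ block_diagonal A.

Lemma Ublk_adjoint A : Ublk A -> Ublk (A ^t*)%sesqui.
Proof.
move=> [uA bA]; split; first by rewrite trmxC_unitary.
by move=> a b ab; rewrite !mxE bA ?rmorph0// eq_sym.
Qed.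

Lemma dmx_Ublk (w : 'I_n -> R[i]) : (forall a, normc (w a) = 1) -> Ublk (dmx w).
Proof.
move=> w1; split; first exact: dmx_unitary.
move=> a b ab; rewrite !mxE; case: eqVneq => // e; by rewrite e eqxx in ab.
Qed.

Lemma block_diagonal_comm A t z : block_diagonal A ->
  A *m (dmx (fun a => t (blk a)) *m z) = dmx (fun a => t (blk a)) *m (A *m z).
Proof.
move=> bA; apply/colP => a; rewrite dmx_coord !mxE mulr_sumr; apply: eq_bigr => b _.
rewrite dmx_coord; have [->|ab] := eqVneq (blk a) (blk b); first by rewrite mulrCA.
by rewrite bA// !mul0r mulr0.
Qed.

Lemma measurable_eq_cst d (T : measurableType d) (f : T -> R[i]) c : measurable_fun setT f ->
  measurable [set x | f x = c].
Proof.
move=> mf.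
have E (g : T -> R) r : measurable_fun setT g -> measurable [set x | g x = r].
  by move=> mg; rewrite -[X in measurable X]setTI; exact: (mg measurableT [set r] (measurable_set1 r)).
rewrite (_ : [set _ | _] = [set x | cRe (f x) = cRe c] `&` [set x | cIm (f x) = cIm c]).
  by apply: measurableI; apply: E; [exact: measurable_Re|exact: measurable_Im].
by apply/seteqP; split => x /= => [->//|[h1 h2]]; exact: complexP.
Qed.

Lemma measurable_adjoint d (T : measurableType d) p q (f : T -> 'M[R[i]]_(p, q)) :
  measurable_fun setT f -> measurable_fun setT (fun x => ((f x) ^t*)%sesqui).
Proof.
move=> mf; apply: measurable_matrixP => i j; under eq_fun do rewrite !mxE.
by apply: measurable_cJ; exact: measurable_coord.
Qed.

(** Membership is a finite system of equations between measurable functions of the entries. *)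
Lemma measurable_Ublk : measurable (Ublk).
Proof.
have mid : measurable_fun setT (fun A : 'M[R[i]]_n => A) by [].
have -> : Ublk = (\bigcap_(ab in [set: 'I_n * 'I_n])
      [set A : 'M[R[i]]_n | (A *m (A ^t*)%sesqui) ab.1 ab.2 = (1%:M : 'M[R[i]]_n) ab.1 ab.2]) `&`
    (\bigcap_(ab in [set: 'I_n * 'I_n])
      [set A : 'M[R[i]]_n | (if blk ab.1 == blk ab.2 then 0 else A ab.1 ab.2) = 0]).
  apply/seteqP; split => A.
    move=> [/unitarymxP uA bA]; split => -[a b] _ /=; first by rewrite uA.
    by case: ifPn => // /bA.
  move=> [uA bA]; split.
    by apply/unitarymxP/matrixP => a b; exact: (uA (a, b) I).
  by move=> a b ab; have := bA (a, b) I; rewrite /= (negbTE ab).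
apply: measurableI; apply: fin_bigcap_measurable => // -[a b] _; apply: measurable_eq_cst => /=.
  by apply: measurable_coord; apply: measurable_mulmx => //; exact: measurable_adjoint.
by case: (blk a == blk b); [exact: measurable_cst|exact: measurable_coord].
Qed.

(* [1 - c J] with [J] the all-ones matrix of size [K] and [c = (1 - i)/K] is unitary since
   [|1 - cK| = 1], and none of its entries vanishes. *)
Lemma Ublk_nonvanishing : exists2 A, Ublk A & forall a b, blk a = blk b -> A a b != 0.
Proof.
pose K j := #|[pred x | blk x == j]|.
pose c j : R[i] := Complex (K j)%:R^-1 (- (K j)%:R^-1).
pose N : 'M[R[i]]_n := \matrix_(a, b) (if blk a == blk b then c (blk a) else 0).
have k0 (a : 'I_n) : (K (blk a))%:R != 0 :> R.
  by rewrite pnatr_eq0 -lt0n; apply/card_gt0P; exists a; rewrite inE.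
(* This identity is the unitarity of [1 - N]. Inside a block of size [K] both sides have all entries
   [2/K]: on the left [K |c|^2], on the right [2 Re c]. *)
have NN : N *m (N ^t*)%sesqui = N + (N ^t*)%sesqui.
  apply/matrixP => a b.
  have E x : N a x * (N ^t*)%sesqui x b =
      if (blk a == blk b) && (blk x == blk a) then c (blk a) * conjc (c (blk a)) else 0.
    rewrite !mxE; have [ax|ax] := eqVneq (blk a) (blk x); last first.
      by rewrite andbF mul0r.
    rewrite -ax andbT.
    by have [->|ab] := eqVneq (blk a) (blk b); rewrite // rmorph0 mulr0.
  rewrite mxE (eq_bigr _ (fun x _ => E x)) !mxE.
  have [<-|ab] := eqVneq (blk a) (blk b); last by rewrite rmorph0 addr0 big1.
  rewrite -big_mkcond sumr_const.
  rewrite -/(K (blk a)).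
  rewrite mulcJ sqr_normc [cRe _]/= [cIm _]/= sqrrN -[LHS]mulr_natr.
  have -> : (K (blk a))%:R = ((K (blk a))%:R : R)%:C%C by rewrite rmorph_nat.
  have kk := k0 a; apply: complexP; rewrite ?(cReM, cImM) /=; last by ring.
  by rewrite mulr0 subr0; field.
have uA : 1%:M - N \is unitarymx.
  apply/unitarymxP.
  rewrite raddfB /= trmx1 map_mxB map_mx1 mulmxBl mul1mx mulmxBr mulmx1 NN.
  by rewrite opprB [N + _]addrC addrK; exact: subrK.
exists (1%:M - N).
  split => // a b ab; rewrite !mxE (negbTE ab) subr0.
  by case: eqVneq => // e; rewrite e eqxx in ab.
(* The identity matrix is real, so on and off the diagonal the imaginary part of an entry of the
   block is [1/K]. *)
move=> a b ab; rewrite !mxE ab eqxx; apply/eqP => /(congr1 cIm)/=.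
have kb := k0 b; rewrite cImB (_ : cIm _ = 0); last by case: (a == b).
by rewrite /c/= opprK add0r => /eqP; rewrite invr_eq0 (negbTE kb).
Qed.

End block_unitary.

(** * The groups [Uk] and [Tm] in terms of the block map *)

Section block_partition.
Context {R : realType} {m : nat} (k : 'I_m -> nat).
Local Notation n := (\sum_j k j)%N.
Local Notation blk := (@tagnat.sig1 m k).
Implicit Types (A : 'M[R[i]]_n) (t : 'I_m -> R[i]).

Lemma mxdiag_adjoint (D : forall j, 'M[R[i]]_(k j)) :
  ((\mxdiag_(j < m) D j) ^t*)%sesqui = \mxdiag_(j < m) ((D j) ^t*)%sesqui.
Proof.
rewrite tr_mxdiag; apply/matrixP => a b; rewrite !mxE.
case: eqVneq => [e|_]; last by rewrite !mxE rmorph0.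
have := map_conform_mx Num.conj (D (blk a))^T (0 : 'M[R[i]]_(k (blk a), k (blk b))).
by rewrite map_mx0 => <-; rewrite !mxE.
Qed.

Lemma mxdiag_mul (D E : forall j, 'M[R[i]]_(k j)) :
  \mxdiag_(j < m) D j *m \mxdiag_(j < m) E j = \mxdiag_(j < m) (D j *m E j).
Proof.
rewrite {2}/mxdiag mul_mxdiag_mxblock; apply/eq_mxblock => a b.
by case: eqVneq => [->|_]; rewrite ?conform_mx_id ?mulmx0.
Qed.

Lemma mxdiag_unitary (D : forall j, 'M[R[i]]_(k j)) :
  (\mxdiag_(j < m) D j \is unitarymx) <-> forall j, D j \is unitarymx.
Proof.
split=> [/unitarymxP|h].
  rewrite mxdiag_adjoint mxdiag_mul -mxdiagZ => /eq_mxdiagP h j.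
  exact/unitarymxP.
apply/unitarymxP; rewrite mxdiag_adjoint mxdiag_mul -mxdiagZ; apply: eq_mxdiag => j.
exact/unitarymxP.
Qed.

Lemma block_diagonalE A : block_diagonal blk A -> A = \mxdiag_(j < m) submxblock A j j.
Proof.
move=> hA; rewrite -{1}[A]submxblockK; apply/eq_mxblock => i j.
have [->|ij] := eqVneq i j; first by rewrite conform_mx_id.
by apply/matrixP => a b; rewrite !mxE hA// !tagnat.Rank1K.
Qed.

Lemma UkP A : Uk R k A <-> Ublk blk A.
Proof.
split=> [[D uD ->]|[uA bA]].
  split; first exact/mxdiag_unitary.
  by move=> a b ab; rewrite mxE (negbTE ab) mxE.
exists (fun j => submxblock A j j); last exact: block_diagonalE.
by apply/mxdiag_unitary; rewrite -block_diagonalE.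
Qed.

Lemma TmP A : Tm R k A <-> exists2 t, forall j, normc (t j) = 1 & A = dmx (fun a => t (blk a)).
Proof.
have E t : \mxdiag_(j < m) ((t j)%:M : 'M[R[i]]_(k j)) = dmx (fun a => t (blk a)).
  under eq_mxdiag do rewrite -diag_const_mx; rewrite -diag_mxrow; congr diag_mx.
  by apply/rowP => a; rewrite !mxE.
by split=> -[t t1 ->]; exists t => //; move=> j; apply/normc_eq1.
Qed.

End block_partition.

(** * Toeplitz operators on a block-homogeneous part *)

Section graded_functions.
Context {R : realType} {n m : nat} (blk : 'I_n -> 'I_m) (la : R).
Hypothesis la1 : -1 < la.
Local Notation V := 'cV[R[i]]_n.
Local Notation B := (Bn R n).
Local Notation nu := (@bnu R n la la1).
Local Notation e p := (ball_restrict (mono p) : V -> R[i]).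
Variables (kappa : 'I_m -> nat) (D : nat) (ex : 'I_D -> 'I_n -> nat).
Hypotheses (ex_inj : injective ex) (exP : forall p, has_degree blk kappa p <-> exists x, p = ex x).
Implicit Types (h phi : V -> R[i]) (z : V) (p q : 'I_n -> nat) (t : 'I_m -> R[i]) (x y : 'I_D).
Local Notation b x := (e (ex x)).

(** Homogeneity of degree [kappa] under the central torus; it holds almost everywhere only, like the
    invariance of the symbol from which it comes. *)
Definition graded h := [/\ measurable_fun setT h, exists K : R, forall z, normc (h z) <= K &
  forall t, (forall j, normc (t j) = 1) ->
    {ae nu, forall z, h (dmx (fun a => t (blk a)) *m z) = (\prod_j t j ^+ kappa j) * h z}].

Lemma ex_degree x : has_degree blk kappa (ex x).
Proof. by apply/exP; exists x. Qed.

(** In a block where the degree of [q] differs from that of [kappa], a unimodular number separates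
    the two; acting by it on this block alone changes the sign of the integrand. *)
Lemma graded_orthogonal h q : graded h -> ~ has_degree blk kappa q ->
  Cint nu (fun z => h z * conjc (e q z)) = 0.
Proof.
move=> [mh [K hK] ht] nq.
pose dq j := (\sum_(a | blk a == j) q a)%N.
have [j jq] : exists j, kappa j != dq j.
  apply: contrapT => H; apply: nq => j; apply/eqP/negPn/negP => jq.
  by apply: H; exists j; rewrite eq_sym.
have [w0 w01 w0E] := @separating_unimodular R _ _ jq.
pose t j' := if j' == j then w0 else 1 : R[i].
have t1 j' : normc (t j') = 1 by rewrite /t; case: ifP => // _; rewrite normc1.
have tE (r : 'I_m -> nat) : \prod_j' t j' ^+ r j' = w0 ^+ r j.
  rewrite (bigD1 j)//= {1}/t eqxx big1 ?mulr1// => j' /negbTE jj.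
  by rewrite /t jj expr1n.
apply: (Cint_e_eq0 mh hK _ (ht t t1)) => [a|]; first exact: t1.
by rewrite (@prod_degree n m blk _ t dq)// !tE.
Qed.

Definition coef h x := Cint nu (fun z => h z * conjc (b x z)) / gram la1 (ex x).

Lemma graded_cintegrable h q : graded h -> cintegrable nu (fun z => h z * conjc (e q z)).
Proof.
move=> [mh [K hK] _]; apply: (@cintegrable_bounded _ _ _ nu _ K).
  by apply: measurable_cM => //; apply: measurable_cJ; exact: measurable_e.
move=> z; rewrite normcM normcJ; apply: le_trans (hK z).
by rewrite ler_piMr ?normc_ge0// normc_e.
Qed.

Lemma graded_projection h p : graded h ->
  Cint nu (fun z => (h z - \sum_x coef h x * b x z) * conjc (e p z)) = 0.
Proof.
move=> gh; have cs : cintegrable nu (fun z => \sum_x coef h x * (b x z * conjc (e p z))).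
  by apply: cintegrable_sum => x; apply: cintegrableZ; exact: cintegrable_ee.
transitivity (Cint nu (fun z => h z * conjc (e p z) - \sum_x coef h x * (b x z * conjc (e p z)))).
  apply: eq_Cint => z; rewrite mulrBl mulr_suml; congr (_ - _).
  by apply: eq_bigr => x _; rewrite mulrA.
rewrite CintB//; last exact: graded_cintegrable.
rewrite Cint_sum; last by move=> x; apply: cintegrableZ; exact: cintegrable_ee.
under eq_bigr do rewrite (CintZ _ (cintegrable_ee la1 _ _)).
have [/exP[y ->]|np] := pselect (has_degree blk kappa p).
  rewrite (bigD1 y)//= big1 ?addr0 => [|x xy].
    by rewrite /coef divfK ?subrr//; exact: gram_neq0.
  by rewrite e_orthogonal ?mulr0// => /ex_inj xy'; rewrite xy' eqxx in xy.
rewrite graded_orthogonal// sub0r big1 ?oppr0// => x _.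
by rewrite e_orthogonal ?mulr0// => xp; apply: np; rewrite -xp; exact: ex_degree.
Qed.

Lemma toeplitz_graded (a a' phi : V -> R[i]) (M K : R) :
  measurable_fun B a -> {ae lebesgue_Cn R n, forall z, B z -> a z = a' z} ->
  measurable_fun setT a' -> (forall z, normc (a' z) <= M) ->
  measurable_fun setT phi -> (forall z, normc (phi z) <= K) ->
  graded (fun z => a' z * phi z) ->
  toeplitz la a phi = fun z => \sum_x coef (fun z => a' z * phi z) x * b x z.
Proof.
move=> ma aa' ma' aM mphi phiK gr.
apply: (@toeplitz_eq R n la la1 a a' phi _ M K (\sum_x normc (coef (fun z => a' z * phi z) x))) => //.
- exact: bergman_polynomial.
- move=> z; apply: (le_trans (le_normc_sum _ _ _)); apply: ler_sum => x _.
  by rewrite normcM ler_piMr ?normc_ge0// normc_e.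
- by move=> p; exact: graded_projection.
Qed.

(** The Toeplitz operator with symbol 1 fixes [h], while on graded functions it is given by the
    finite sum. So a bounded graded Bergman function is a polynomial. *)
Lemma bergman_graded h z : bergman_space la h -> graded h -> h z = \sum_x coef h x * b x z.
Proof.
move=> bh gh; have [mh [K hK] _] := gh.
have E1 : toeplitz la (cst 1) h = h.
  apply: (@toeplitz_eq _ _ _ la1 _ (cst 1) _ _ 1 K K) => //.
  - exact: aeW.
  - by move=> ?; rewrite normc1.
  - by move=> p; rewrite -[RHS](Cint0 nu); apply: eq_Cint => z'; rewrite mul1r subrr mul0r.
have g1 : graded (fun z => cst 1 z * h z) by under [fun _ => _]funext do rewrite mul1r.
rewrite -{1}E1 (@toeplitz_graded (cst 1) (cst 1) h 1 K)//.
- apply: eq_bigr => x _; congr (_ / _ * _); apply: eq_Cint => y; by rewrite mul1r.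
- exact: aeW.
- by move=> ?; rewrite normc1.
Qed.

Lemma b_dmx t x z : (forall j, normc (t j) = 1) ->
  b x (dmx (fun a => t (blk a)) *m z) = (\prod_j t j ^+ kappa j) * b x z.
Proof. by move=> t1; rewrite e_dmx// (prod_degree _ (ex_degree x)). Qed.

Lemma graded_symbol (a' : V -> R[i]) (M : R) (c : 'I_D -> R[i]) : measurable_fun setT a' ->
  (forall z, normc (a' z) <= M) ->
  (forall t, (forall j, normc (t j) = 1) ->
    {ae nu, forall z, a' (dmx (fun a => t (blk a)) *m z) = a' z}) ->
  graded (fun z => a' z * \sum_x c x * b x z).
Proof.
move=> ma' aM at_; split.
- apply: measurable_cM => //; apply: measurable_csum => x; apply: measurable_cM => //.
  exact: measurable_e.
- exists (M * \sum_x normc (c x)) => z; rewrite normcM; apply: ler_pM; rewrite ?normc_ge0//.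
  apply: (le_trans (le_normc_sum _ _ _)); apply: ler_sum => x _.
  by rewrite normcM ler_piMr ?normc_ge0// normc_e.
- move=> t t1; apply: filterS (at_ t t1) => z az; rewrite az mulrCA; congr (_ * _).
  by rewrite mulr_sumr; apply: eq_bigr => x _; rewrite b_dmx// mulrCA.
Qed.

Lemma sum_fctE (c : 'I_D -> R[i]) : \sum_x c x *: (b x : V -> R[i]) = fun z => \sum_x c x * b x z.
Proof. by apply/funext => z; rewrite fct_sumE. Qed.

Definition Pdeg : set (V -> R[i]) := lin_span [set ball_restrict (mono p) | p in
  [set p | has_degree blk kappa p]].

(** Pairing a vanishing combination with [b x] leaves the coefficient of [b x] times its nonzero
    squared norm. *)
Lemma basis_Pdeg : is_basis Pdeg (fun x => b x : V -> R[i]).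
Proof.
split=> [c|]; last first.
  congr lin_span; apply/seteqP; split => f.
    by move=> [x _ <-]; exists (ex x) => //; exact: ex_degree.
  by move=> [p /exP[x ->] <-]; exists x.
rewrite sum_fctE => c0 x; apply: (mulIf (gram_neq0 la1 (ex x))); rewrite mul0r.
have := Cint_sum (mu := nu) (index_enum _) predT (F := fun y z => c y * (b y z * conjc (b x z))).
rewrite (_ : Cint nu _ = 0); last first.
  rewrite -[RHS](Cint0 nu); apply: eq_Cint => z.
  transitivity ((\sum_y c y * b y z) * conjc (b x z)).
    by rewrite mulr_suml; apply: eq_bigr => y _; rewrite mulrA.
  by rewrite (congr1 (@^~ z) c0) mul0r.
move=> -> //; last by move=> y; apply: cintegrableZ; exact: cintegrable_ee.
under eq_bigr do rewrite (CintZ _ (cintegrable_ee la1 _ _)).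
rewrite (bigD1 x)//= big1 ?addr0// => y yx.
by rewrite e_orthogonal ?mulr0// => /ex_inj yx'; rewrite yx' eqxx in yx.
Qed.

Section toeplitz_matrix.
Variables (a a' : V -> R[i]) (M : R).
Hypotheses (ma : measurable_fun B a)
  (aa' : {ae lebesgue_Cn R n, forall z, B z -> a z = a' z})
  (ma' : measurable_fun setT a') (aM : forall z, normc (a' z) <= M)
  (a't : forall t, (forall j, normc (t j) = 1) ->
    {ae nu, forall z, a' (dmx (fun a => t (blk a)) *m z) = a' z}).

Definition entry y x := Cint nu (fun z => a' z * b x z * conjc (b y z)).

Definition toeplitz_mx : 'M[R[i]]_D := \matrix_(y, x) (entry y x / gram la1 (ex y)).

Lemma cintegrable_entry p q : cintegrable nu (fun z => a' z * e p z * conjc (e q z)).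
Proof.
under eq_fun do rewrite -mulrA; apply: (cintegrableM _ aM) => //; exact: cintegrable_ee.
Qed.

(** Linearity on the span and the matrix of the operator in one computation; single basis vectors
    are the case of Kronecker coefficients. *)
Lemma toeplitz_sum (c : 'I_D -> R[i]) :
  toeplitz la a (\sum_x c x *: (b x : V -> R[i])) =
  \sum_x c x *: comb (fun y => b y : V -> R[i]) toeplitz_mx x.
Proof.
rewrite sum_fctE (@toeplitz_graded _ a' _ M (\sum_x normc (c x)))//.
- apply/funext => z; rewrite fct_sumE.
  transitivity (\sum_x \sum_y c x * toeplitz_mx y x * b y z); last first.
    apply: eq_bigr => x _; rewrite -[RHS]/(c x * comb (fun y => b y : V -> R[i]) toeplitz_mx x z) /comb fct_sumE mulr_sumr.
    by apply: eq_bigr => y _; rewrite -mulrA.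
  rewrite exchange_big; apply: eq_bigr => y _ /=; rewrite -mulr_suml; congr (_ * _).
  rewrite /coef (_ : Cint nu _ = \sum_x c x * entry y x).
    by rewrite mulr_suml; apply: eq_bigr => x _; rewrite mxE mulrA.
  transitivity (Cint nu (fun z => \sum_x c x * (a' z * b x z * conjc (b y z)))).
    apply: eq_Cint => z'; rewrite mulr_sumr mulr_suml; apply: eq_bigr => x _; ring.
  rewrite Cint_sum; last by move=> x; apply: cintegrableZ; exact: cintegrable_entry.
  by apply: eq_bigr => x _; rewrite CintZ//; exact: cintegrable_entry.
- by apply: measurable_csum => x; apply: measurable_cM => //; exact: measurable_e.
- move=> z; apply: (le_trans (le_normc_sum _ _ _)); apply: ler_sum => x _.
  by rewrite normcM ler_piMr ?normc_ge0// normc_e.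
- exact: (graded_symbol c ma' aM a't).
Qed.

Lemma toeplitz_b x : toeplitz la a (b x) = comb (fun y => b y : V -> R[i]) toeplitz_mx x.
Proof.
have := toeplitz_sum (fun y => (y == x)%:R).
rewrite (bigD1 x)//= eqxx scale1r big1 ?addr0 => [|y /negbTE ->]; last by rewrite scale0r.
by rewrite (bigD1 x)//= eqxx scale1r big1 ?addr0 => [|y /negbTE ->]; last by rewrite scale0r.
Qed.

Lemma trace_toeplitz : trace_on Pdeg (toeplitz la a) =
  \sum_x entry x x / gram la1 (ex x).
Proof.
rewrite (trace_on_basis (M := toeplitz_mx) basis_Pdeg).
- by apply: eq_bigr => x _; rewrite mxE.
- move=> c; rewrite toeplitz_sum; apply: eq_bigr => x _; by rewrite toeplitz_b.
- exact: toeplitz_b.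
Qed.

End toeplitz_matrix.
End graded_functions.

(** * The action of [U(k)] on the degree [kappa] part *)

Section block_unitary_action.
Context {R : realType} {n m : nat} (blk : 'I_n -> 'I_m) (la : R).
Hypothesis la1 : -1 < la.
Local Notation V := 'cV[R[i]]_n.
Local Notation B := (Bn R n).
Local Notation nu := (@bnu R n la la1).
Local Notation e p := (ball_restrict (mono p) : V -> R[i]).
Variables (kappa : 'I_m -> nat) (D : nat) (ex : 'I_D -> 'I_n -> nat).
Hypotheses (ex_inj : injective ex) (exP : forall p, has_degree blk kappa p <-> exists x, p = ex x).
Implicit Types (A : 'M[R[i]]_n) (z : V) (x y : 'I_D).
Local Notation b x := (e (ex x)).
Local Notation G x := (gram la1 (ex x)).

Lemma measurable_comp_mulmx A (h : V -> R[i]) : measurable_fun setT h ->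
  measurable_fun setT (fun z => h (A *m z)).
Proof.
move=> mh; apply: (measurableT_comp mh); apply: measurable_mulmx => //; exact: measurable_cst.
Qed.

Lemma bergman_e_unitary A p : A \is unitarymx -> bergman_space la (fun z => e p (A *m z)).
Proof.
move=> uA; apply: (bergman_bounded la1 (K := 1)).
- by apply: measurable_comp_mulmx; exact: measurable_e.
- by move=> z; exact: normc_e.
- by move=> z nBz; rewrite ball_restrict_out// (Bn_unitary _ uA).
move=> z Bz; have := differentiable_ball_restrict Bz (differentiable_mono_mulmx A p z).
congr (differentiable _ _); apply/funext => y; have [By|nBy] := pselect (B y).
  by rewrite !ball_restrict_in// (Bn_unitary _ uA).
by rewrite !ball_restrict_out// (Bn_unitary _ uA).
Qed.

(** Block diagonal matrices commute with the central torus, so composition with [A] keeps the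
    degree. *)
Lemma graded_b_unitary A x : Ublk blk A -> graded blk la1 kappa (fun z => b x (A *m z)).
Proof.
move=> [uA bA]; split.
- by apply: measurable_comp_mulmx; exact: measurable_e.
- by exists 1 => z; exact: normc_e.
- by move=> t t1; apply: aeW => z; rewrite (block_diagonal_comm t z bA) (b_dmx exP).
Qed.

Definition act A : 'M[R[i]]_D := \matrix_(y, x) coef la1 ex (fun z => b x (A *m z)) y.

Lemma actE A x z : Ublk blk A -> b x (A *m z) = \sum_y act A y x * b y z.
Proof.
move=> uA.
rewrite (bergman_graded ex_inj exP z (bergman_e_unitary (ex x) uA.1) (graded_b_unitary x uA)).
by apply: eq_bigr => y _; rewrite mxE.
Qed.

Definition form (a : V -> R[i]) : 'M[R[i]]_D :=
  \matrix_(x, y) Cint nu (fun z => a z * b x z * conjc (b y z)).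

Section bounded_symbol.
Variables (a : V -> R[i]) (M : R).
Hypotheses (ma : measurable_fun setT a) (aM : forall z, normc (a z) <= M).

Lemma form_sum (c d : 'I_D -> R[i]) :
  Cint nu (fun z => a z * (\sum_x c x * b x z) * conjc (\sum_y d y * b y z)) =
  \sum_x \sum_y c x * conjc (d y) * form a x y.
Proof.
have cint x y : cintegrable nu (fun z => c x * conjc (d y) * (a z * b x z * conjc (b y z))).
  by apply: cintegrableZ; exact: (cintegrable_entry la1 ma aM).
transitivity (Cint nu (fun z => \sum_x \sum_y c x * conjc (d y) * (a z * b x z * conjc (b y z)))).
  apply: eq_Cint => z; rewrite rmorph_sum mulr_sumr mulr_suml; apply: eq_bigr => x _.
  rewrite mulr_sumr; apply: eq_bigr => y _; rewrite rmorphM; ring.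
rewrite Cint_sum; last by move=> x; apply: cintegrable_sum => y.
apply: eq_bigr => x _; rewrite Cint_sum//; apply: eq_bigr => y _.
by rewrite CintZ ?mxE//; exact: (cintegrable_entry la1 ma aM).
Qed.

(** Change of variable [z -> A z] in the integral, both monomials being expanded by [actE]. *)
Lemma form_act A : Ublk blk A -> {ae nu, forall z, a (A *m z) = a z} ->
  (act A)^T *m form a *m map_mx conjc (act A) = form a.
Proof.
move=> uA aA; apply/matrixP => x y; rewrite [RHS]mxE.
have mab x' y' : measurable_fun setT (fun z => a z * b x' z * conjc (b y' z)).
  by apply: measurable_cM; [apply: measurable_cM => //|apply: measurable_cJ]; exact: measurable_e.
rewrite -(Cint_bnu_unitary la1 uA.1 (mab x y)).
rewrite (ae_eq_Cint (g := fun z => a z * (\sum_x' act A x' x * b x' z) * conjc (\sum_y' act A y' y * b y' z))).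
- rewrite form_sum mxE exchange_big; apply: eq_bigr => y' _.
  rewrite !mxE mulr_suml; apply: eq_bigr => x' _; rewrite !mxE; ring.
- exact: (measurable_comp_mulmx A (mab x y)).
- apply: measurable_cM; first apply: measurable_cM => //; try apply: measurable_cJ;
    by apply: measurable_csum => ?; apply: measurable_cM => //; exact: measurable_e.
- by apply: filterS aA => z az; rewrite az !(actE _ _ uA).
Qed.

End bounded_symbol.

Definition gram_mx : 'M[R[i]]_D := diag_mx (\row_x G x).

Lemma form1 : form (cst 1) = gram_mx.
Proof.
apply/matrixP => x y; rewrite !mxE.
transitivity (Cint nu (fun z => b x z * conjc (b y z))).
  by apply: eq_Cint => z; rewrite mul1r.
have [->|xy] := eqVneq x y; first by rewrite mulr1n.
by rewrite mulr0n e_orthogonal// => /ex_inj xy'; rewrite xy' eqxx in xy.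
Qed.

Lemma gram_act A : Ublk blk A -> (act A)^T *m gram_mx *m map_mx conjc (act A) = gram_mx.
Proof.
move=> uA; rewrite -form1; apply: (form_act (M := 1)) => //.
- by move=> z; rewrite normc1.
- exact: aeW.
Qed.

Definition gram_inv : 'M[R[i]]_D := diag_mx (\row_x (G x)^-1).

Lemma gram_invK : gram_inv *m gram_mx = 1%:M.
Proof.
apply/matrixP => x y; rewrite mul_diag_mx !mxE mulrnAr mulVf ?gram_neq0//.
Qed.

(** [Y Gm X = Gm] exhibits a left inverse of [X]; for square matrices it is also a right inverse,
    and this gives the dual identity, on which the invariance of the kernel rests. *)
Lemma gram_inv_act A : Ublk blk A -> map_mx conjc (act A) *m gram_inv *m (act A)^T = gram_inv.
Proof.
move=> uA; set X := map_mx _ _; set Y := (act A)^T.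
have E1 : gram_inv *m Y *m gram_mx *m X = 1%:M.
  by rewrite -!mulmxA [Y *m _]mulmxA gram_act// gram_invK.
have E2 := mulmx1C E1.
have gK : gram_mx *m gram_inv = 1%:M := mulmx1C gram_invK.
by rewrite !mulmxA in E2; rewrite -[LHS]mulmx1 -gK mulmxA E2 mul1mx.
Qed.

(* The reproducing kernel of the degree [kappa] part, on the diagonal. *)
Definition kernel_diag z := \sum_x b x z * conjc (b x z) / G x.

Lemma measurable_kernel_diag : measurable_fun setT kernel_diag.
Proof.
apply: measurable_csum => x; apply: measurable_cM => //; apply: measurable_cM.
  exact: measurable_e.
by apply: measurable_cJ; exact: measurable_e.
Qed.

Lemma normc_kernel_diag z : normc (kernel_diag z) <= \sum_x normc (G x)^-1.
Proof.
apply: (le_trans (le_normc_sum _ _ _)); apply: ler_sum => x _.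
by rewrite !normcM normcJ ler_piMl ?normc_ge0// mulr_ile1 ?normc_ge0 ?normc_e.
Qed.

(** The coefficients of the kernel in the products [b y z * conjc (b y' z)] are the entries of
    [gram_inv], which the action fixes. *)
Lemma kernel_diag_unitary A z : Ublk blk A -> kernel_diag (A *m z) = kernel_diag z.
Proof.
move=> uA; have E := gram_inv_act uA.
transitivity (\sum_y \sum_y' b y z * conjc (b y' z) *
    (map_mx conjc (act A) *m gram_inv *m (act A)^T) y' y).
  transitivity (\sum_x \sum_y \sum_y' b y z * conjc (b y' z) *
      (conjc (act A y' x) * (G x)^-1 * act A y x)).
    apply: eq_bigr => x _; rewrite (actE _ _ uA) !mulr_suml; apply: eq_bigr => y _.
    rewrite rmorph_sum mulr_sumr mulr_suml; apply: eq_bigr => y' _.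
    by rewrite rmorphM; ring.
  rewrite exchange_big; apply: eq_bigr => y _; rewrite exchange_big; apply: eq_bigr => y' _.
  by rewrite mxE mulr_sumr; apply: eq_bigr => x _; rewrite mul_mx_diag !mxE.
rewrite E; apply: eq_bigr => y _; rewrite (bigD1 y)//= big1 ?addr0 => [|y' yy].
  by rewrite !mxE eqxx mulr1n.
by rewrite !mxE (negbTE yy) mulr0n mulr0.
Qed.

Lemma trace_form (a : V -> R[i]) (M : R) : measurable_fun setT a -> (forall z, normc (a z) <= M) ->
  \sum_x form a x x / G x = Cint nu (fun z => a z * kernel_diag z).
Proof.
move=> ma aM; have ci x : cintegrable nu (fun z => (G x)^-1 * (a z * b x z * conjc (b x z))).
  by apply: cintegrableZ; exact: (cintegrable_entry la1 ma aM).
transitivity (Cint nu (fun z => \sum_x (G x)^-1 * (a z * b x z * conjc (b x z)))).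
  rewrite Cint_sum//; apply: eq_bigr => x _; rewrite CintZ ?mxE 1?mulrC//.
  exact: (cintegrable_entry la1 ma aM).
by apply: eq_Cint => z; rewrite /kernel_diag mulr_sumr; apply: eq_bigr => x _; ring.
Qed.

End block_unitary_action.

(** * Averages over the group *)

Section haar_average.
Context {R : realType} {n : nat} (la : R).
Hypothesis la1 : -1 < la.
Local Notation V := 'cV[R[i]]_n.
Local Notation B := (Bn R n).
Local Notation nu := (@bnu R n la la1).
Variables (H : set 'M[R[i]]_n) (mu : probability 'M[R[i]]_n R).
Hypotheses (mH : measurable H) (uH : forall A, H A -> A \is unitarymx)
  (HJ : forall A, H A -> H (A ^t*)%sesqui) (muH : is_haar_probability H mu).
Implicit Types (f : V -> R[i]) (z : V).

(** The adjoint replaces [invmx] because it is measurable on all matrices, and the integral runs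
    over all of them; on [H], which carries the whole mass, nothing changes. *)
Definition avg f z := Cint mu (fun A => f ((A ^t*)%sesqui *m z)).

Let integral_mu_cst (c : R) : (\int[mu]_A c%:E = c%:E)%E.
Proof.
apply: (etrans (integral_cst mu measurableT c%:E)).
exact: (etrans (congr1 (mule c%:E) (probability_setT mu)) (mule1 _)).
Qed.

Lemma ae_group : {ae mu, forall A, H A}.
Proof.
exists (~` H); split => //; first exact: measurableC.
have := probability_setC mu mH.
have [-> _] := muH; by rewrite subee.
Qed.

Lemma measurable_average_integrand f : measurable_fun setT f ->
  measurable_fun setT (fun p : V * 'M[R[i]]_n => f ((p.2 ^t*)%sesqui *m p.1)).
Proof.
move=> mf; apply: (measurableT_comp mf); apply: measurable_mulmx => //.
exact: measurable_adjoint.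
Qed.

Lemma measurable_average_fixed f z : measurable_fun setT f ->
  measurable_fun setT (fun A : 'M[R[i]]_n => f ((A ^t*)%sesqui *m z)).
Proof.
move=> mf; apply: (measurableT_comp mf); apply: measurable_mulmx => //.
exact: measurable_adjoint.
Qed.

Lemma measurable_avg f : measurable_fun setT f -> measurable_fun setT (avg f).
Proof.
move=> mf; apply: (@measurable_Cint R _ _ V 'M[R[i]]_n mu (fun z A => f ((A ^t*)%sesqui *m z))).
exact: measurable_average_integrand.
Qed.

Lemma ball_adjoint A z : H A -> B z -> B ((A ^t*)%sesqui *m z).
Proof. by move=> HA Bz; rewrite (Bn_unitary _ (uH (HJ HA))). Qed.

Lemma group_average_avg f z : measurable_fun setT (ball_restrict f) -> B z ->
  group_average H mu f z = avg (ball_restrict f) z.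
Proof.
move=> mf Bz.
have key (g : R[i] -> R) : measurable_fun setT (fun A : 'M[R[i]]_n => g (ball_restrict f ((A ^t*)%sesqui *m z))) ->
    \int[mu]_(A in H) g (f (invmx A *m z)) = \int[mu]_A g (ball_restrict f ((A ^t*)%sesqui *m z)).
  move=> mg; transitivity (\int[mu]_(A in H) g (ball_restrict f ((A ^t*)%sesqui *m z))).
    apply: eq_Rintegral => A /set_mem HA; rewrite ball_restrict_in; last exact: ball_adjoint.
    by rewrite invmx_unitary// uH.
  congr fine; rewrite [LHS]integral_mkcond; apply: ae_eq_integral => //.
  - apply/(measurable_restrictT _ mH); apply: measurable_funTS; exact/measurable_EFinP.
  - exact/measurable_EFinP.
  - by apply: filterS ae_group => A HA _; rewrite patchE mem_set.
by apply: complexP; apply: key;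
  [exact: measurable_Re (measurable_average_fixed z mf)|exact: measurable_Im (measurable_average_fixed z mf)].
Qed.

(** The adjoint of [C^* A] is [A^* C], so left invariance of [mu] is applied to [C^*], again an
    element of [H]. *)
Lemma avg_invariant f C z : measurable_fun setT f -> H C -> avg f (C *m z) = avg f z.
Proof.
move=> mf HC; have mfz := measurable_average_fixed z mf.
rewrite /avg -(Cint_invariant (mu := mu) (phi := fun A => (C ^t*)%sesqui *m A) _ _ mfz).
- apply: eq_Cint => A; congr f.
  by rewrite trmx_mul map_mxM trmxCK mulmxA.
- apply: measurable_mulmx => //; exact: measurable_cst.
- by move=> E mE; have [_ h] := muH; exact: (h _ (HJ HC) E mE).
Qed.

Lemma avg_bounded f (M : R) z : measurable_fun setT f -> (forall z, normc (f z) <= M) ->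
  normc (avg f z) <= 2 * M.
Proof.
move=> mf fM; have mfz := measurable_average_fixed z mf.
have ci : cintegrable mu (fun A => f ((A ^t*)%sesqui *m z)) by exact: (@cintegrable_bounded _ _ _ mu _ M).
rewrite -lee_fin; apply: (le_trans (normc_Cint_leE ci)); rewrite EFinM; apply: lee_wpmul2l => //.
apply: (@le_trans _ _ (\int[mu]_A M%:E)%E).
  apply: ge0_le_integral => //.
  - by move=> A _; rewrite lee_fin normc_ge0.
  - exact/measurable_EFinP/measurable_normc.
  - by move=> A _; rewrite lee_fin.
by rewrite integral_mu_cst.
Qed.

(** An average along an orbit could see a null set [N]. But for each [A] in [H] the points sent into
    [N] by the adjoint of [A] form a null set, so by Tonelli, for almost every [z], almost no [A]
    sends [z] into [N]. *)
Lemma avg_ae f g : measurable_fun setT f -> measurable_fun setT g ->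
  {ae lebesgue_Cn R n, forall z, f z = g z} -> {ae lebesgue_Cn R n, forall z, avg f z = avg g z}.
Proof.
move=> mf mg fg; pose N : set V := [set z | f z - g z != 0].
have mN : measurable N.
  rewrite (_ : N = ~` [set z | f z - g z = 0]).
    by apply: measurableC; apply: measurable_eq_cst; apply: measurable_cD => //; exact: measurable_cN.
  by apply/seteqP; split => z /= /eqP.
have N0 : leb N = 0%E.
  have [N' [mN' N'0 sub]] := fg; apply/eqP; rewrite eq_le measure_ge0 andbT -N'0.
  apply: le_measure; rewrite ?inE// => z Nz; apply: sub => /= fgz.
  by move: Nz; rewrite /N /= fgz subrr eqxx.
pose F (p : V * 'M[R[i]]_n) : \bar R := (\1_N ((p.2 ^t*)%sesqui *m p.1))%:E.
have mF : measurable_fun setT F.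
  apply/measurable_EFinP; apply: (measurableT_comp (f := \1_N : V -> R)).
    exact: measurable_indic.
  apply: measurable_mulmx => //; exact: measurable_adjoint.
have F0 p : (0 <= F p)%E by rewrite lee_fin.
have FT := fubini_tonelli (m1 := @leb R n) (m2 := mu) F mF F0.
have I0 : (\int[mu]_A \int[@leb R n]_z F (z, A) = 0)%E.
  rewrite -[RHS](integral0 mu setT); apply: ae_eq_integral => //.
    exact: measurable_fun_fubini_tonelli_G.
  apply: filterS ae_group => A HA _.
  rewrite /F /=; transitivity (leb ((fun z => (A ^t*)%sesqui *m z) @^-1` N)).
    rewrite leb_indic; last first.
      rewrite -[_ @^-1` _]setTI; apply: (measurable_mulmx (f := fun=> (A ^t*)%sesqui) (g := id)) => //.
    by apply: eq_integral => z _; rewrite !indicE.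
  by rewrite leb_unitary// uH//; exact: HJ.
rewrite I0 in FT.
have mFF : measurable_fun setT (fun z => \int[mu]_A F (z, A))%E by exact: measurable_fun_fubini_tonelli_F.
have := (ae_eq_integral_abs (@leb R n) measurableT mFF).1.
under eq_integral do rewrite gee0_abs ?integral_ge0//.
move=> /(_ FT); apply: filterS => z /(_ I) Fz.
have mFz : measurable_fun setT (fun A => F (z, A)) by exact: (measurableT_comp mF (pair1_measurable z)).
have := (ae_eq_integral_abs mu measurableT mFz).1.
under eq_integral do rewrite gee0_abs//.
move=> /(_ Fz) H0.
apply: ae_eq_Cint; [exact: measurable_average_fixed|exact: measurable_average_fixed|].
apply: filterS H0 => A /(_ I) [] /eqP; rewrite indicE.
have [//|/negP nN _] := boolP (_ \in N); first by rewrite (eqr_nat R 1 0).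
apply/eqP; rewrite -subr_eq0; apply/negPn/negP => h; apply: nN; exact/mem_set.
Qed.

(** After Fubini, for each [A] in [H] the unitary substitution and the invariance of [K] remove [A]
    from the inner integral; it is then constant on [H], and [mu] has mass 1. *)
Lemma Cint_avg f (K : V -> R[i]) (M L : R) : measurable_fun setT f -> measurable_fun setT K ->
  (forall z, normc (f z) <= M) -> (forall z, normc (K z) <= L) ->
  (forall A z, H A -> K (A *m z) = K z) ->
  Cint nu (fun z => avg f z * K z) = Cint nu (fun z => f z * K z).
Proof.
move=> mf mK fM KL Kinv.
pose F z A := f ((A ^t*)%sesqui *m z) * K z.
have mF : measurable_fun setT (fun p : V * 'M[R[i]]_n => F p.1 p.2).
  by apply: measurable_cM; [exact: measurable_average_integrand|apply: (measurableT_comp mK)].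
have FML z A : normc (F z A) <= M * L by rewrite normcM ler_pM ?normc_ge0.
have c1 z : cintegrable mu (F z).
  by apply: (@cintegrable_bounded _ _ _ mu _ (M * L)) => //; exact: (measurableT_comp mF (pair1_measurable z)).
have c2 A : cintegrable nu (F^~ A).
  by apply: (@cintegrable_bounded _ _ _ nu _ (M * L)) => //; exact: (measurableT_comp mF (pair2_measurable A)).
have cst_fin (c : R) d (T : measurableType d) (m : {finite_measure set T -> \bar R}) : 0 <= c ->
    (\int[m]_x c%:E < +oo)%E.
  by move=> c0; rewrite integral_cst// lte_mul_pinfty//; exact: fin_num_fun_lty.
have ML0 : 0 <= M * L by apply: le_trans (FML 0 0); exact: normc_ge0.
have fin : (\int[nu]_z \int[mu]_A (normc (F z A))%:E < +oo)%E.
  apply: le_lt_trans (cst_fin (M * L) _ _ nu ML0); apply: ge0_le_integral => //.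
  - by move=> z _; apply: integral_ge0 => A _; rewrite lee_fin normc_ge0.
  - apply: (@measurable_fun_fubini_tonelli_F _ _ _ _ R mu (fun p => (normc (F p.1 p.2))%:E)) => //.
      exact/measurable_EFinP/measurable_normc.
    by move=> p; rewrite lee_fin normc_ge0.
  - move=> z _; apply: (@le_trans _ _ (\int[mu]_A (M * L)%:E)%E).
      apply: ge0_le_integral => //.
      - by move=> A _; rewrite lee_fin normc_ge0.
      - by apply/measurable_EFinP/measurable_normc; case: (c1 z).
      - by move=> A _; rewrite lee_fin.
    by rewrite integral_mu_cst.
transitivity (Cint nu (fun z => Cint mu (F z))).
  apply: eq_Cint => z; rewrite /avg mulrC -CintZ.
    by apply: eq_Cint => A; rewrite mulrC.
  by apply: (@cintegrable_bounded _ _ _ mu _ M) => //; exact: measurable_average_fixed.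
rewrite (Cint_fubini mF c1 c2 fin).
set I0 := Cint nu (fun z => f z * K z).
have mG : measurable_fun setT (fun A => Cint nu (F^~ A)).
  apply: (@measurable_Cint R _ _ 'M[R[i]]_n V nu (fun A z => F z A)).
  apply: measurable_cM; last by apply: (measurableT_comp mK).
  apply: (measurableT_comp mf); apply: measurable_mulmx => //; exact: measurable_adjoint.
rewrite (ae_eq_Cint (g := fun=> I0) mG (measurable_cst _)).
  by apply: complexP; rewrite /Cintegral/= /Rintegral integral_mu_cst.
apply: filterS ae_group => A HA.
have mfK : measurable_fun setT (fun z => f z * K z) by exact: measurable_cM.
rewrite /I0 -(Cint_bnu_unitary la1 (uH (HJ HA)) mfK); apply: eq_Cint => z.
by rewrite /F (Kinv _ _ (HJ HA)).
Qed.

End haar_average.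

(** * Invariant symbols *)

Section invariant_symbol.
Context {R : realType} {n m : nat} (blk : 'I_n -> 'I_m) (la : R).
Hypothesis la1 : -1 < la.
Local Notation V := 'cV[R[i]]_n.
Local Notation B := (Bn R n).
Local Notation nu := (@bnu R n la la1).
Local Notation e p := (ball_restrict (mono p) : V -> R[i]).
Variables (kappa : 'I_m -> nat) (D : nat) (ex : 'I_D -> 'I_n -> nat).
Hypotheses (ex_inj : injective ex) (exP : forall p, has_degree blk kappa p <-> exists x, p = ex x).
(** One coordinate chosen in each block; this is where it matters that the blocks are nonempty. *)
Variable r : 'I_m -> 'I_n.
Hypothesis blk_r : forall j, blk (r j) = j.
Implicit Types (A : 'M[R[i]]_n) (z : V) (x y : 'I_D).
Local Notation b x := (e (ex x)).
Local Notation G x := (gram la1 (ex x)).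

(* The monomial carried by one coordinate per block detects, at a point supported on these
   coordinates, the coefficients of [b x \o A]. *)
Lemma act_nonvanishing : exists2 y, b y <> cst 0 &
  exists2 A, Ublk blk A & forall x, act la1 ex A y x != 0.
Proof.
pose conc a := if a == r (blk a) then kappa (blk a) else 0%N.
have [y yE] : exists y, conc = ex y.
  apply/exP => j; rewrite (bigD1 (r j)) ?blk_r//= {1}/conc blk_r eqxx big1 ?addn0// => a.
  by move=> /andP[/eqP <- ar]; rewrite /conc (negbTE ar).
have [s s0 sB] := @box_sub_ball R n.
have s2 : 0 < s / 2 by rewrite divr_gt0.
have s2n : (s / 2)%:C%C != 0 :> R[i] by rewrite -normc_eq0 normc_real normr_eq0 gt_eqF.
pose w : V := \col_a (if a == r (blk a) then (s / 2)%:C%C else 0).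
have Bw : B w.
  apply: sB => a; rewrite mxE; case: ifP => _ /=; rewrite !normr0 ?s0//.
  by rewrite ger0_norm ?(ltW s2)//; split => //; rewrite ltr_pdivrMr// ltr_pMr// (ltr_nat R 1).
have byw : b y w != 0.
  rewrite ball_restrict_in// -yE; apply/prodf_neq0 => a _; rewrite mxE /conc.
  by case: ifP => _; rewrite ?expr0 ?oner_neq0// expf_neq0.
exists y; first by move=> b0; rewrite b0 eqxx in byw.
have [A uA A0] := @Ublk_nonvanishing R n m blk; exists A => // x.
(* Coordinate [a] of [A w] reduces to [A a (r (blk a))] times [s/2], so no coordinate vanishes.
   Among the monomials of degree [kappa] only [b y] is nonzero at [w], hence [b x (A w)] is
   [act A y x] times [b y w]. *)
have bAw : b x (A *m w) != 0.
  rewrite ball_restrict_in ?(Bn_unitary _ uA.1)//; apply/prodf_neq0 => a _; apply: expf_neq0.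
  rewrite mxE (bigD1 (r (blk a)))//= big1 ?addr0 => [|c ca].
    by rewrite mxE blk_r eqxx mulf_neq0// A0// blk_r.
  rewrite mxE; case: eqP => cr; last by rewrite mulr0.
  by rewrite uA.2 ?mul0r//; apply: contraNneq ca => ac; rewrite cr ac.
apply: contraNneq bAw => Dy0.
rewrite (actE la1 ex_inj exP x w uA) (bigD1 y)//= Dy0 mul0r add0r big1// => y' y'y.
rewrite ball_restrict_in// (_ : mono _ w = 0) ?mulr0//.
have [a ar ya] : exists2 a, a != r (blk a) & (0 < ex y' a)%N.
  apply: contrapT => H; move/negP: y'y; apply; apply/eqP/ex_inj; rewrite -yE.
  have y0 a : a != r (blk a) -> ex y' a = 0%N.
    by move=> ar; apply/eqP; rewrite -leqn0 leqNgt; apply/negP => ya; apply: H; exists a.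
  apply/funext => a; rewrite /conc; case: eqP => [ar|/eqP]; last exact: y0.
  rewrite -(ex_degree exP y' (blk a)) (bigD1 a)//= big1 ?addn0// => c /andP[/eqP ca cna].
  by apply: y0; rewrite ca -ar.
by rewrite /mono (bigD1 a)//= mxE (negbTE ar) expr0n -leqn0 leqNgt ya mul0r.
Qed.

Variables (a : V -> R[i]) (M : R).
Hypotheses (ma : measurable_fun setT a) (aM : forall z, normc (a z) <= M)
  (a_inv : forall A z, Ublk blk A -> a (A *m z) = a z).

Lemma form_offdiag x y : x != y -> form la1 ex a x y = 0.
Proof.
move=> xy; have /(@separating_torus R)[w w1 wE] : ex x <> ex y.
  by move=> /ex_inj xy'; rewrite xy' eqxx in xy.
rewrite mxE; apply: (@Cint_e_eq0 R n la la1 w (fun z => a z * b x z) M (\prod_i w i ^+ ex x i)) => //.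
- by apply: measurable_cM => //; exact: measurable_e.
- by move=> z; rewrite normcM; apply: le_trans (aM z); rewrite ler_piMr ?normc_ge0 ?normc_e.
- by apply: aeW => z; rewrite (a_inv _ (dmx_Ublk blk w1)) e_dmx// mulrCA.
Qed.

(* The form of [a] and the Gram form are both diagonal and invariant under the action, so the
   ratio [c] of their diagonals commutes with it; a matrix of the action with a row
   without zeros then forces [c] to be constant. *)
Lemma form_scalar : exists c, form la1 ex a = c *: gram_mx la1 ex.
Proof.
have [y _ [A uA Ay0]] := act_nonvanishing.
pose c x := form la1 ex a x x / G x.
pose C := diag_mx (\row_x c x) : 'M[R[i]]_D.
set X := map_mx conjc (act la1 ex A); set Y := (act la1 ex A)^T; set Gm := gram_mx la1 ex.
have FE : form la1 ex a = Gm *m C.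
  apply/matrixP => x x'; rewrite mul_diag_mx !mxE.
  have [<-|xx'] := eqVneq x x'; last by rewrite mulr0n mulr0 -(form_offdiag xx') mxE.
  by rewrite mulr1n /c mxE mulrCA divff ?mulr1// gram_neq0.
have eF : Y *m (Gm *m C) *m X = Gm *m C.
  by rewrite -FE; apply: (@form_act R n m blk la la1 kappa D ex ex_inj exP a M ma aM A uA); apply: aeW => z; exact: a_inv.
have eG : Y *m Gm *m X = Gm := gram_act la1 ex_inj exP uA.
have gK : gram_inv la1 ex *m Gm = 1%:M := gram_invK la1 ex.
have XY : X *m (gram_inv la1 ex *m Y *m Gm) = 1%:M.
  by apply: mulmx1C; rewrite -!mulmxA [Y *m _]mulmxA eG gK.
(* Multiply the invariance of [Gm C] on the left by [X gram_inv]: on one side [XY] leaves [C X], on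
   the other [gK] leaves [X C]. *)
have CX : C *m X = X *m C.
  have : X *m gram_inv la1 ex *m (Y *m (Gm *m C) *m X) = X *m gram_inv la1 ex *m (Gm *m C) by rewrite eF.
  rewrite -[RHS]mulmxA [gram_inv la1 ex *m (Gm *m C)]mulmxA gK mul1mx => <-.
  by rewrite -[LHS]mul1mx -XY !mulmxA.
(* Entry [(y, x)] of [C X = X C] reads [c y * X y x = X y x * c x], and row [y] of [X] has no
   zero. *)
have cE x : c x = c y.
  have := congr1 (fun N : 'M[R[i]]_D => N y x) CX; rewrite /= mul_diag_mx mul_mx_diag !mxE.
  rewrite mulrC => /(mulfI _) ->//.
  by rewrite conjc_eq0; have := Ay0 x; rewrite mxE.
exists (c y); rewrite FE; apply/matrixP => x x'; rewrite mul_mx_diag !mxE cE.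
by rewrite mulrC.
Qed.

(** The scalar is determined only on a nonzero space, and the division needs a nonzero dimension;
    [act_nonvanishing] supplies a nonzero vector for both. *)
Lemma scalar_on_trace (a0 : V -> R[i]) : measurable_fun B a0 ->
  {ae lebesgue_Cn R n, forall z, B z -> a0 z = a z} ->
  scalar_on (Pdeg blk kappa) (toeplitz la a0) =
  trace_on (Pdeg blk kappa) (toeplitz la a0) / (fin_dim (Pdeg blk kappa : set (V -> R[i])))%:R.
Proof.
move=> ma0 a0a; have [y by0 _] := act_nonvanishing.
have bP : is_basis (Pdeg blk kappa) (fun x => b x : V -> R[i]) := basis_Pdeg la1 ex_inj exP.
have at_ t : (forall j, normc (t j) = 1) ->
    {ae nu, forall z, a (dmx (fun a => t (blk a)) *m z) = a z}.
  by move=> t1; apply: aeW => z; apply: a_inv; exact: dmx_Ublk.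
have [c cE] := form_scalar.
have TE : toeplitz_mx la1 ex a = c%:M.
  apply/matrixP => x x'; rewrite !mxE /entry.
  have := congr1 (fun N : 'M[R[i]]_D => N x' x) cE; rewrite /= !mxE => ->.
  have [->|xx'] := eqVneq x' x; first by rewrite !mulr1n mulfK ?gram_neq0.
  by rewrite !mulr0n mulr0 mul0r.
have D0 : D%:R != 0 :> R[i] by rewrite pnatr_eq0; case: (D) y {by0} => // -[].
rewrite (fin_dim_basis bP) (trace_toeplitz ex_inj exP ma0 a0a ma aM at_).
transitivity c.
  apply: (scalar_on_eq (x := b y)) => [||f].
  - exact: (basis_in y bP).
  - by apply/eqP => b0; apply: by0.
  - rewrite -bP.2 => /lin_span_range[d ->].
    rewrite (toeplitz_sum ex_inj exP ma0 a0a ma aM at_) TE scaler_sumr.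
    apply: eq_bigr => x _; rewrite /comb (bigD1 x)//= big1 ?addr0 => [|x' xx'].
      by rewrite mxE eqxx mulr1n !scalerA mulrC.
    by rewrite mxE (negbTE xx') mulr0n scale0r.
apply: (mulIf D0); rewrite divfK// mulr_natr -[D in LHS]card_ord -sumr_const.
apply: eq_bigr => x _; have := congr1 (fun N : 'M[R[i]]_D => N x x) TE.
by rewrite /= !mxE eqxx mulr1n.
Qed.

End invariant_symbol.

Lemma ae_unitary {R : realType} n (U : 'M[R[i]]_n) (P : 'cV[R[i]]_n -> Prop) : U \is unitarymx ->
  {ae lebesgue_Cn R n, forall z, P z} -> {ae lebesgue_Cn R n, forall z, P (U *m z)}.
Proof.
move=> uU [N [mN N0 PN]]; exists ((fun z => U *m z) @^-1` N); split.
- rewrite -[_ @^-1` _]setTI; apply: (measurable_mulmx (f := fun=> U) (g := id)) => //.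
- by have := leb_unitary uU mN; rewrite /leb N0.
- by move=> z Pz; apply: PN.
Qed.

Lemma trace_kernel_diag {R : realType} {n m : nat} (blk : 'I_n -> 'I_m) (la : R) (la1 : -1 < la)
    (kappa : 'I_m -> nat) D (ex : 'I_D -> 'I_n -> nat) (a a' : 'cV[R[i]]_n -> R[i]) (M : R) :
  injective ex -> (forall p, has_degree blk kappa p <-> exists x, p = ex x) ->
  measurable_fun (Bn R n) a -> {ae lebesgue_Cn R n, forall z, Bn R n z -> a z = a' z} ->
  measurable_fun setT a' -> (forall z, normc (a' z) <= M) ->
  (forall t, (forall j, normc (t j) = 1) ->
    {ae (@bnu R n la la1), forall z, a' (dmx (fun a => t (blk a)) *m z) = a' z}) ->
  trace_on (Pdeg blk kappa) (toeplitz la a) =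
  Cint (@bnu R n la la1) (fun z => a' z * kernel_diag la1 ex z).
Proof.
move=> ex_inj exP ma aa' ma' aM at_.
rewrite (trace_toeplitz ex_inj exP ma aa' ma' aM at_) -(trace_form la1 ex ma' aM).
by apply: eq_bigr => x _; rewrite mxE.
Qed.

Lemma ae_unitary_invariant {R : realType} n (U : 'M[R[i]]_n) (a a' : 'cV[R[i]]_n -> R[i]) :
  U \is unitarymx -> (forall z, ~ Bn R n z -> a' z = 0) ->
  {ae lebesgue_Cn R n, forall z, Bn R n z -> a z = a' z} ->
  {ae lebesgue_Cn R n, forall z, Bn R n z -> a (U *m z) = a z} ->
  {ae lebesgue_Cn R n, forall z, a' (U *m z) = a' z}.
Proof.
move=> uU a'0 aa' aU; apply: filterS3 aa' aU (ae_unitary uU aa') => z h1 h2 h3.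
have BU := Bn_unitary z uU; have [Bz|nBz] := pselect (Bn R n z).
  by rewrite -h3 ?h2 ?h1// BU.
by rewrite !a'0// BU.
Qed.

Lemma Uk_Ublk {R : realType} {m : nat} (k : 'I_m -> nat) :
  Uk R k = Ublk (@tagnat.sig1 m k) :> set 'M[R[i]]_(\sum_j k j).
Proof. by apply/seteqP; split => A /UkP. Qed.

Lemma Pk_Pdeg {R : realType} {m : nat} (k kappa : 'I_m -> nat) :
  Pk R k kappa = Pdeg (@tagnat.sig1 m k) kappa.
Proof.
congr lin_span; apply/seteqP; split => f [p hp <-]; exists p => //= j.
  by rewrite -sum_block; exact: hp.
by rewrite sum_block; exact: hp.
Qed.

Theorem theorem5p3 (R : realType) (m : nat) (k : 'I_m -> nat)
    (k_gt0 : forall j, (0 < k j)%N)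
    (a : 'cV[R[i]]_(\sum_j k j)%N -> R[i])
    (a_inv : Linfty_invariant (Tm R k) a)
    (mu : probability 'M[R[i]]_(\sum_j k j)%N R)
    (mu_haar : is_haar_probability (Uk R k) mu) :
  let ahat := group_average (Uk R k) mu a in
  Linfty_invariant (Uk R k) ahat /\
  forall lambda : R, -1 < lambda ->
    (forall kappa : 'I_m -> nat,
       trace_on (Pk R k kappa) (toeplitz lambda a) =
       trace_on (Pk R k kappa) (toeplitz lambda ahat)) /\
    (forall kappa : 'I_m -> nat,
       gamma k lambda ahat kappa =
       trace_on (Pk R k kappa) (toeplitz lambda a) / (fin_dim (Pk R k kappa))%:R).
Proof.
set H := Uk R k; move=> ahat.
pose blk := @tagnat.sig1 m k.
have HE : H = Ublk blk := Uk_Ublk k.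
have uH A : H A -> A \is unitarymx by rewrite HE => -[].
have HJ A : H A -> H (A ^t*)%sesqui by rewrite HE; exact: Ublk_adjoint.
have mH : measurable H by rewrite HE; exact: measurable_Ublk.
have [La at_] := a_inv; have [ma _] := La.
have [a' [ma' [M aM] a'0 aa']] := bounded_representative La.
have mb := measurable_ball_restrict ma.
have bM z : normc (avg mu a' z) <= 2 * M by exact: avg_bounded.
have mavg' := measurable_avg mu ma'.
(* The equality holds at every point of the ball for the restricted [a]; replacing it by [a'] under
   the average costs a null set, as [hat'] records. *)
have ahatE z : Bn R _ z -> ahat z = avg mu (ball_restrict a) z.
  by move=> Bz; exact: (group_average_avg mH uH HJ mu_haar).
have mhat : measurable_fun (Bn R _) ahat.
  apply: (@eq_measurable_fun _ _ _ _ _ (avg mu (ball_restrict a))).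
    by move=> z /set_mem Bz; rewrite ahatE.
  by apply: measurable_funTS; exact: measurable_avg.
have hat' : {ae lebesgue_Cn R (\sum_j k j)%N, forall z, Bn R _ z -> ahat z = avg mu a' z}.
  have : {ae lebesgue_Cn R (\sum_j k j)%N, forall z, ball_restrict a z = a' z}.
    apply: filterS aa' => z az; have [Bz|nBz] := pselect (Bn R _ z).
      by rewrite ball_restrict_in// az.
    by rewrite ball_restrict_out// a'0.
  move=> /(avg_ae mH uH HJ mu_haar mb ma'); apply: filterS => z h Bz.
  by rewrite ahatE.
have avg_inv A z : Ublk blk A -> avg mu a' (A *m z) = avg mu a' z.
  by rewrite -HE => HA; exact: (avg_invariant HJ mu_haar).
split.
  split; first by split => //; exists (2 * M); apply: filterS hat' => z h Bz; rewrite h.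
  (* By [ahatE] the invariance of [ahat] holds at every point of the ball, not merely almost
     everywhere. *)
  move=> A HA; apply: aeW => z Bz; rewrite !ahatE ?(Bn_unitary _ (uH _ HA))//.
  exact: (avg_invariant HJ mu_haar).
move=> la la1; pose nu := @bnu R (\sum_j k j)%N la la1.
have a't t : (forall j, normc (t j) = 1) ->
    {ae nu, forall z, a' (dmx (fun a => t (blk a)) *m z) = a' z}.
  move=> t1; apply: ae_bnu; apply: (ae_unitary_invariant _ a'0 aa'); first exact: dmx_unitary.
  by apply: at_; apply/TmP; exists t.
have hat't t : (forall j, normc (t j) = 1) ->
    {ae nu, forall z, avg mu a' (dmx (fun a => t (blk a)) *m z) = avg mu a' z}.
  by move=> t1; apply: aeW => z; apply: avg_inv; exact: dmx_Ublk.
have traceE kappa : trace_on (Pk R k kappa) (toeplitz la a) = trace_on (Pk R k kappa) (toeplitz la ahat).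
  have [D [ex [ex_inj exP]]] := exponents blk kappa.
  rewrite Pk_Pdeg (trace_kernel_diag ex_inj exP ma aa' ma' aM a't).
  rewrite (trace_kernel_diag ex_inj exP mhat hat' mavg' bM hat't).
  apply/esym; apply: (Cint_avg la1 mH uH HJ mu_haar (M := M) (L := \sum_x normc (gram la1 (ex x))^-1)) => //.
  - exact: measurable_kernel_diag.
  - exact: normc_kernel_diag.
  - by move=> A z; rewrite HE => HA; exact: (kernel_diag_unitary la1 ex_inj exP).
split=> // kappa; rewrite traceE /gamma Pk_Pdeg.
have [D [ex [ex_inj exP]]] := exponents blk kappa.
apply: (scalar_on_trace la1 ex_inj exP (r := fun j => tagnat.Rank j (Ordinal (k_gt0 j))) _ mavg' bM avg_inv mhat hat').
by move=> j; exact: tagnat.Rank1K.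
Qed.
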